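(* Assume that the physical constants and the control parameters $\epsilon_1,\epsilon_2$ satisfy the structural assumption (S) given in the context. For $X_0\in D(\mathcal{A})$ let $X(t)=T(t)X_0$ and define the augmented energy $\mathcal{E}(t)=\frac12\|X(t)\|_{\mathcal{H},2}^2$, $t\ge0$. Then the augmented energy decays exponentially to zero: there exists $\Lambda>0$ such that, for every $X_0\in D(\mathcal{A})$, $$\forall t\ge0,\quad \mathcal{E}(t)\le\mathcal{E}(0)\exp(-\Lambda t).$$ Furthermore, $T(t)$ is an exponentially stable $C_0$-semigroup for $\|\cdot\|_{\mathcal{H},2}$.
   Context: Constants: $l,\rho,I_w,m_s,J_s,c_\omega,c_\phi,\eta_\omega,\eta_\phi,k_1,k_2,\epsilon_1,\epsilon_2$ are positive real numbers, $x_c\in\mathbb{R}$, and $\alpha_\omega,\beta_\omega,\gamma_\omega,\alpha_\phi,\beta_\phi,\gamma_\phi\ge 0$. Put $I_w^*=I_w+\rho x_c^2$, $J_s^*=J_s+m_sx_c^2$, and define the symmetric positive definite matrices $M=\begin{bmatrix}\rho&\rho x_c\\ \rho x_c&I_w^*\end{bmatrix}$, $M_s=\begin{bmatrix}m_s&m_sx_c\\ m_sx_c&J_s^*\end{bmatrix}$. $\lambda_m(\cdot)$ denotes the smallest eigenvalue. Spaces: $H^m(0,l)$ is the usual real Sobolev space of functions in $L^2(0,l)$ with $m$ weak derivatives in $L^2(0,l)$, $\mathrm{AC}[0,l]$ is the set of absolutely continuous functions on $[0,l]$, and $H_L^m(0,l)=\{f\in H^m(0,l): f(0)=f'(0)=\dots=f^{(m-1)}(0)=0\}$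 (elements of $H^1(0,l)$ are identified with their absolutely continuous representatives). Let $\mathcal{H}=H_L^2(0,l)\times L^2(0,l)\times H_L^1(0,l)\times L^2(0,l)\times\mathbb{R}\times\mathbb{R}$. For $X_i=(f_i,g_i,h_i,z_i,\zeta_{\omega,i},\zeta_{\phi,i})\in\mathcal{H}$ define $$\langle X_1,X_2\rangle_{\mathcal{H},1}=\int_0^l\big[\rho c_\omega^2f_1''f_2''+I_wc_\phi^2h_1'h_2'\big]dy+\int_0^l\begin{bmatrix}g_1\\ z_1\end{bmatrix}^\top M\begin{bmatrix}g_2\\ z_2\end{bmatrix}dy+\begin{bmatrix}\zeta_{\omega,1}\\ \zeta_{\phi,1}\end{bmatrix}^\top M_s\begin{bmatrix}\zeta_{\omega,2}\\ \zeta_{\phi,2}\end{bmatrix},$$ $$\Psi(X_1,X_2)=\int_0^l\Big(\begin{bmatrix}g_1\\ z_1\end{bmatrix}^\top M\begin{bmatrix}\epsilon_1f_2\\ \epsilon_2h_2\end{bmatrix}+\begin{bmatrix}g_2\\ z_2\end{bmatrix}^\top M\begin{bmatrix}\epsilon_1f_1\\ \epsilon_2h_1\end{bmatrix}\Big)dy+\begin{bmatrix}\zeta_{\omega,1}\\ \zeta_{\phi,1}\end{bmatrix}^\top M_s\begin{bmatrix}\epsilon_1f_2(l)\\ \epsilon_2h_2(l)\end{bmatrix}+\begin{bmatrix}\zeta_{\omega,2}\\ \zeta_{\phi,2}\end{bmatrix}^\top M_s\begin{bmatrix}\epsilon_1f_1(l)\\ \epsilon_2h_1(l)\end{bmatrix},$$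 and $\langle X_1,X_2\rangle_{\mathcal{H},2}=\langle X_1,X_2\rangle_{\mathcal{H},1}+\Psi(X_1,X_2)$ (for $\epsilon_i\in(0,K_{m,i})$ this is an inner product on $\mathcal{H}$ whose norm $\|\cdot\|_{\mathcal{H},2}$ is equivalent to $\|\cdot\|_{\mathcal{H},1}$). Thresholds (if $x_c=0$, terms with $|x_c|$ as a factor of the denominator are read as $+\infty$, i.e. omitted): $$K_{m,1}=\min\Big(\tfrac{\pi^4\rho c_\omega^2}{4l^3(1+|x_c|)\{4l\rho^{3/2}c_\omega+\pi^2m_s\}},\tfrac{c_\omega\lambda_m(M)}{2\sqrt\rho},\tfrac{c_\omega\lambda_m(M)}{2\sqrt\rho|x_c|},\tfrac{\lambda_m(M_s)}{2m_s},\tfrac{\lambda_m(M_s)}{2m_s|x_c|}\Big),$$ $$K_{m,2}=\min\Big(\tfrac{\pi^2I_wc_\phi^2}{4l^2(I_w^*+\rho|x_c|)\sqrt{I_w}c_\phi+\pi^2l(J_s^*+m_s|x_c|)},\tfrac{\sqrt{I_w}c_\phi\lambda_m(M)}{2\rho|x_c|},\tfrac{\sqrt{I_w}c_\phi\lambda_m(M)}{2I_w^*},\tfrac{\lambda_m(M_s)}{2m_s|x_c|},\tfrac{\lambda_m(M_s)}{2J_s^*}\Big),$$ $$\epsilon_1^*=\min\Big(\tfrac{\pi^2I_w\eta_\phi c_\phi^2}{l|x_c|(4l\rho+\pi^2m_s)},\tfrac{2\pi^4\rho\eta_\omega c_\omega^2}{32l^4(2+|x_c|)\rho+8\pi^2l^3(2+|x_c|)m_s+\pi^4\rho\eta_\omega^2c_\omega^2}\Big),$$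 $$\epsilon_2^*=\min\Big(\tfrac{\pi^4\rho\eta_\omega c_\omega^2}{4l^3|x_c|(4l\rho+\pi^2m_s)},\tfrac{2\pi^2I_w\eta_\phi c_\phi^2}{8l^2(2I_w^*+|x_c|\rho)+2\pi^2l(2J_s^*+|x_c|m_s)+\pi^2I_w\eta_\phi^2c_\phi^2}\Big).$$ Operators: $D(\mathcal{A})=D(\mathcal{A}_1)$ is the set of $(f,g,h,z,\zeta_\omega,\zeta_\phi)\in\mathcal{H}$ such that $g\in H_L^2(0,l)$, $z\in H_L^1(0,l)$, $f''+\eta_\omega g''\in H^2(0,l)$, $h'+\eta_\phi z'\in H^1(0,l)$, $(f''+\eta_\omega g'')(l)=0$, $\zeta_\omega=g(l)$, $\zeta_\phi=z(l)$, and $f,f',g,g',h,z,(f''+\eta_\omega g''),(f''+\eta_\omega g'')',(h'+\eta_\phi z')\in\mathrm{AC}[0,l]$. On it, $\mathcal{A}=\mathcal{A}_1+\mathcal{A}_2$, where $\mathcal{A}_1(f,g,h,z,\zeta_\omega,\zeta_\phi)=(g,\tilde g,z,\tilde z,\tilde\zeta_\omega,\tilde\zeta_\phi)$ with $$\begin{bmatrix}\tilde g\\ \tilde z\end{bmatrix}=-M^{-1}\begin{bmatrix}\rho c_\omega^2(f''+\eta_\omega g'')''\\ -I_wc_\phi^2(h'+\eta_\phi z')'\end{bmatrix},\qquad \begin{bmatrix}\tilde\zeta_\omega\\ \tilde\zeta_\phi\end{bmatrix}=M_s^{-1}\begin{bmatrix}\rho c_\omega^2(f''+\eta_\omega g'')'(l)-k_1(g(l)+\epsilon_1f(l))\\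 -I_wc_\phi^2(h'+\eta_\phi z')(l)-k_2(z(l)+\epsilon_2h(l))\end{bmatrix},$$ and $\mathcal{A}_2(f,g,h,z,\zeta_\omega,\zeta_\phi)=(0,\tilde F_a,0,\tilde M_a,0,0)$ with $$\begin{bmatrix}\tilde F_a\\ \tilde M_a\end{bmatrix}=M^{-1}\begin{bmatrix}\alpha_\omega h+\beta_\omega z+\gamma_\omega g\\ \alpha_\phi h+\beta_\phi z+\gamma_\phi g\end{bmatrix}.$$ When $0<\epsilon_i<\min(\epsilon_i^*,K_{m,i})$, $i=1,2$, the operator $\mathcal{A}$ generates a $C_0$-semigroup on $\mathcal{H}$, denoted $T(t)$; for $X_0\in D(\mathcal{A})$, $X(t)=T(t)X_0\in D(\mathcal{A})$ is the unique solution of $\dot X=\mathcal{A}X$, $X(0)=X_0$. Exponentially stable means $\|T(t)\|\le Ce^{-\delta t}$ for all $t\ge 0$, for some $C,\delta>0$. Structural assumption (S): $0<\epsilon_1<\min(\epsilon_1^*,K_{m,1})$, $0<\epsilon_2<\min(\epsilon_2^*,K_{m,2})$, and there exist $r_1,\dots,r_8>0$ such that the quantities $$\lambda_1=\epsilon_1\Big(1-\tfrac{\eta_\omega}{2r_1}-\tfrac{8l^4}{\pi^4\rho c_\omega^2}\big(\tfrac{\alpha_\omega}{r_4}+\tfrac{\beta_\omega}{r_5}+\tfrac{\gamma_\omega}{r_3}\big)\Big),$$ $$\lambda_2=\gamma_\omega+\tfrac{\alpha_\omega+\epsilon_2\gamma_\phi}{2r_6}+\tfrac{\epsilon_1\gamma_\omega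 r_3}{2}+\tfrac{\beta_\omega+\gamma_\phi}{2r_7}\ (\ge0),$$ $$\lambda_3=\rho\Big\{\eta_\omega c_\omega^2-\epsilon_2\tfrac{2l^3|x_c|}{\pi^2}\big(\tfrac{4l}{\pi^2}+\tfrac{m_s}{\rho}\big)-\epsilon_1\big(\tfrac{8l^4(2+|x_c|)}{\pi^4}+\tfrac{\eta_\omega c_\omega^2r_1}{2}+\tfrac{2l^3(2+|x_c|)m_s}{\pi^2\rho}\big)\Big\},$$ $$\lambda_4=\epsilon_2\big(1-\tfrac{\eta_\phi}{2r_2}\big)-\tfrac{4l^2}{\pi^2I_wc_\phi^2}\Big(\tfrac{(\alpha_\omega+\epsilon_2\gamma_\phi)r_6}{2}+\tfrac{\alpha_\phi+\epsilon_2\beta_\phi}{2r_8}+\tfrac{\epsilon_1\alpha_\omega r_4}{2}+\epsilon_2\alpha_\phi\Big),$$ $$\lambda_5=\beta_\phi+\tfrac{(\beta_\omega+\gamma_\phi)r_7}{2}+\tfrac{(\alpha_\phi+\epsilon_2\beta_\phi)r_8}{2}+\tfrac{\epsilon_1\beta_\omega r_5}{2}\ (\ge0),$$ $$\lambda_6=I_w\Big\{\eta_\phi c_\phi^2-\epsilon_1\tfrac{l|x_c|}{I_w}\big(\tfrac{2l\rho}{\pi^2}+\tfrac{m_s}{2}\big)-\epsilon_2\big(2l^2\tfrac{2I_w^*+|x_c|\rho}{\pi^2I_w}+\tfrac{\eta_\phi c_\phi^2r_2}{2}+\tfrac{l(2J_s^*+|x_c|m_s)}{2I_w}\big)\Big\}$$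 satisfy $\lambda_1,\lambda_3,\lambda_4,\lambda_6>0$, $\mu_3=\pi^4\lambda_3/(16l^4)-\lambda_2>0$ and $\mu_6=\pi^2\lambda_6/(4l^2)-\lambda_5>0$. *)

(* Defs.v *)
From HB Require Import structures.
From mathcomp Require Import all_boot all_order all_algebra.
From mathcomp Require Import all_classical all_reals all_analysis measurable_realfun.
Set Implicit Arguments.
Unset Strict Implicit.
Unset Printing Implicit Defensive.
Import Order.TTheory GRing.Theory Num.Theory.
Import numFieldNormedType.Exports.
Local Open Scope classical_set_scope.
Local Open Scope ring_scope.

(** The R-vector space structure on the library's space [LspaceType2 mu] of
    classes, modulo equality almost everywhere, of square-integrable
    functions. *)

Section L2_lmodType.
Local Open Scope quotient_scope.
Context d (T : measurableType d) (R : realType) (mu : {measure set T -> \bar R}).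
Local Notation L2fun := (LfunType mu (lee1n 2)).
Local Notation L2 := (LspaceType2 mu).

(** The library's quotient is over the generated sigma-algebra
    [measurableTypeR R], which carries another display than that of [R]. *)
Definition to_mfun (f : L2fun) : {mfun T >-> measurableTypeR R} :=
  MeasurableFun.Pack (MeasurableFun.Class
   (@isMeasurableFun.Build _ _ T (measurableTypeR R) f (@measurable_funP _ _ _ _ setT f))).

Definition L2_class (f : L2fun) : {mfun_ mu, T >-> measurableTypeR R} :=
  \pi_({mfun_ mu, T >-> measurableTypeR R}) (to_mfun f).

Lemma L2_classE (f : L2fun) : L2_class f = f %[ae mu].
Proof. by have /eqmodP/asboolP := reprK (L2_class f). Qed.

Lemma L2_class_measurable (u : {mfun_ mu, T >-> measurableTypeR R}) :
  measurable_fun [set: T] (u : T -> R).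
Proof. exact: (@measurable_funP _ _ _ _ setT (repr u)). Qed.

Lemma L2_class_fin (f : L2fun) : finite_norm mu 2 (L2_class f).
Proof.
have := @Lfunction_finite _ _ _ mu _ (lee1n 2) f; rewrite /finite_norm unlock.
have mpow (g : T -> R) : measurable_fun [set: T] g ->
    measurable_fun [set: T] ((fun x => `|(EFin \o g) x| `^ 2)%E : T -> \bar R).
  move=> mg; apply: (@measurableT_comp _ _ _ _ _ _ (@poweR R ^~ 2)).
    exact: measurable_poweR.
  by apply: measurableT_comp => //; exact/measurable_EFinP.
suff -> : (\int[mu]_x (`|(EFin \o f) x| `^ 2) =
           \int[mu]_x (`|(EFin \o L2_class f) x| `^ 2))%E by [].
apply: ge0_ae_eq_integral => //.
- exact: mpow.
- by apply: mpow; exact: L2_class_measurable.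
- by move=> x _; exact: poweR_ge0.
- by move=> x _; exact: poweR_ge0.
- by apply: filterS (L2_classE f) => x + _ => /(_ I) /= ->.
Qed.

Definition L2_of (f : L2fun) : L2 :=
  LebesgueSpace.Pack (LebesgueSpace.Class
    (isFinLebesgue.Build _ _ _ mu 2%E (lee1n 2) (L2_class f) (L2_class_fin f))).

Lemma L2_repr_subproof (u : L2) : (u : T -> R) \in Lfun mu 2.
Proof.
rewrite inE; apply/andP; split; rewrite inE/=.
  exact: L2_class_measurable.
exact: (@Lebesgue_finite _ _ _ _ _ _ u).
Qed.

Definition L2_repr (u : L2) : L2fun := Lfun_Sub (lee1n 2) (L2_repr_subproof u).

Lemma L2_eqP (u v : L2) : u = v %[ae mu] -> u = v.
Proof.
case: u v => [u [[pu]]] [v [[pv]]] /= uv.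
have E : u = v.
  by rewrite -[u]reprK -[v]reprK; apply/eqmodP/asboolP.
by case: v / E pv {uv} => pv; rewrite (Prop_irrelevance pu pv).
Qed.

Lemma L2_ofE (f : L2fun) : L2_of f = f %[ae mu].
Proof. exact: L2_classE. Qed.

HB.instance Definition _ := gen_eqMixin L2.
HB.instance Definition _ := gen_choiceMixin L2.

Let add (u v : L2) : L2 := L2_of (L2_repr u + L2_repr v).
Let opp (u : L2) : L2 := L2_of (- L2_repr u).
Let zero : L2 := L2_of 0.
Let scale (a : R) (u : L2) : L2 := L2_of (a *: L2_repr u).

Let ofE (f : L2fun) : \forall x \ae mu, L2_of f x = f x.
Proof. by apply: filterS (L2_ofE f) => x /(_ I). Qed.
Let addE u v : \forall x \ae mu, add u v x = u x + v x.
Proof. exact: ofE. Qed.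
Let oppE u : \forall x \ae mu, opp u x = - u x.
Proof. exact: ofE. Qed.
Let zeroE : \forall x \ae mu, zero x = 0.
Proof. exact: ofE. Qed.
Let scaleE a u : \forall x \ae mu, scale a u x = a * u x.
Proof. exact: ofE. Qed.

Let addA : associative add.
Proof.
move=> u v w; apply: L2_eqP; near=> x => _.
rewrite (near (addE u (add v w)) x)// (near (addE v w) x)//.
by rewrite (near (addE (add u v) w) x)// (near (addE u v) x)// addrA.
Unshelve. all: by end_near. Qed.

Let addC : commutative add.
Proof.
move=> u v; apply: L2_eqP; near=> x => _.
by rewrite (near (addE u v) x)// (near (addE v u) x)// addrC.
Unshelve. all: by end_near. Qed.

Let add0 : left_id zero add.
Proof.
move=> u; apply: L2_eqP; near=> x => _.
by rewrite (near (addE zero u) x)// (near zeroE x)// add0r.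
Unshelve. all: by end_near. Qed.

Let addN : left_inverse zero opp add.
Proof.
move=> u; apply: L2_eqP; near=> x => _.
rewrite (near (addE (opp u) u) x)// (near (oppE u) x)//.
by rewrite (near zeroE x)// addNr.
Unshelve. all: by end_near. Qed.

HB.instance Definition _ := GRing.isZmodule.Build L2 addA addC add0 addN.

Let scaleA a b u : scale a (scale b u) = scale (a * b) u.
Proof.
apply: L2_eqP; near=> x => _.
rewrite (near (scaleE a (scale b u)) x)// (near (scaleE b u) x)//.
by rewrite (near (scaleE (a * b) u) x)// mulrA.
Unshelve. all: by end_near. Qed.

Let scale1 : left_id 1 scale.
Proof.
move=> u; apply: L2_eqP; near=> x => _.
by rewrite (near (scaleE 1 u) x)// mul1r.
Unshelve. all: by end_near. Qed.

Let scaleDr : right_distributive scale +%R.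
Proof.
move=> a u v; apply: L2_eqP; near=> x => _.
rewrite (near (scaleE a (add u v)) x)// (near (addE u v) x)//.
rewrite (near (addE (scale a u) (scale a v)) x)//.
by rewrite (near (scaleE a u) x)// (near (scaleE a v) x)// mulrDr.
Unshelve. all: by end_near. Qed.

Let scaleDl u : {morph scale^~ u : a b / a + b}.
Proof.
move=> a b; apply: L2_eqP; near=> x => _.
rewrite (near (scaleE (a + b) u) x)//.
rewrite (near (addE (scale a u) (scale b u)) x)//.
by rewrite (near (scaleE a u) x)// (near (scaleE b u) x)// mulrDl.
Unshelve. all: by end_near. Qed.

HB.instance Definition _ :=
  GRing.Zmodule_isLmodule.Build R L2 scaleA scale1 scaleDr scaleDl.

Lemma L2_addE (u v : L2) : \forall x \ae mu, (u + v) x = u x + v x.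
Proof. exact: addE. Qed.
Lemma L2_oppE (u : L2) : \forall x \ae mu, (- u) x = - u x.
Proof. exact: oppE. Qed.
Lemma L2_zeroE : \forall x \ae mu, (0 : L2) x = 0.
Proof. exact: zeroE. Qed.
Lemma L2_scaleE a (u : L2) : \forall x \ae mu, (a *: u) x = a * u x.
Proof. exact: scaleE. Qed.
End L2_lmodType.


Section one_dimensional_sobolev.
Variable R : realType.

Definition leb (l : R) : {measure set (measurableTypeR R) -> \bar R} :=
  mrestr lebesgue_measure (measurable_itv `]0, l[).

Definition L2 (l : R) := LspaceType2 (leb l).

Definition abs_cont (a b : R) (f : R -> R) : Prop :=
  forall e : R, 0 < e -> exists2 delta : R, 0 < delta &
    forall (n : nat) (u v : 'I_n -> R),
      (forall i, a <= u i /\ u i <= v i /\ v i <= b) ->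
      trivIset [set: 'I_n] (fun i => [set` `]u i, v i[]) ->
      \sum_(i < n) (v i - u i) < delta ->
      \sum_(i < n) `|f (v i) - f (u i)| < e.

Variable l : R.
Implicit Types (u v : L2 l).

(** Test functions are the C^1 functions with compact support in the open
    interval (0, l), as in Brezis's treatment of Sobolev spaces in dimension
    one: a subset of (0, l) that is closed in the real line is compact. *)
Definition test_function (phi : R -> R) : Prop :=
  [/\ forall x, derivable phi x 1,
      continuous (derive1 phi) &
      closure [set x | phi x != 0] `<=` [set` `]0, l[]].

Definition is_wderiv u v : Prop := forall phi, test_function phi ->
  \int[leb l]_x (u x * derive1 phi x) = - \int[leb l]_x (v x * phi x).

(** The weak derivative is unique when it exists; the value is 0 otherwise. *)
Definition wderiv u : L2 l := xget 0 [set v | is_wderiv u v].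

Fixpoint sobolev (m : nat) u : Prop :=
  if m is m'.+1 then exists2 v, is_wderiv u v & sobolev m' v else True.

Definition is_ac_rep u (f : R -> R) : Prop :=
  abs_cont 0 l f /\ \forall x \ae leb l, f x = u x.

Definition in_AC u : Prop := exists f, is_ac_rep u f.

(** [trace u x] is the value at x in [0, l] of the absolutely continuous
    representative of u. For 0 < l this representative is unique on [0, l]; it
    exists for every u in H^1(0, l). *)
Definition trace u : R -> R := xget (fun=> 0) [set f | is_ac_rep u f].

Definition sobolevL (m : nat) u : Prop :=
  sobolev m u /\ forall k, (k < m)%N -> trace (iter k wderiv u) 0 = 0.

End one_dimensional_sobolev.

(** The space is a subset [H] of an ambient vector space, normed by [N]. *)
Section semigroups.
Variables (R : realType) (V : lmodType R) (H : set V) (N : V -> R).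
Implicit Types (T : R -> V -> V) (D : set V) (A : V -> V).

Record C0_semigroup T : Prop := {
  C0_stable : forall t x, 0 <= t -> H x -> H (T t x);
  C0_linear : forall t a x y, 0 <= t -> H x -> H y ->
    T t (a *: x + y) = a *: T t x + T t y;
  C0_bounded : forall t, 0 <= t ->
    exists C : R, forall x, H x -> N (T t x) <= C * N x;
  C0_id : forall x, H x -> T 0 x = x;
  C0_add : forall s t x, 0 <= s -> 0 <= t -> H x -> T (s + t) x = T s (T t x);
  C0_cvg : forall x, H x -> N (T t x - x) @[t --> 0^'+] --> (0 : R) }.

(** The operator [A] with domain [D] is the infinitesimal generator of [T]. *)
Definition generator T D A : Prop := forall x y,
  (D x /\ A x = y) <->
  [/\ H x, H y & N (h^-1 *: (T h x - x) - y) @[h --> 0^'+] --> (0 : R)].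

Definition opnorm (S : V -> V) : \bar R :=
  ereal_sup [set (N (S x))%:E | x in [set x | H x /\ N x <= 1]].

Definition exp_stable T : Prop := exists C delta : R,
  [/\ 0 < C, 0 < delta &
    forall t, 0 <= t -> (opnorm (T t) <= (C * expR (- delta * t))%:E)%E].

End semigroups.

Section two_by_two.
Variable R : realType.

Definition mx2 (a b c d : R) : 'M[R]_2 :=
  \matrix_(i, j) if i == 0 then (if j == 0 then a else b)
                 else (if j == 0 then c else d).

Definition cv2 (a b : R) : 'cV[R]_2 := \col_i if i == 0 then a else b.

Definition bilin (A : 'M[R]_2) (x y : 'cV[R]_2) : R := (x^T *m A *m y) 0 0.

(** The product of a real matrix with a column of two vectors of [V]. *)
Definition mxact (V : lmodType R) (A : 'M[R]_2) (x y : V) : V * V :=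
  (A 0 0 *: x + A 0 1 *: y, A 1 0 *: x + A 1 1 *: y).

(** The smallest real eigenvalue. *)
Definition lambda_min (A : 'M[R]_2) : R := inf [set a | eigenvalue A a].

(** A quotient with a positive numerator and a denominator that may vanish. *)
Definition efrac (a b : R) : \bar R := if b == 0 then +oo%E else (a / b)%:E.

End two_by_two.

Record params (R : realType) := Params {
  len : R; p_rho : R; p_Iw : R; p_ms : R; p_Js : R; p_xc : R;
  p_comega : R; p_cphi : R; p_etaomega : R; p_etaphi : R;
  p_k1 : R; p_k2 : R; p_eps1 : R; p_eps2 : R;
  p_alphaomega : R; p_betaomega : R; p_gammaomega : R;
  p_alphaphi : R; p_betaphi : R; p_gammaphi : R }.

Section flexible_structure.
Variables (R : realType) (p : params R).

Local Notation l := (len p).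
Local Notation rho := (p_rho p).
Local Notation Iw := (p_Iw p).
Local Notation ms := (p_ms p).
Local Notation Js := (p_Js p).
Local Notation xc := (p_xc p).
Local Notation cw := (p_comega p).
Local Notation cphi := (p_cphi p).
Local Notation etaw := (p_etaomega p).
Local Notation etaphi := (p_etaphi p).
Local Notation k1 := (p_k1 p).
Local Notation k2 := (p_k2 p).
Local Notation eps1 := (p_eps1 p).
Local Notation eps2 := (p_eps2 p).
Local Notation aw := (p_alphaomega p).
Local Notation bw := (p_betaomega p).
Local Notation gw := (p_gammaomega p).
Local Notation aphi := (p_alphaphi p).
Local Notation bphi := (p_betaphi p).
Local Notation gphi := (p_gammaphi p).

Definition admissible : Prop :=
  [/\ [/\ 0 < l, 0 < rho, 0 < Iw, 0 < ms & 0 < Js],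
      [/\ 0 < cw, 0 < cphi, 0 < etaw & 0 < etaphi],
      [/\ 0 < k1, 0 < k2, 0 < eps1 & 0 < eps2],
      [/\ 0 <= aw, 0 <= bw & 0 <= gw] &
      [/\ 0 <= aphi, 0 <= bphi & 0 <= gphi]].

Definition Iw_star : R := Iw + rho * xc ^+ 2.
Definition Js_star : R := Js + ms * xc ^+ 2.
Definition mxM : 'M[R]_2 := mx2 rho (rho * xc) (rho * xc) Iw_star.
Definition mxMs : 'M[R]_2 := mx2 ms (ms * xc) (ms * xc) Js_star.

(** The components are f, g, h, z, zeta_omega, zeta_phi. *)
Definition state : lmodType R := (L2 l * L2 l * L2 l * L2 l * R * R)%type.

Definition Hspace : set state := [set X |
  let: (f, g, h, z, zw, zphi) := X in sobolevL 2 f /\ sobolevL 1 h].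

Definition inner1 (X1 X2 : state) : R :=
  let: (f1, g1, h1, z1, zw1, zphi1) := X1 in
  let: (f2, g2, h2, z2, zw2, zphi2) := X2 in
  \int[leb l]_y (rho * cw ^+ 2 * wderiv (wderiv f1) y * wderiv (wderiv f2) y
                 + Iw * cphi ^+ 2 * wderiv h1 y * wderiv h2 y)
  + \int[leb l]_y bilin mxM (cv2 (g1 y) (z1 y)) (cv2 (g2 y) (z2 y))
  + bilin mxMs (cv2 zw1 zphi1) (cv2 zw2 zphi2).

Definition Psi (X1 X2 : state) : R :=
  let: (f1, g1, h1, z1, zw1, zphi1) := X1 in
  let: (f2, g2, h2, z2, zw2, zphi2) := X2 in
  \int[leb l]_y
     (bilin mxM (cv2 (g1 y) (z1 y)) (cv2 (eps1 * f2 y) (eps2 * h2 y))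
      + bilin mxM (cv2 (g2 y) (z2 y)) (cv2 (eps1 * f1 y) (eps2 * h1 y)))
  + bilin mxMs (cv2 zw1 zphi1) (cv2 (eps1 * trace f2 l) (eps2 * trace h2 l))
  + bilin mxMs (cv2 zw2 zphi2) (cv2 (eps1 * trace f1 l) (eps2 * trace h1 l)).

Definition inner2 (X1 X2 : state) : R := inner1 X1 X2 + Psi X1 X2.

Definition norm1 (X : state) : R := Num.sqrt (inner1 X X).
Definition norm2 (X : state) : R := Num.sqrt (inner2 X X).

(** f'' + eta_omega g'' and h' + eta_phi z'. *)
Definition bend (f g : L2 l) : L2 l :=
  wderiv (wderiv f) + etaw *: wderiv (wderiv g).
Definition twist (h z : L2 l) : L2 l := wderiv h + etaphi *: wderiv z.

Definition domA : set state := [set X |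
  let: (f, g, h, z, zw, zphi) := X in
  [/\ Hspace X,
      [/\ sobolevL 2 g, sobolevL 1 z, sobolev 2 (bend f g) &
          sobolev 1 (twist h z)],
      trace (bend f g) l = 0,
      zw = trace g l /\ zphi = trace z l &
      [/\ in_AC f /\ in_AC (wderiv f), in_AC g /\ in_AC (wderiv g),
          in_AC h /\ in_AC z, in_AC (bend f g) /\ in_AC (wderiv (bend f g)) &
          in_AC (twist h z)]]].

Definition opA1 (X : state) : state :=
  let: (f, g, h, z, zw, zphi) := X in
  let: (g', z') := mxact (- invmx mxM)
    ((rho * cw ^+ 2) *: wderiv (wderiv (bend f g)))
    (- (Iw * cphi ^+ 2) *: wderiv (twist h z)) in
  let zeta' := invmx mxMs *m cv2
    (rho * cw ^+ 2 * trace (wderiv (bend f g)) l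
       - k1 * (trace g l + eps1 * trace f l))
    (- (Iw * cphi ^+ 2) * trace (twist h z) l
       - k2 * (trace z l + eps2 * trace h l)) in
  (g, g', z, z', zeta' 0 0, zeta' 1 0).

Definition opA2 (X : state) : state :=
  let: (f, g, h, z, zw, zphi) := X in
  let: (Fa, Ma) := mxact (invmx mxM)
    (aw *: h + bw *: z + gw *: g) (aphi *: h + bphi *: z + gphi *: g) in
  (0, Fa, 0, Ma, 0, 0).

Definition opA (X : state) : state := opA1 X + opA2 X.

Definition Km1 : \bar R := \big[Order.min/+oo%E]_(x <- [::
  efrac (pi ^+ 4 * rho * cw ^+ 2)
    (4 * l ^+ 3 * (1 + `|xc|)
       * (4 * l * rho `^ (3 / 2) * cw + pi ^+ 2 * ms));
  efrac (cw * lambda_min mxM) (2 * Num.sqrt rho);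
  efrac (cw * lambda_min mxM) (2 * Num.sqrt rho * `|xc|);
  efrac (lambda_min mxMs) (2 * ms);
  efrac (lambda_min mxMs) (2 * ms * `|xc|)]) x.

Definition Km2 : \bar R := \big[Order.min/+oo%E]_(x <- [::
  efrac (pi ^+ 2 * Iw * cphi ^+ 2)
    (4 * l ^+ 2 * (Iw_star + rho * `|xc|) * Num.sqrt Iw * cphi
       + pi ^+ 2 * l * (Js_star + ms * `|xc|));
  efrac (Num.sqrt Iw * cphi * lambda_min mxM) (2 * rho * `|xc|);
  efrac (Num.sqrt Iw * cphi * lambda_min mxM) (2 * Iw_star);
  efrac (lambda_min mxMs) (2 * ms * `|xc|);
  efrac (lambda_min mxMs) (2 * Js_star)]) x.

Definition eps1_star : \bar R := Order.min
  (efrac (pi ^+ 2 * Iw * etaphi * cphi ^+ 2)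
     (l * `|xc| * (4 * l * rho + pi ^+ 2 * ms)))
  (efrac (2 * pi ^+ 4 * rho * etaw * cw ^+ 2)
     (32 * l ^+ 4 * (2 + `|xc|) * rho
        + 8 * pi ^+ 2 * l ^+ 3 * (2 + `|xc|) * ms
        + pi ^+ 4 * rho * etaw ^+ 2 * cw ^+ 2)).

Definition eps2_star : \bar R := Order.min
  (efrac (pi ^+ 4 * rho * etaw * cw ^+ 2)
     (4 * l ^+ 3 * `|xc| * (4 * l * rho + pi ^+ 2 * ms)))
  (efrac (2 * pi ^+ 2 * Iw * etaphi * cphi ^+ 2)
     (8 * l ^+ 2 * (2 * Iw_star + `|xc| * rho)
        + 2 * pi ^+ 2 * l * (2 * Js_star + `|xc| * ms)
        + pi ^+ 2 * Iw * etaphi ^+ 2 * cphi ^+ 2)).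

Definition lambda1 (r1 r3 r4 r5 : R) : R :=
  eps1 * (1 - etaw / (2 * r1)
    - 8 * l ^+ 4 / (pi ^+ 4 * rho * cw ^+ 2) * (aw / r4 + bw / r5 + gw / r3)).

Definition lambda2 (r3 r6 r7 : R) : R :=
  gw + (aw + eps2 * gphi) / (2 * r6) + eps1 * gw * r3 / 2
    + (bw + gphi) / (2 * r7).

Definition lambda3 (r1 : R) : R :=
  rho * (etaw * cw ^+ 2
    - eps2 * (2 * l ^+ 3 * `|xc| / pi ^+ 2) * (4 * l / pi ^+ 2 + ms / rho)
    - eps1 * (8 * l ^+ 4 * (2 + `|xc|) / pi ^+ 4 + etaw * cw ^+ 2 * r1 / 2
              + 2 * l ^+ 3 * (2 + `|xc|) * ms / (pi ^+ 2 * rho))).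

Definition lambda4 (r2 r4 r6 r8 : R) : R :=
  eps2 * (1 - etaphi / (2 * r2))
    - 4 * l ^+ 2 / (pi ^+ 2 * Iw * cphi ^+ 2)
      * ((aw + eps2 * gphi) * r6 / 2 + (aphi + eps2 * bphi) / (2 * r8)
         + eps1 * aw * r4 / 2 + eps2 * aphi).

Definition lambda5 (r5 r7 r8 : R) : R :=
  bphi + (bw + gphi) * r7 / 2 + (aphi + eps2 * bphi) * r8 / 2
    + eps1 * bw * r5 / 2.

Definition lambda6 (r2 : R) : R :=
  Iw * (etaphi * cphi ^+ 2
    - eps1 * (l * `|xc| / Iw) * (2 * l * rho / pi ^+ 2 + ms / 2)
    - eps2 * (2 * l ^+ 2 * ((2 * Iw_star + `|xc| * rho) / (pi ^+ 2 * Iw))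
              + etaphi * cphi ^+ 2 * r2 / 2
              + l * (2 * Js_star + `|xc| * ms) / (2 * Iw))).

Definition structural : Prop :=
  [/\ 0 < eps1, (eps1%:E < Order.min eps1_star Km1)%E,
      0 < eps2, (eps2%:E < Order.min eps2_star Km2)%E &
  exists r1 r2 r3 r4 r5 r6 r7 r8 : R,
    [/\ [/\ 0 < r1, 0 < r2, 0 < r3 & 0 < r4],
        [/\ 0 < r5, 0 < r6, 0 < r7 & 0 < r8],
        [/\ 0 < lambda1 r1 r3 r4 r5, 0 < lambda3 r1,
            0 < lambda4 r2 r4 r6 r8 & 0 < lambda6 r2],
        0 < pi ^+ 4 * lambda3 r1 / (16 * l ^+ 4) - lambda2 r3 r6 r7 &
        0 < pi ^+ 2 * lambda6 r2 / (4 * l ^+ 2) - lambda5 r5 r7 r8]].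

Definition augmented_energy (T : R -> state -> state) (X0 : state) (t : R) : R :=
  2^-1 * norm2 (T t X0) ^+ 2.

End flexible_structure.

Arguments Hspace {R} p.
Arguments norm1 {R} p.
Arguments norm2 {R} p.
Arguments domA {R} p.
Arguments opA {R} p.

(* Main.v *)
Require Import Defs.
From mathcomp Require Import all_boot all_order all_algebra.
From mathcomp Require Import all_classical all_reals all_analysis.
From mathcomp Require Import measurable_realfun.
From mathcomp Require Import ring lra.
Set Implicit Arguments.
Unset Strict Implicit.
Unset Printing Implicit Defensive.
Import Order.TTheory GRing.Theory Num.Theory.
Import numFieldNormedType.Exports.
Local Open Scope classical_set_scope.
Local Open Scope ring_scope.

(** The form <AX, X> in the augmented inner product is computed by integrating
    by parts. The viscous terms give - rho eta_w c_w^2 |g''|^2 and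
    - I_w eta_phi c_phi^2 |z'|^2, the cross terms weighted by eps_1, eps_2 give
    - eps_1 |f''|^2 and - eps_2 |h'|^2, and the boundary controls only
    contribute negative squares. The remaining terms are absorbed by Young's
    inequality with the weights r_i and by the Wirtinger inequalities
    |u|^2 <= (4 l^2 / pi^2) |u'|^2 for u(0) = 0, so that
    <AX, X> <= - c |X|^2 on D(A). The thresholds K_m make the augmented norm
    equivalent to the original one. Along an orbit starting in D(A) the energy
    then has a right derivative at most - 2 c times itself, and orbits are
    continuous, whence the decay on D(A); D(A) being dense, it extends to all
    states. All facts on L2 and H^1 (primitives, integration by parts, the
    Wirtinger inequality, density of D(A)) are checked on polynomials, which
    are dense in L2, and extended by continuity. *)

(** * Exponential decay of dissipative semigroups *)

(** Each [T t] is bounded separately, with no uniformity in t, and [generator] involves limits from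
    the right only; hence the energy is handled by one-sided estimates and left continuity needs its
    own argument. [wderiv] and [trace] are choices, so nothing can be computed with them before
    uniqueness is known: the du Bois-Reymond lemma writes every function with a weak derivative as a
    constant plus a primitive, and later computations start from this form. Both inner products and
    the dissipation are compared with one unweighted form, [qform]. In the dissipation, - lambda_3
    |g''|^2 has to pay for + lambda_2 |g|^2, which two Wirtinger inequalities bound by (16 l^4 /
    pi^4) lambda_2 |g''|^2; mu_3 > 0 says exactly that something remains, and mu_6 > 0 says it for
    z. The weights r_i serve there only. For the equivalence of norms Young's weights are 1 / (sqrt
    rho c_w) and 1 / (sqrt I_w c_phi), and the entries of K_m express what these require. *)

Section psd_forms.
Context {R : realType} {V : lmodType R}.
Variables (H : set V) (B : V -> V -> R).

Definition lin_subspace := H 0 /\ forall a x y, H x -> H y -> H (a *: x + y).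

(** Everything is relative to [H] because [inner2] is bilinear only where [wderiv] and [trace] are
    linear, that is, on Sobolev functions. *)
Record psd_form : Prop := {
  psd_linear : forall a x y z, H x -> H y -> H z ->
    B (a *: x + y) z = a * B x z + B y z;
  psd_sym : forall x y, H x -> H y -> B x y = B y x;
  psd_ge0 : forall x, H x -> 0 <= B x x }.

Definition form_norm (x : V) : R := Num.sqrt (B x x).
Local Notation N := form_norm.

Hypotheses (sH : lin_subspace) (pB : psd_form).

Lemma subspaceD x y : H x -> H y -> H (x + y).
Proof. by move=> hx hy; rewrite -[x]scale1r; apply: sH.2. Qed.

Lemma subspaceZ a x : H x -> H (a *: x).
Proof. by move=> hx; rewrite -[_ *: _]addr0; apply: sH.2 => //; case: sH. Qed.

Lemma subspaceB x y : H x -> H y -> H (x - y).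
Proof. by move=> hx hy; rewrite addrC -scaleN1r; apply: sH.2. Qed.

Lemma psd_0l z : H z -> B 0 z = 0.
Proof.
move=> hz; have := psd_linear pB 1 sH.1 sH.1 hz.
rewrite scaler0 addr0 mul1r => e.
by apply: (addrI (B 0 z)); rewrite addr0.
Qed.

Lemma psd_Dl x y z : H x -> H y -> H z -> B (x + y) z = B x z + B y z.
Proof. by move=> hx hy hz; have := psd_linear pB 1 hx hy hz; rewrite scale1r mul1r. Qed.

Lemma psd_Zl a x z : H x -> H z -> B (a *: x) z = a * B x z.
Proof.
by move=> hx hz; have := psd_linear pB a hx sH.1 hz; rewrite !addr0 psd_0l ?addr0.
Qed.

Lemma psd_Dr x y z : H x -> H y -> H z -> B z (x + y) = B z x + B z y.
Proof.
move=> hx hy hz; rewrite (psd_sym pB) ?psd_Dl//; last exact: subspaceD.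
by rewrite (psd_sym pB hx hz) (psd_sym pB hy hz).
Qed.

Lemma psd_Zr a x z : H x -> H z -> B z (a *: x) = a * B z x.
Proof.
move=> hx hz; rewrite (psd_sym pB) ?psd_Zl//; last exact: subspaceZ.
by rewrite (psd_sym pB hx hz).
Qed.

Lemma psd_DZ a x y : H x -> H y ->
  B (x + a *: y) (x + a *: y) = B x x + 2 * a * B y x + a ^+ 2 * B y y.
Proof.
move=> hx hy; have hay := subspaceZ a hy.
rewrite psd_Dl// ?psd_Dr//; last exact: subspaceD.
rewrite !psd_Zl ?psd_Zr// (psd_sym pB hx hy); lra.
Qed.

Lemma form_norm_ge0 x : 0 <= N x. Proof. exact: sqrtr_ge0. Qed.

Lemma sqr_form_norm x : H x -> N x ^+ 2 = B x x.
Proof. by move=> hx; rewrite sqr_sqrtr// (psd_ge0 pB). Qed.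

Lemma form_CS x y : H x -> H y -> `|B x y| <= N x * N y.
Proof.
move=> hx hy.
have h a : 0 <= B x x + 2 * a * B y x + a ^+ 2 * B y y.
  by rewrite -psd_DZ//; apply: (psd_ge0 pB); exact/subspaceD/subspaceZ.
rewrite -(@ler_pXn2r _ 2)// ?nnegrE ?mulr_ge0 ?form_norm_ge0//.
rewrite exprMn !sqr_form_norm// real_normK ?num_real//.
rewrite (psd_sym pB hx hy).
have := psd_ge0 pB hy; rewrite le_eqVlt => /predU1P[y0|y0].
  have y0' : B y y = 0 by [].
  rewrite y0' mulr0.
  have [->|b0] := eqVneq (B y x) 0; first by rewrite expr0n.
  (* With [B y y = 0] the polynomial in [h] is affine in [a]; at this value of [a] it equals -1, a
     contradiction. *)
  have := h (- (B x x + 1) / (2 * B y x)); rewrite y0' mulr0 addr0.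
  suff -> : 2 * (- (B x x + 1) / (2 * B y x)) * B y x = - (B x x + 1) by lra.
  by field; rewrite b0.
have h1 := mulr_ge0 (h (- B y x / B y y)) (ltW y0).
suff E : (B x x + 2 * (- B y x / B y y) * B y x +
   (- B y x / B y y) ^+ 2 * B y y) * B y y = B x x * B y y - B y x ^+ 2.
  by rewrite E in h1; lra.
by field; rewrite gt_eqF.
Qed.

Lemma form_normD x y : H x -> H y -> N (x + y) <= N x + N y.
Proof.
move=> hx hy.
rewrite -(@ler_pXn2r _ 2)// ?nnegrE ?addr_ge0 ?form_norm_ge0//.
rewrite sqr_form_norm; last exact: subspaceD.
rewrite -[y]scale1r psd_DZ// scale1r sqrrD !sqr_form_norm//.
have := form_CS hx hy; rewrite (psd_sym pB hx hy) ler_norml; lra.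
Qed.

Lemma form_normZ a x : H x -> N (a *: x) = `|a| * N x.
Proof.
move=> hx; rewrite /form_norm psd_Zl ?psd_Zr//; last exact: subspaceZ.
by rewrite mulrA -expr2 sqrtrM ?sqr_ge0// sqrtr_sqr.
Qed.

Lemma form_normB x y : H x -> H y -> N (x - y) = N (y - x).
Proof.
move=> hx hy; rewrite -(opprB y x) -[- (y - x)]scaleN1r form_normZ ?normrN1 ?mul1r//.
exact: subspaceB.
Qed.

Lemma form_norm_triangle x y z : H x -> H y -> H z ->
  N (x - z) <= N (x - y) + N (y - z).
Proof.
move=> hx hy hz; rewrite -(subrKA y).
by apply: form_normD; exact: subspaceB.
Qed.

End psd_forms.

(** * One-sided continuity and one-sided derivatives on the real line *)

Section real_lemmas.
Context {R : realType}.

(** Nested intervals: right continuity at the midpoint of an interval provides a subinterval on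
    which the oscillation is below 1/(n+1). The inclusions are strict at both ends, so the common
    point is interior to all of them and is a point of two-sided continuity. *)
Lemma continuity_point_right (a b : R) (dist : R -> R -> R) : a < b ->
  (forall s t, dist s t = dist t s) ->
  (forall r s t, dist r t <= dist r s + dist s t) ->
  (forall t e : R, a < t -> t < b -> 0 < e -> exists2 d : R, 0 < d &
     forall s, t <= s -> s < t + d -> dist s t < e) ->
  exists2 t0, a < t0 < b & forall e : R, 0 < e -> exists2 d : R, 0 < d &
     forall s, `|s - t0| < d -> dist s t0 < e.
Proof.
move=> ab dsym dtri rc.
pose ok (p : R * R) := [&& a <= p.1, p.1 < p.2 & p.2 <= b].
(* The implication stands under the existential so that [choice] applies to all pairs, valid
   intervals or not. *)
have step (n : nat) (p : R * R) : exists q : R * R, ok p ->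
    [/\ p.1 < q.1, q.1 < q.2, q.2 < p.2 &
      forall s t, q.1 <= s <= q.2 -> q.1 <= t <= q.2 -> dist s t < n.+1%:R^-1].
  have [/and3P[ap pp pb]|_] := boolP (ok p); last by exists (0, 0).
  pose t := (p.1 + p.2) / 2.
  have tp1 : p.1 < t by rewrite /t; lra.
  have tp2 : t < p.2 by rewrite /t; lra.
  have [|||d d0 hd] := rc t (n.+1%:R^-1 / 2); [lra|lra|by rewrite divr_gt0|].
  pose d' := Num.min d (p.2 - t).
  have d'0 : 0 < d' by rewrite lt_min d0 subr_gt0.
  have d'd : d' <= d by rewrite ge_min lexx.
  have d'p : d' <= p.2 - t by rewrite ge_min lexx orbT.
  exists (t + d' / 4, t + d' / 2) => _ /=; split; try lra.
  move=> s r /andP[s1 s2] /andP[r1 r2].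
  have := hd s ltac:(lra) ltac:(lra); have := hd r ltac:(lra) ltac:(lra).
  have := dtri s t r; rewrite (dsym t r); move: (dist s t) (dist r t) (dist s r).
  by move: n.+1%:R^-1 => k u1 u2 u3 *; lra.
have {step} step n := choice (step n).
pose f n := projT1 (step n); have hf n := projT2 (step n).
pose x := fix x n := if n is n'.+1 then f n' (x n') else (a, b).
have okx n : ok (x n).
  elim: n => [|n ih]; first by rewrite /ok /= !lexx ab.
  have [h1 h2 h3 _] := hf n _ ih; case/and3P: (ih) => h4 h5 h6 /=.
  by apply/and3P; split=> //; lra.
have x1 n : (x n).1 < (x n.+1).1 by have [] := hf n _ (okx n).
have x2 n : (x n.+1).2 < (x n).2 by have [] := hf n _ (okx n).
have m1 n k : (x n).1 <= (x (n + k)%N).1.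
  elim: k => [|k ih]; first by rewrite addn0.
  by rewrite addnS (le_trans ih)// ltW.
have m2 n k : (x (n + k)%N).2 <= (x n).2.
  elim: k => [|k ih]; first by rewrite addn0.
  by rewrite addnS (le_trans _ ih)// ltW.
have m12 n k : (x n).1 < (x k).2.
  have h := okx (n + k)%N; case/and3P: h => _ h _.
  rewrite (le_lt_trans (m1 n k))// (lt_le_trans h)//.
  by rewrite addnC; exact: m2.
pose S := [set (x n).1 | n in [set: nat]].
have ubS k : ubound S (x k).2 by move=> _ [n _ <-]; exact/ltW/m12.
have hS : has_sup S by split; [exists (x 0%N).1, 0%N|exists (x 0%N).2; exact: ubS].
pose t0 := sup S.
have t1 n : (x n).1 <= t0 by apply: ub_le_sup; [exact: hS.2|exists n].
have t2 n : t0 <= (x n).2 by apply: ge_sup; [exact: hS.1|exact: ubS].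
have t1' n : (x n).1 < t0 by rewrite (lt_le_trans (x1 n)).
have t2' n : t0 < (x n).2 by rewrite (le_lt_trans (t2 n.+1)).
exists t0; first by rewrite (t1' 0%N) (t2' 0%N).
move=> e e0.
pose n := Num.bound e^-1.
have ne : n.+1%:R^-1 < e.
  rewrite invf_plt ?posrE// (lt_trans (archi_boundP _))// ?invr_ge0 1?ltW//.
  by rewrite ltr_nat.
have [_ _ _ h] := hf n _ (okx n).
exists (Num.min (t0 - (x n.+1).1) ((x n.+1).2 - t0)).
  by rewrite lt_min !subr_gt0 t1' t2'.
move=> s; rewrite lt_min !ltr_norml => /andP[s1 s2].
apply: lt_trans ne; apply: h; [apply/andP; split; lra|].
by rewrite (t1 n.+1) (t2 n.+1).
Qed.

(** Take the supremum of the times s in [0, t] with phi s <= phi 0 + e s: the second hypothesis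
    shows that it is attained, the first that it can be exceeded unless it is t. *)
Lemma right_derivative_le0_le (phi : R -> R) :
  (forall t e : R, 0 <= t -> 0 < e -> exists2 d : R, 0 < d &
     forall h, 0 <= h -> h < d -> phi (t + h) <= phi t + e * h) ->
  (forall t e : R, 0 < t -> 0 < e -> exists2 d : R, 0 < d &
     forall h, 0 <= h -> h < d -> h <= t -> phi t <= phi (t - h) + e) ->
  forall t, 0 <= t -> phi t <= phi 0.
Proof.
move=> hr hl t t0; apply/ler_addgt0Pr => e0 e00.
pose e := e0 / (t + 1).
have e_gt0 : 0 < e by rewrite divr_gt0//; lra.
suff : phi t <= phi 0 + e * t.
  move=> /le_trans; apply; rewrite lerD2l /e -mulrA ger_pMr//.
  by rewrite mulrC ler_pdivrMr; lra.
pose S := [set s | 0 <= s <= t /\ phi s <= phi 0 + e * s].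
have S0 : S 0 by split; [rewrite lexx|rewrite mulr0 addr0].
have ubS : ubound S t by move=> s [/andP[]].
have hS : has_sup S by split; [exists 0|exists t].
have s0 : 0 <= sup S by apply: ub_le_sup S0; exists t.
have st : sup S <= t by apply: ge_sup => //; exists 0.
have Ss : phi (sup S) <= phi 0 + e * sup S.
  move: s0; rewrite le_eqVlt => /predU1P[<-|s0]; first by rewrite mulr0 addr0.
  apply/ler_addgt0Pr => e1 e10.
  have [d d0 hd] := hl _ _ s0 e10.
  have [s [/andP[s1 s2] s3] s4] := sup_adherent d0 hS.
  have s5 : s <= sup S.
    by apply: ub_le_sup; [exists t|split=> //; rewrite s1 s2].
  have := hd (sup S - s) ltac:(lra) ltac:(lra) ltac:(lra).
  rewrite (_ : sup S - (sup S - s) = s); last by lra.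
  have : e * s <= e * sup S by rewrite ler_pM2l.
  lra.
move: st; rewrite le_eqVlt => /predU1P[<-//|st].
have [d d0 hd] := hr _ _ s0 e_gt0.
pose h := Num.min (d / 2) (t - sup S).
have h0 : 0 < h by rewrite lt_min; apply/andP; split; lra.
have hd2 : h <= d / 2 by rewrite ge_min lexx.
have ht : h <= t - sup S by rewrite ge_min lexx orbT.
have := hd h ltac:(lra) ltac:(lra) => hh.
have : S (sup S + h).
  by split; [apply/andP; split; lra|rewrite mulrDr; lra].
by move/(ub_le_sup (ex_intro _ t ubS)); lra.
Qed.

End real_lemmas.

(** * Decay of the energy along the orbits of a dissipative generator *)

Section semigroup_decay.
Context {R : realType} {V : lmodType R}.
Variables (H : set V) (B : V -> V -> R) (T : R -> V -> V) (D : set V) (A : V -> V).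
Local Notation N := (form_norm B).
Hypotheses (sH : lin_subspace H) (pB : psd_form H B).
Hypotheses (hT : C0_semigroup H N T) (hA : generator H N T D A).

Let Hs t x : 0 <= t -> H x -> H (T t x) := @C0_stable _ _ _ _ _ hT t x.

Let TB t x y : 0 <= t -> H x -> H y -> T t (x - y) = T t x - T t y.
Proof.
move=> t0 hx hy; have := C0_linear hT (-1) t0 hy hx.
by rewrite !scaleN1r addrC => ->; rewrite addrC.
Qed.

Let TZ t a x : 0 <= t -> H x -> T t (a *: x) = a *: T t x.
Proof.
move=> t0 hx; have h0 := sH.1.
have e0 : T t 0 = 0 by rewrite -{1}(subrr x) TB// subrr.
by have := C0_linear hT a t0 hx h0; rewrite !addr0 e0 addr0.
Qed.

Let bnd t : 0 <= t -> exists2 C, 0 < C & forall x, H x -> N (T t x) <= C * N x.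
Proof.
move=> t0; have [C hC] := C0_bounded hT t0.
exists (`|C| + 1); first by rewrite ltr_wpDl.
move=> x hx; apply: (le_trans (hC x hx)); rewrite ler_wpM2r ?form_norm_ge0//.
by rewrite (le_trans (ler_norm _))// lerDl.
Qed.

Let domH x : D x -> H x.
Proof. by move=> Dx; have /hA[] : D x /\ A x = A x by []. Qed.

Let opH x : D x -> H (A x).
Proof. by move=> Dx; have /hA[] : D x /\ A x = A x by []. Qed.

(** [T t] commutes with the difference quotients and is bounded, so it carries their convergence at
    [x] over to [T t x]. *)
Lemma generator_invariant t x : 0 <= t -> D x -> D (T t x).
Proof.
move=> t0 Dx; have hx := domH Dx; have hAx := opH Dx.
suff : D (T t x) /\ A (T t x) = T t (A x) by case.
apply/hA; split; [exact: Hs|exact: Hs|].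
have /hA[_ _ cv] : D x /\ A x = A x by [].
have [C C0 hC] := bnd t0.
apply/cvgrPdist_lt => /= e e0.
have eC : 0 < e / C by rewrite divr_gt0.
move/cvgrPdist_lt/(_ _ eC): cv; apply: filter_app.
near=> h; rewrite !sub0r !normrN => hh.
have h0 : 0 <= h by near: h; exact: nbhs_right_ge.
have hTx : H (T h x - x) by apply: subspaceB => //; exact: Hs.
have -> : h^-1 *: (T h (T t x) - T t x) - T t (A x) =
    T t (h^-1 *: (T h x - x) - A x).
  rewrite TB//; last exact: subspaceZ.
  by rewrite TZ// TB//; [rewrite -!(C0_add hT)// (addrC h)|exact: Hs].
rewrite ger0_norm ?form_norm_ge0//.
rewrite ger0_norm ?form_norm_ge0// ltr_pdivlMr// mulrC in hh.
apply: le_lt_trans hh; apply: hC; apply: subspaceB => //.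
exact: subspaceZ.
Unshelve. all: by end_near. Qed.

Let small0 x e : H x -> 0 < e ->
  exists2 d : R, 0 < d & forall h, 0 <= h -> h < d -> N (T h x - x) < e.
Proof.
move=> hx e0.
have /cvgrPdist_lt/(_ _ e0) := C0_cvg hT hx.
case=> d /= d0 hd; exists d => // h h0 hh.
move: h0; rewrite le_eqVlt => /predU1P[<-|h0].
  by rewrite (C0_id hT)// subrr /form_norm (psd_0l sH pB) ?sqrtr0//; case: sH.
have := hd h; rewrite sub0r normrN ger0_norm ?form_norm_ge0//; apply => //=.
by rewrite sub0r normrN gtr0_norm.
Qed.

Let right_cont x t e : H x -> 0 <= t -> 0 < e ->
  exists2 d : R, 0 < d & forall h, 0 <= h -> h < d -> N (T (t + h) x - T t x) < e.
Proof.
move=> hx t0 e0; have [C C0 hC] := bnd t0.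
have [d d0 hd] := small0 hx (divr_gt0 e0 C0).
exists d => // h h0 hh; rewrite (C0_add hT)// -TB//; last exact: Hs.
have := hd h h0 hh; rewrite ltr_pdivlMr// mulrC.
by apply: le_lt_trans; apply: hC; apply: subspaceB => //; exact: Hs.
Qed.

(* A right-continuous map has continuity points in every interval, and left
   continuity of an orbit at t0 propagates to all t >= t0 by applying the
   bounded map T (t - t0); no uniform bound of the T t is needed. *)
Lemma orbit_left_continuous x t e : H x -> 0 < t -> 0 < e ->
  exists2 d : R, 0 < d &
    forall h, 0 <= h -> h < d -> h <= t -> N (T (t - h) x - T t x) < e.
Proof.
move=> hx t0 e0.
(* [continuity_point_right] asks for symmetry and the triangle inequality at all real times; the
   truncation keeps every [u s] in [H]. *)
pose u s := T (Num.max 0 s) x.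
have hu s : H (u s) by apply: Hs => //; rewrite le_max lexx.
have uE s : 0 <= s -> u s = T s x by move=> s0; rewrite /u max_r.
have [s r|r s t'|s e1 s0 s1 e10|t1 /andP[t10 t11] h1] :=
  @continuity_point_right R 0 t (fun s r => N (u s - u r)) t0.
- by apply: (form_normB sH pB).
- by apply: (form_norm_triangle sH pB).
- have [d d0 hd] := right_cont hx (ltW s0) e10.
  exists d => // r sr rd; rewrite !uE; [|lra|lra].
  by have := hd (r - s) ltac:(lra) ltac:(lra); rewrite subrKC.
have ht1 : 0 <= t - t1 by lra.
have [C C0 hC] := bnd ht1.
have [d d0 hd] := h1 _ (divr_gt0 e0 C0).
exists (Num.min d t1); first by rewrite lt_min d0.
move=> h h0; rewrite lt_min => /andP[hd1 ht] _.
have := hd (t1 - h); rewrite addrAC subrr add0r normrN ger0_norm// => /(_ hd1).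
rewrite !uE; [|lra|lra].
rewrite ltr_pdivlMr// mulrC; apply: le_lt_trans.
have -> : T (t - h) x = T (t - t1) (T (t1 - h) x).
  by rewrite -(C0_add hT)//; [congr (T _ x); lra|lra].
have -> : T t x = T (t - t1) (T t1 x).
  by rewrite -(C0_add hT)//; [congr (T _ x); lra|lra].
have ha : H (T (t1 - h) x) by apply: Hs => //; lra.
have hb : H (T t1 x) by apply: Hs => //; lra.
by rewrite -TB//; apply: hC; exact: subspaceB.
Qed.

Variable c : R.
Hypotheses (c0 : 0 < c) (diss : forall x, D x -> B (A x) x <= - c * B x x).

(** After multiplication by exp(2 c t) the energy has nonpositive upper right derivative: T (t + h)
    x = y + h q with q close to A y, so the increment is 2 h B(q, y) + h^2 B(q, q), where B(q, y) <=
    - c B(y, y) + o(1). The second hypothesis of [right_derivative_le0_le] follows from the left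
    continuity of the orbit. *)
Lemma decay_on_domain x t : D x -> 0 <= t ->
  B (T t x) (T t x) <= B x x * expR (- (2 * c) * t).
Proof.
move=> Dx t0; have hx := domH Dx.
pose E t := B (T t x) (T t x).
suff : E t * expR (2 * c * t) <= E 0 * expR (2 * c * 0).
  rewrite mulr0 expR0 mulr1 {2}/E (C0_id hT)// -ler_pdivlMr ?expR_gt0//.
  by rewrite -expRN mulNr.
move: t t0; apply: right_derivative_le0_le => [t e t0 e0|t e t0 e0].
- have Du := generator_invariant t0 Dx.
  set y := T t x in Du; have hy := domH Du; have hAy := opH Du.
  have /hA[_ _ cv] : D y /\ A y = A y by [].
  (* [K] bounds the exponential factor for h < 1, so the total error must stay below (e / K) h. One
     half of it is spent on 2 h B(q - A y, y), through [del], the other on h^2 B(q, q), through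
     [d2]. *)
  pose K := expR (2 * c * (t + 1)).
  have K0 : 0 < K by exact: expR_gt0.
  pose del := e / (4 * K * (N y + 1)).
  have Ny := form_norm_ge0 B y; have NAy := form_norm_ge0 B (A y).
  have del0 : 0 < del by rewrite divr_gt0// !mulr_gt0//; lra.
  have [d d0 hd] : exists2 d : R, 0 < d &
      forall h, 0 < h -> h < d -> N (h^-1 *: (T h y - y) - A y) < del.
    have /cvgrPdist_lt/(_ _ del0)[d /= d0 hd] := cv.
    exists d => // h h0 hh; have := hd h.
    rewrite sub0r normrN ger0_norm ?form_norm_ge0//; apply => //=.
    by rewrite sub0r normrN gtr0_norm.
  pose M := (N (A y) + del) ^+ 2.
  have M0 : 0 <= M by exact: sqr_ge0.
  pose d2 := e / (2 * K * (M + 1)).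
  have d20 : 0 < d2 by rewrite divr_gt0// !mulr_gt0//; lra.
  exists (Num.min 1 (Num.min d d2)); first by rewrite !lt_min ltr01 d0.
  move=> h; rewrite le_eqVlt => /predU1P[<- _|h0]; first by rewrite mulr0 !addr0.
  rewrite !lt_min => /and3P[h1 hhd hd2].
  pose q := h^-1 *: (T h y - y); pose r := q - A y.
  have hTy : H (T h y) by apply: Hs => //; exact: ltW.
  have hq : H q by apply: subspaceZ => //; exact: subspaceB.
  have hr : H r by exact: subspaceB.
  have Nr : N r < del by exact: hd.
  have Nr0 := form_norm_ge0 B r.
  have eT : T (t + h) x = y + h *: q.
    rewrite addrC (C0_add hT)//; last exact: ltW.
    by rewrite -/y /q scalerA divff ?gt_eqF// scale1r subrKC.
  have Bq : B q y <= - c * B y y + del * N y.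
    rewrite -(subrK (A y) q) -/r (psd_Dl pB)// addrC lerD ?diss//.
    have := form_CS sH pB hr hy; rewrite ler_norml => /andP[_] /le_trans.
    by apply; rewrite ler_wpM2r// ltW.
  have Bqq : B q q <= M.
    rewrite -(sqr_form_norm pB)// /M ler_pXn2r ?nnegrE ?form_norm_ge0//; last lra.
    rewrite -(subrK (A y) q) -/r addrC.
    by apply: (le_trans (form_normD sH pB _ _)) => //; rewrite lerD2l ltW.
  have E1 : E (t + h) <= E t * (1 - 2 * c * h) + (e / K) * h.
    rewrite /E eT (psd_DZ sH pB)// -/y.
    have i1 : h * B q y <= h * (- c * B y y + del * N y) by rewrite ler_pM2l.
    have i2 : h ^+ 2 * B q q <= h ^+ 2 * M by rewrite ler_pM2l ?exprn_gt0.
    have i3 : del * N y <= e / K / 4.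
      rewrite /del; have -> : e / (4 * K * (N y + 1)) * N y =
        (e / K / 4) * (N y / (N y + 1)) by field; rewrite !gt_eqF//; lra.
      rewrite ger_pMr ?divr_gt0// ler_pdivrMr; lra.
    have i4 : h * M <= e / K / 2.
      apply: (@le_trans _ _ (d2 * M)); first by rewrite ler_wpM2r// ltW.
      rewrite /d2; have -> : e / (2 * K * (M + 1)) * M =
        (e / K / 2) * (M / (M + 1)) by field; rewrite !gt_eqF//; lra.
      rewrite ger_pMr ?divr_gt0// ler_pdivrMr; lra.
    have i5 : h * (del * N y) <= h * (e / K / 4) by rewrite ler_pM2l.
    have i6 : h * (h * M) <= h * (e / K / 2) by rewrite ler_pM2l.
    have -> : h ^+ 2 = h * h by rewrite expr2.
    nra.
  have Et0 : 0 <= E t by apply: (psd_ge0 pB).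
  have e1 : (1 - 2 * c * h) <= expR (- (2 * c * h)).
    by have := expR_ge1Dx (- (2 * c * h)).
  have -> : 2 * c * (t + h) = 2 * c * t + 2 * c * h by ring.
  rewrite expRD mulrA.
  apply: (@le_trans _ _ ((E t * expR (- (2 * c * h)) + e / K * h) * expR (2 * c * t)
    * expR (2 * c * h))).
    rewrite !ler_wpM2r ?expR_ge0//; apply: (le_trans E1).
    by rewrite lerD2r ler_wpM2l.
  rewrite expRN !mulrDl; apply: lerD.
    by rewrite mulrAC -(mulrA (E t)) mulVf ?gt_eqF ?expR_gt0// mulr1.
  rewrite -!mulrA -expRD ler_pM2l// mulrCA ger_pMr//.
  rewrite mulrC ler_pdivrMr// [leRHS]mul1r /K ler_expR.
  have : c * h <= c * 1 by rewrite ler_pM2l// ltW.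
  lra.
- have hy : H (T t x) by apply: Hs => //; exact: ltW.
  set y := T t x in hy; set K := expR (2 * c * t).
  have K0 : 0 < K by exact: expR_gt0.
  have Ny := form_norm_ge0 B y.
  (* [k * h] dominates the loss 2 c h E(t) caused by the exponential factor; the summand 1 only
     makes [k] positive. *)
  pose k := 2 * c * E t + 1.
  have Et0 : 0 <= E t by apply: (psd_ge0 pB).
  have k0 : 0 < k by rewrite /k; have := mulr_ge0 (ltW c0) Et0; lra.
  pose del := e / K / (4 * (N y + 1)).
  have del0 : 0 < del by rewrite !divr_gt0// mulr_gt0//; lra.
  have [d d0 hd] := orbit_left_continuous hx t0 del0.
  exists (Num.min d (e / K / 2 / k)); first by rewrite lt_min d0 !divr_gt0.
  move=> h h0; rewrite lt_min => /andP[hhd hhk] ht.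
  have := hd h h0 hhd ht; set z := T (t - h) x; rewrite -/y => Nzy.
  have hz : H z by apply: Hs => //; lra.
  have Nzy0 := form_norm_ge0 B (z - y).
  have hzy : H (z - y) by exact: subspaceB.
  have E1 : E t <= E (t - h) + e / K / 2.
    rewrite /E -/y -/z.
    have -> : B z z = B y y + 2 * 1 * B (z - y) y + 1 ^+ 2 * B (z - y) (z - y).
      by rewrite -(psd_DZ sH pB)// scale1r subrKC.
    have := psd_ge0 pB hzy.
    have := form_CS sH pB hzy hy; rewrite ler_norml => /andP[+ _].
    have : N (z - y) * N y <= del * N y by rewrite ler_wpM2r// ltW.
    have : del * N y <= e / K / 4.
      rewrite /del; have -> : e / K / (4 * (N y + 1)) * N y =
        (e / K / 4) * (N y / (N y + 1)) by field; rewrite !gt_eqF//; lra.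
      rewrite ger_pMr ?divr_gt0// ler_pdivrMr; lra.
    lra.
  have -> : 2 * c * (t - h) = 2 * c * t + - (2 * c * h) by ring.
  rewrite expRD -/K.
  have e1 : (1 - 2 * c * h) <= expR (- (2 * c * h)).
    by have := expR_ge1Dx (- (2 * c * h)).
  have Eth0 : 0 <= E (t - h) by apply: (psd_ge0 pB).
  have e2 : expR (- (2 * c * h)) <= 1.
    by rewrite -[leRHS]expR0 ler_expR; have := mulr_ge0 (ltW c0) h0; lra.
  have i1 : k * h <= e / K / 2.
    by rewrite mulrC -ler_pdivlMr// ltW.
  have i2 : E t <= E (t - h) * expR (- (2 * c * h)) + e / K.
    have j1 : expR (- (2 * c * h)) * E t <=
        expR (- (2 * c * h)) * (E (t - h) + e / K / 2).
      by rewrite ler_pM2l ?expR_gt0.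
    have j2 : (1 - 2 * c * h) * E t <= expR (- (2 * c * h)) * E t.
      by rewrite ler_wpM2r.
    have j3 : expR (- (2 * c * h)) * (e / K / 2) <= e / K / 2.
      by rewrite ger_pMl// !divr_gt0.
    rewrite /k in i1; lra.
  have : E t * K <= (E (t - h) * expR (- (2 * c * h)) + e / K) * K.
    by rewrite ler_pM2r.
  by rewrite mulrDl divfK ?gt_eqF// mulrAC -!mulrA.
Qed.

Hypothesis dense : forall x e, H x -> 0 < e -> exists2 y, D y & N (x - y) < e.

(** At a fixed [t] the density of [D] and the boundedness of [T t] suffice, so it is harmless that
    [C] may depend on [t]. *)
Lemma decay_everywhere x t : H x -> 0 <= t ->
  N (T t x) <= expR (- c * t) * N x.
Proof.
move=> hx t0; apply/ler_addgt0Pr => e e0.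
have [C C0 hC] := bnd t0.
pose K := C + 1.
have K0 : 0 < K by rewrite /K; lra.
have [y Dy xy] := dense hx (divr_gt0 e0 K0).
have hy := domH Dy; have hTy := Hs t0 hy; have hTx := Hs t0 hx.
have h1 : N (T t y) <= expR (- c * t) * N y.
  rewrite -(@ler_pXn2r _ 2)// ?nnegrE ?mulr_ge0 ?form_norm_ge0 ?expR_ge0//.
  rewrite exprMn !(sqr_form_norm pB)//.
  apply: (le_trans (decay_on_domain Dy t0)); rewrite mulrC.
  by rewrite expr2 -expRD le_eqVlt; apply/orP; left; apply/eqP; congr (expR _ * _); ring.
have h2 : N (T t x) <= N (T t y) + N (T t (x - y)).
  rewrite TB// -{1}[T t x](subrK (T t y)) [X in N X]addrC.
  by apply: (form_normD sH pB) => //; exact: subspaceB.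
have h3 : N y <= N x + N (x - y).
  rewrite (form_normB sH pB)// -{1}[y](subrK x) [X in N X]addrC.
  by apply: (form_normD sH pB) => //; exact: subspaceB.
have h4 := hC _ (subspaceB sH hx hy).
have h5 : C * N (x - y) + N (x - y) <= e.
  rewrite -[X in _ + X]mul1r -mulrDl -/K mulrC -ler_pdivlMr//; exact: ltW.
have e1 : expR (- c * t) <= 1.
  by rewrite -[leRHS]expR0 ler_expR; have := mulr_ge0 (ltW c0) t0; lra.
have h6 : expR (- c * t) * N y <= expR (- c * t) * N x + N (x - y).
  rewrite (le_trans (ler_wpM2l (expR_ge0 _) h3))// mulrDr lerD2l.
  by rewrite ler_piMl ?form_norm_ge0.
lra.
Qed.

Lemma decay_exp_stable : exp_stable H N T.
Proof.
exists 1, c; split=> // t t0; apply: ge_ereal_sup => _ [x [hx x1] <-].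
rewrite lee_fin mul1r (le_trans (decay_everywhere hx t0))//.
by rewrite ger_pMr ?expR_gt0.
Qed.

End semigroup_decay.

(** * Transfer of semigroups and generators to an equivalent norm *)

Section equivalent_norms.
Context {R : realType} {V : lmodType R}.
Variables (H : set V) (N1 N2 : V -> R) (C1 C2 : R).
Hypotheses (sH : lin_subspace H) (C10 : 0 < C1) (C20 : 0 < C2).
Hypotheses (N10 : forall x, 0 <= N1 x) (N20 : forall x, 0 <= N2 x).
Hypotheses (N12 : forall x, H x -> N2 x <= C1 * N1 x)
           (N21 : forall x, H x -> N1 x <= C2 * N2 x).

Lemma equivalent_norm_cvg0 (N N' : V -> R) (C : R) (f : R -> V) :
  0 < C -> (forall x, 0 <= N x) -> (forall x, 0 <= N' x) ->
  (forall x, H x -> N' x <= C * N x) ->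
  (forall h, 0 < h -> H (f h)) ->
  N (f h) @[h --> 0^'+] --> (0 : R) -> N' (f h) @[h --> 0^'+] --> (0 : R).
Proof.
move=> C0 hN hN' hC Hf /cvgrPdist_lt cv; apply/cvgrPdist_lt => /= e e0.
have := cv _ (divr_gt0 e0 C0); apply: filter_app; near=> h.
rewrite !sub0r !normrN !ger0_norm// ltr_pdivlMr// mulrC.
apply: le_lt_trans; apply: hC; apply: Hf.
by near: h; exact: nbhs_right_gt.
Unshelve. all: by end_near. Qed.

Lemma equivalent_C0_semigroup T : C0_semigroup H N1 T -> C0_semigroup H N2 T.
Proof.
case=> hs hl hb hi ha hc; split=> //.
- move=> t t0; have [C hC] := hb t t0; exists (C1 * `|C| * C2) => x hx.
  have hTx := hs _ _ t0 hx.
  rewrite (le_trans (N12 hTx))// -!mulrA ler_pM2l//.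
  rewrite (le_trans (hC x hx))//.
  apply: (@le_trans _ _ (`|C| * N1 x)); first by rewrite ler_wpM2r// ler_norm.
  by rewrite ler_wpM2l// N21.
- move=> x hx; apply: (@equivalent_norm_cvg0 N1 N2 C1) => //; last exact: hc.
  by move=> h h0; apply: subspaceB => //; apply: hs => //; exact: ltW.
Qed.

Lemma equivalent_generator T D A :
  (forall t x, 0 <= t -> H x -> H (T t x)) ->
  generator H N1 T D A -> generator H N2 T D A.
Proof.
move=> hs hA x y; split=> [/hA[hx hy cv]|[hx hy cv]]; [split=> //|apply/hA; split=> //].
- apply: (@equivalent_norm_cvg0 N1 N2 C1) cv => // h h0.
  apply: subspaceB => //; apply: subspaceZ => //; apply: subspaceB => //.
  by apply: hs => //; exact: ltW.
- apply: (@equivalent_norm_cvg0 N2 N1 C2) cv => // h h0.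
  apply: subspaceB => //; apply: subspaceZ => //; apply: subspaceB => //.
  by apply: hs => //; exact: ltW.
Qed.

End equivalent_norms.

(** * Density of polynomials in L2(0, l) *)

Section L2_inner_product.
Context {R : realType} {l : R}.
Local Notation mu := (leb l).
Implicit Types (u v w : L2 l).

Lemma lebE (A : set (measurableTypeR R)) : mu A = lebesgue_measure (A `&` [set` `]0, l[]).
Proof. by []. Qed.

Lemma leb_setTE : 0 < l -> mu [set: R] = l%:E.
Proof.
move=> l0; rewrite lebE setTI lebesgue_measure_itv /= lte_fin l0.
by rewrite -EFinD subr0.
Qed.

Lemma measurable_I : measurable ([set` `]0, l[] : set (measurableTypeR R)).
Proof. exact: measurable_itv. Qed.

Lemma leb_compl : mu (~` [set` `]0, l[]) = 0.
Proof. by rewrite lebE setICl measure0. Qed.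

Lemma ae_in_itv : \forall x \ae mu, 0 < x < l.
Proof.
exists (~` [set` `]0, l[]); split; [apply: measurableC; exact: measurable_I|exact: leb_compl|].
by move=> x /= h /=; rewrite in_itv.
Qed.

#[local] Instance leb_ae_filter : Filter (nbhs (almost_everywhere mu)) :=
  ae_filter_ringOfSetsType mu.

Lemma aeS (P Q : R -> Prop) : (forall x, P x -> Q x) ->
  (\forall x \ae mu, P x) -> \forall x \ae mu, Q x.
Proof. by move=> PQ h; apply: filterS h. Qed.

Lemma aeI (P Q : R -> Prop) :
  (\forall x \ae mu, P x) -> (\forall x \ae mu, Q x) -> \forall x \ae mu, P x /\ Q x.
Proof. by move=> hP hQ; apply: filterS2 hP hQ. Qed.

Lemma leb_integralE (f : R -> \bar R) : measurable_fun [set: measurableTypeR R] f ->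
  (\int[mu]_x f x = \int[lebesgue_measure]_(x in `]0%R, l[) f x)%E.
Proof.
move=> mf.
have mI := measurable_I.
transitivity (\int[mu]_x ((f \_ [set` `]0%R, l[]) x))%E.
  apply: ae_eq_integral => //.
    by apply/measurable_restrict => //; exact: measurable_funS mf.
  apply: aeS ae_in_itv => x hx _.
  have hI : [set` `]0, l[] x by rewrite /= in_itv.
  by rewrite patchE mem_set.
rewrite -integral_mkcond; apply: eq_measure_integral => A mA AI.
by rewrite lebE setIidl.
Qed.

Lemma L2_mem u : (u : R -> R) \in Lfun mu 2.
Proof. exact: L2_repr_subproof. Qed.

Lemma L2_measurable u : measurable_fun [set: measurableTypeR R] (u : R -> R).
Proof. exact: L2_class_measurable. Qed.

Lemma Lfun_mul_integrable (f g : R -> R) : f \in Lfun mu 2 -> g \in Lfun mu 2 ->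
  mu.-integrable [set: _] (EFin \o (fun x => f x * g x)).
Proof. by move=> hf hg; apply/Lfun1_integrable; exact: Lfun2_mul_Lfun1. Qed.

(* Locked, so that unification never unfolds the integral. *)
Fact ip_key : unit. Proof. exact: tt. Qed.
Definition ip : L2 l -> L2 l -> R :=
  locked_with ip_key (fun u v => \int[mu]_x (u x * v x)).

Lemma ip_def u v : ip u v = \int[mu]_x (u x * v x).
Proof. by rewrite /ip unlock. Qed.

Lemma ip_integrable u v : mu.-integrable [set: _] (EFin \o (fun x => u x * v x)).
Proof. by apply: Lfun_mul_integrable; exact: L2_mem. Qed.

Lemma ae_eq_Rintegral (f g : R -> R) :
  measurable_fun [set: measurableTypeR R] f -> measurable_fun [set: measurableTypeR R] g ->
  (\forall x \ae mu, f x = g x) -> \int[mu]_x f x = \int[mu]_x g x.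
Proof.
move=> mf mg fg; congr fine; apply: ae_eq_integral => //.
- exact/measurable_EFinP.
- exact/measurable_EFinP.
- by apply: aeS fg => x /= -> .
Qed.

Lemma measurable_Lfun (f : R -> R) : f \in Lfun mu 2 ->
  measurable_fun [set: measurableTypeR R] f.
Proof. by case/andP; rewrite !inE. Qed.

Lemma ipE u v (f g : R -> R) : f \in Lfun mu 2 -> g \in Lfun mu 2 ->
  (\forall x \ae mu, u x = f x) -> (\forall x \ae mu, v x = g x) ->
  ip u v = \int[mu]_x (f x * g x).
Proof.
move=> hf hg uf vg; rewrite ip_def; apply: ae_eq_Rintegral.
- by apply: measurable_funM; exact: L2_measurable.
- by apply: measurable_funM; exact: measurable_Lfun.
- by apply: aeS (aeI uf vg) => x [] -> ->.
Qed.

Lemma ip_sym u v : ip u v = ip v u.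
Proof. by rewrite !ip_def; apply: eq_Rintegral => x _; rewrite mulrC. Qed.

Lemma ip_linear a u v w : ip (a *: u + v) w = a * ip u w + ip v w.
Proof.
rewrite !ip_def -RintegralZl//; last exact: ip_integrable.
rewrite -RintegralD//; last 2 first.
- have := integrableZl (measurableT : measurable [set: measurableTypeR R]) a (ip_integrable u w).
  by apply: eq_integrable => // x _ /=; rewrite EFinM.
- exact: ip_integrable.
apply: ae_eq_Rintegral.
- by apply: measurable_funM; exact: L2_measurable.
- apply: measurable_funD; last by apply: measurable_funM; exact: L2_measurable.
  by apply: measurable_funM => //; apply: measurable_funM; exact: L2_measurable.
- apply: aeS (aeI (L2_addE (a *: u) v) (L2_scaleE a u)) => x [] -> ->.
  by rewrite mulrDl mulrA.
Qed.

Lemma ip_ge0 u : 0 <= ip u u.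
Proof. by rewrite ip_def; apply: Rintegral_ge0 => x _; rewrite -expr2 sqr_ge0. Qed.

Lemma ip_eq0 u : ip u u = 0 -> u = 0.
Proof.
rewrite ip_def => u0; apply: L2_eqP.
have /ae_eq_integral_abs : (\int[mu]_x `|(u x * u x)%:E| = 0)%E.
  have <- : (\int[mu]_x (u x * u x)%:E = 0)%E.
    rewrite -[LHS]fineK; first by rewrite -[fine _]/(\int[mu]_x (u x * u x)) u0.
    by apply: integrable_fin_num => //; exact: ip_integrable.
  by apply: eq_integral => x _; rewrite gee0_abs// lee_fin -expr2 sqr_ge0.
move=> /(_ measurableT) h.
have /h : measurable_fun [set: measurableTypeR R] (fun x => (u x * u x)%:E).
  by apply/measurable_EFinP; apply: measurable_funM; exact: L2_measurable.
move=> {}h; apply: aeS (aeI h (L2_zeroE mu)) => x [/(_ I) [uu] z] _.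
by rewrite z; move/eqP: uu; rewrite mulf_eq0 orbb => /eqP.
Qed.

Lemma ip_psd : psd_form [set: L2 l] ip.
Proof.
split=> [a u v w _ _ _|u v _ _|u _]; [exact: ip_linear|exact: ip_sym|exact: ip_ge0].
Qed.

Lemma subspaceT : lin_subspace [set: L2 l]. Proof. by split. Qed.

Lemma ip0l u : ip 0 u = 0. Proof. by apply: (psd_0l subspaceT ip_psd). Qed.
Lemma ip0r u : ip u 0 = 0. Proof. by rewrite ip_sym ip0l. Qed.
Lemma ipDl u v w : ip (u + v) w = ip u w + ip v w.
Proof. by apply: (psd_Dl ip_psd). Qed.
Lemma ipDr u v w : ip w (u + v) = ip w u + ip w v.
Proof. by apply: (psd_Dr subspaceT ip_psd). Qed.
Lemma ipZl a u w : ip (a *: u) w = a * ip u w.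
Proof. by apply: (psd_Zl subspaceT ip_psd). Qed.
Lemma ipZr a u w : ip w (a *: u) = a * ip w u.
Proof. by apply: (psd_Zr subspaceT ip_psd). Qed.
Lemma ipNl u w : ip (- u) w = - ip u w.
Proof. by rewrite -scaleN1r ipZl mulN1r. Qed.
Lemma ipNr u w : ip w (- u) = - ip w u.
Proof. by rewrite ip_sym ipNl ip_sym. Qed.
Lemma ipBl u v w : ip (u - v) w = ip u w - ip v w.
Proof. by rewrite ipDl ipNl. Qed.
Lemma ipBr u v w : ip w (u - v) = ip w u - ip w v.
Proof. by rewrite ipDr ipNr. Qed.

Definition L2norm := form_norm ip.
Lemma sqr_L2norm u : L2norm u ^+ 2 = ip u u. Proof. by apply: (sqr_form_norm ip_psd). Qed.
Lemma L2norm_ge0 u : 0 <= L2norm u. Proof. exact: form_norm_ge0. Qed.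
Lemma ip_CS u v : `|ip u v| <= L2norm u * L2norm v.
Proof. by apply: (form_CS subspaceT ip_psd). Qed.
Lemma L2normD u v : L2norm (u + v) <= L2norm u + L2norm v.
Proof. by apply: (form_normD subspaceT ip_psd). Qed.
Lemma L2normZ a u : L2norm (a *: u) = `|a| * L2norm u.
Proof. by apply: (form_normZ subspaceT ip_psd). Qed.
Lemma L2norm_distC u v : L2norm (u - v) = L2norm (v - u).
Proof. by apply: (form_normB subspaceT ip_psd). Qed.
Lemma L2norm_triangle u v w : L2norm (u - w) <= L2norm (u - v) + L2norm (v - w).
Proof. exact: (form_norm_triangle subspaceT ip_psd). Qed.

(* The class of f, with junk value 0 when f is not square-integrable. *)
Definition cls : (R -> R) -> L2 l := locked_with ip_key (fun f =>
  if pselect (f \in Lfun mu 2) is left h then L2_of (Lfun_Sub (lee1n 2) h) else 0).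

Lemma clsE (f : R -> R) : f \in Lfun mu 2 -> \forall x \ae mu, cls f x = f x.
Proof.
move=> hf; rewrite /cls unlock; case: pselect => // h.
by apply: aeS (L2_ofE (Lfun_Sub (lee1n 2) h)) => x /(_ I).
Qed.

Lemma cls_eq (f : R -> R) u : f \in Lfun mu 2 -> (\forall x \ae mu, u x = f x) ->
  cls f = u.
Proof.
move=> hf uf; apply: L2_eqP; apply: aeS (aeI uf (clsE hf)) => x [] -> ->.
by [].
Qed.

Lemma clsK u : cls u = u.
Proof. by apply: cls_eq; [exact: L2_mem|exact: aeW]. Qed.

Lemma ip_cls (f g : R -> R) : f \in Lfun mu 2 -> g \in Lfun mu 2 ->
  ip (cls f) (cls g) = \int[mu]_x (f x * g x).
Proof. by move=> hf hg; apply: ipE => //; exact: clsE. Qed.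

Lemma Lfun_lin a (f g : R -> R) : f \in Lfun mu 2 -> g \in Lfun mu 2 ->
  (fun x => a * f x + g x) \in Lfun mu 2.
Proof.
move=> hf hg; have := LfunP (a *: Lfun_Sub (lee1n 2) hf + Lfun_Sub (lee1n 2) hg).
by [].
Qed.

Lemma cls_lin a (f g : R -> R) : f \in Lfun mu 2 -> g \in Lfun mu 2 ->
  cls (fun x => a * f x + g x) = a *: cls f + cls g.
Proof.
move=> hf hg; apply: cls_eq; first exact: Lfun_lin.
apply: aeS (aeI (aeI (clsE hf) (clsE hg))
  (aeI (L2_addE (a *: cls f) (cls g)) (L2_scaleE a (cls f)))) => x [[e1 e2] [-> ->]].
by rewrite e1 e2.
Qed.

Lemma sqr_Lfun (f : R -> R) : measurable_fun [set: measurableTypeR R] f ->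
  (\int[mu]_x (f x ^+ 2)%:E < +oo)%E -> f \in Lfun mu 2.
Proof.
move=> mf fi; rewrite inE; apply/andP; split; rewrite inE //=.
rewrite /finite_norm unlock /= poweR_lty//.
by under eq_integral do rewrite powR_mulrn// real_normK ?num_real//.
Qed.

Lemma le_Lfun (f g : R -> R) : measurable_fun [set: measurableTypeR R] f ->
  g \in Lfun mu 2 -> (forall x, 0 < x < l -> `|f x| <= `|g x|) -> f \in Lfun mu 2.
Proof.
move=> mf hg fg; apply: sqr_Lfun => //.
have mg := measurable_Lfun hg.
have mf2 : measurable_fun [set: measurableTypeR R] (EFin \o (fun x => f x ^+ 2)).
  by apply/measurable_EFinP; exact: measurable_funX.
have mg2 : measurable_fun [set: measurableTypeR R] (EFin \o (fun x => g x ^+ 2)).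
  by apply/measurable_EFinP; exact: measurable_funX.
rewrite (leb_integralE mf2).
apply: (@le_lt_trans _ _ (\int[lebesgue_measure]_(x in `]0%R, l[) (g x ^+ 2)%:E)%E).
  apply: ge0_le_integral => //.
  - by move=> x _; rewrite lee_fin sqr_ge0.
  - exact: measurable_funS mf2.
  - exact: measurable_funS mg2.
  - move=> x /=; rewrite in_itv /= => hx; rewrite lee_fin.
    by rewrite -(real_normK (num_real (f x))) -(real_normK (num_real (g x)))
       ler_pXn2r ?nnegrE ?fg.
rewrite -(leb_integralE mg2).
have /integrableP[_] := Lfun2_integrable_sqr hg.
congr (_ < _)%E; apply: eq_integral => x _ /=.
by rewrite ger0_norm ?sqr_ge0.
Qed.

Lemma cst_Lfun (c : R) : (fun=> c) \in Lfun mu 2.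
Proof.
apply: sqr_Lfun => //; rewrite integral_cst//.
have : (mu [set: R] < +oo)%E.
  rewrite lebE setTI lebesgue_measure_itv /=; case: ifP => // _.
  by rewrite -EFinD ltry.
by move=> h; rewrite lte_mul_pinfty// lee_fin sqr_ge0.
Qed.

Lemma bounded_Lfun (f : R -> R) M : measurable_fun [set: measurableTypeR R] f ->
  (forall x, 0 < x < l -> `|f x| <= M) -> f \in Lfun mu 2.
Proof.
move=> mf fM; apply: (le_Lfun mf (cst_Lfun M)) => x hx.
by rewrite (le_trans (fM x hx))// ler_norm.
Qed.

Lemma bounded_mul_Lfun (f g : R -> R) M : measurable_fun [set: measurableTypeR R] f ->
  (forall x, 0 < x < l -> `|f x| <= M) -> g \in Lfun mu 2 ->
  (fun x => f x * g x) \in Lfun mu 2.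
Proof.
move=> mf fM hg.
have hM : (fun x => M * g x) \in Lfun mu 2.
  have := Lfun_lin M hg (cst_Lfun 0).
  by rewrite (_ : (fun x => _) = (fun x => M * g x))//; apply/funext => x; rewrite addr0.
apply: (le_Lfun _ hM) => [|x hx].
  by apply: measurable_funM => //; exact: measurable_Lfun.
by rewrite !normrM ler_wpM2r// (le_trans (fM x hx))// ler_norm.
Qed.

Lemma L2_dominated (F : nat -> R -> R) (f g : R -> R) (e : R) :
  (forall n, measurable_fun [set: measurableTypeR R] (F n)) ->
  measurable_fun [set: measurableTypeR R] f ->
  (\forall x \ae mu, F n x @[n --> \oo] --> f x) ->
  g \in Lfun mu 2 ->
  (forall n x, 0 < x < l -> `|F n x - f x| <= `|g x|) -> 0 < e ->
  \forall n \near \oo, \int[mu]_x ((F n x - f x) ^+ 2) < e.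
Proof.
move=> mF mf Ff hg Fg e0.
have mD n : measurable_fun [set: measurableTypeR R] (fun x => ((F n x - f x) ^+ 2)%:E).
  by apply/measurable_EFinP; apply: measurable_funX; exact: measurable_funB.
have [||||_ _ h] := @dominated_convergence _ _ _ mu setT measurableT
  (fun n x => ((F n x - f x) ^+ 2)%:E) (cst 0%E) (fun x => (g x ^+ 2)%:E) mD.
- by [].
- apply: aeS Ff => x Ffx _; apply/fine_cvgP; split; first exact: nearW.
  have h : (F n x - f x) ^+ 2 @[n --> \oo] --> (0 : R).
    rewrite [X in _ --> X](_ : 0 = (f x - f x) * (f x - f x)); last by rewrite subrr mulr0.
    under eq_fun do rewrite expr2.
    by apply: cvgM; apply: cvgB; [exact: Ffx|exact: cvg_cst|exact: Ffx|exact: cvg_cst].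
  exact: h.
- exact: Lfun2_integrable_sqr.
- apply: aeS ae_in_itv => x hx n _; rewrite lee_fin ger0_norm ?sqr_ge0//.
  rewrite -(real_normK (num_real (F n x - f x))) -(real_normK (num_real (g x))).
  by rewrite ler_pXn2r ?nnegrE ?Fg.
- rewrite integral0 in h; move/fine_cvgP : h => [_ /cvgrPdist_lt/(_ _ e0)].
  apply: filterS => n /=; rewrite sub0r normrN; apply: le_lt_trans.
  exact: ler_norm.
Qed.

End L2_inner_product.

Arguments cls {R} l f.

(** * Polynomial approximation of a step, and truncation *)

Section steps_and_clamps.
Context {R : realType}.

Lemma bernoulli_sub (a : R) m : 0 <= a <= 1 -> 1 - m%:R * a <= (1 - a) ^+ m.
Proof.
move=> /andP[a0 a1]; elim: m => [|m ih]; first by rewrite mul0r subr0 expr0.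
rewrite exprS -natr1.
have m0 : 0 <= m%:R :> R by [].
have := ler_wpM2l (_ : 0 <= 1 - a) ih; rewrite subr_ge0 => /(_ a1).
have := mulr_ge0 m0 (sqr_ge0 a); rewrite expr2; nra.
Qed.

Lemma exp_sub_le_inv (a : R) m : 0 <= a <= 1 -> (1 - a) ^+ m * (1 + m%:R * a) <= 1.
Proof.
move=> /andP[a0 a1]; elim: m => [|m ih]; first by rewrite mul0r addr0 expr0 mulr1.
rewrite exprS -natr1.
have m0 : 0 <= m%:R :> R by [].
apply: le_trans ih; rewrite [X in X * _]mulrC -mulrA ler_wpM2l ?exprn_ge0 ?subr_ge0//.
have := mulr_ge0 m0 (sqr_ge0 a); have := sqr_ge0 a; rewrite expr2; nra.
Qed.

(* Polynomials converging boundedly to the step function of [0, 1/2[. *)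
Lemma step_poly_range (t : R) n : 0 <= t <= 1 -> 0 <= (1 - t ^+ n) ^+ (2 ^ n)%N <= 1.
Proof.
move=> /andP[t0 t1]; have h : 0 <= t ^+ n <= 1 by rewrite exprn_ge0// exprn_ile1.
case/andP: h => h1 h2.
by rewrite exprn_ge0 ?subr_ge0// exprn_ile1 ?subr_ge0// lerBlDr lerDl.
Qed.

(** Both sides are squeezed with (2 t)^n: below 1/2 Bernoulli's inequality gives the lower bound 1 -
    (2 t)^n, above 1/2 the inverse form gives the upper bound 1 / (1 + (2 t)^n). At t = 1/2 the
    limit would be 1/e, hence the exclusion. *)
Lemma cvg_step_poly (t : R) : 0 <= t <= 1 -> t != 1 / 2 ->
  (1 - t ^+ n) ^+ (2 ^ n)%N @[n --> \oo] --> ((t <= 1 / 2)%R%:R : R).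
Proof.
move=> t01 t2; case/andP: (t01) => t0 t1.
have tn n : 0 <= t ^+ n <= 1 by rewrite exprn_ge0// exprn_ile1.
have rng n := step_poly_range n t01.
have [th|th] := leP t (1 / 2).
- have t2' : `|2 * t| < 1.
    rewrite ger0_norm; last by lra.
    have : t < 1 / 2 by rewrite lt_neqAle t2.
    lra.
  apply: (@squeeze_cvgr _ _ _ _ (fun n => 1 - (2 * t) ^+ n) (fun=> 1)).
  + apply: nearW => n; case/andP: (rng n) => _ ->; rewrite andbT.
    by rewrite exprMn -natrX; exact: bernoulli_sub.
  + rewrite -[X in _ --> X]subr0; apply: cvgB; [exact: cvg_cst|exact: cvg_expr].
  + exact: cvg_cst.
- have t2' : `|(2 * t)^-1| < 1.
    rewrite ger0_norm; last by rewrite invr_ge0; lra.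
    rewrite invf_lt1; lra.
  apply: (@squeeze_cvgr _ _ _ _ (fun=> 0) (fun n => (2 * t)^-1 ^+ n)).
  + apply: nearW => n; case/andP: (rng n) => -> _ /=.
    have p0 : 0 < (2 * t) ^+ n by rewrite exprn_gt0//; lra.
    rewrite exprVn -[leRHS]div1r ler_pdivlMr//.
    apply: le_trans (exp_sub_le_inv (2 ^ n)%N (tn n)).
    rewrite ler_wpM2l//; first by case/andP: (rng n).
    by rewrite natrX -exprMn lerDr.
  + exact: cvg_cst.
  + exact: cvg_expr.
Qed.

(** A monotone boolean sequence jumps exactly once, so a single increment survives. With [b k]
    meaning x <= c_k this evaluates a step function at x. *)
Lemma monotone_step_sum n (a : nat -> R) (b : nat -> bool) :
  (forall k, b k -> b k.+1) -> ~~ b 0%N -> b n ->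
  exists2 k, [&& (k < n)%N, b k.+1 & ~~ b k] &
    \sum_(i < n) a i * ((b i.+1)%:R - (b i)%:R) = a k.
Proof.
move=> bS b0; elim: n => [|n ih] bn; first by rewrite bn in b0.
have [bn'|bn'] := boolP (b n).
- have [k /and3P[k1 k2 k3] kE] := ih bn'; exists k; first by rewrite k2 k3 ltnS ltnW.
  by rewrite big_ord_recr /= kE bn bn' subrr mulr0 addr0.
- exists n; first by rewrite ltnSn bn bn'.
  rewrite big_ord_recr /= bn (negbTE bn') subr0 mulr1 big1 ?add0r// => i _.
  have bF j : (j <= n)%N -> b j = false.
    move=> jn; apply/negbTE; apply: contra bn' => bj.
    by rewrite -(subnKC jn); elim: (n - j)%N => [|m ihm]; rewrite ?addn0// addnS bS.
  by rewrite !bF ?subrr ?mulr0//; exact: ltnW.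
Qed.

Definition clamp (M y : R) : R := Num.max (- M) (Num.min M y).

Lemma clamp_lipschitz M y z : `|clamp M y - clamp M z| <= `|y - z|.
Proof.
rewrite /clamp; have := ler_norm (y - z); have := ler_norm (z - y).
rewrite (distrC z y) ler_norml.
by case: (leP M y); case: (leP M z); case: (leP (- M) M); case: (leP (- M) y);
  case: (leP (- M) z) => *; apply/andP; split; lra.
Qed.

Lemma clamp_id M y : `|y| <= M -> clamp M y = y.
Proof. by rewrite ler_norml /clamp => /andP[h1 h2]; rewrite min_r// max_r. Qed.

Lemma clamp_le M y : 0 <= M -> `|clamp M y| <= M.
Proof.
move=> M0; rewrite /clamp ler_norml.
by case: (leP M y); case: (leP (- M) M); case: (leP (- M) y) => *; apply/andP; split; lra.
Qed.

Lemma clamp0 M : 0 <= M -> clamp M 0 = 0.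
Proof. by move=> M0; rewrite clamp_id// normr0. Qed.

Lemma continuous_clamp M : continuous (clamp M).
Proof.
move=> x; apply/cvgrPdist_lt => e e0; exists e => //= y.
by apply: le_lt_trans; exact: clamp_lipschitz.
Qed.

End steps_and_clamps.

(** * From polynomials through indicator, continuous and bounded functions to all of L2 *)

Section L2_polynomials.
Context {R : realType} {l : R}.
Hypothesis l0 : 0 < l.
Local Notation mu := (leb l).
Implicit Types (u v w : L2 l) (p q : {poly R}).

Lemma continuous_bounded_itv (f : R -> R) : continuous f ->
  exists M, forall x, 0 <= x <= l -> `|f x| <= M.
Proof.
move=> cf; have [|c _ hc] := @EVT_max R (fun x => `|f x|) 0 l (ltW l0).
  apply: continuous_subspaceT => x; apply: continuous_comp; first exact: cf.
  exact: norm_continuous.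
by exists `|f c| => x hx; apply: hc; rewrite in_itv.
Qed.

Lemma continuous_Lfun (f : R -> R) : continuous f -> f \in Lfun mu 2.
Proof.
move=> cf; have [M hM] := continuous_bounded_itv cf.
apply: (@bounded_Lfun _ _ _ M); first exact: continuous_measurable_fun.
by move=> x /andP[x0 xl]; rewrite hM// !ltW.
Qed.

Lemma leb_FTC2 (F f : R -> R) : (forall x : R, is_derive x (1 : R) F (f x)) -> continuous f ->
  \int[mu]_x f x = F l - F 0.
Proof.
move=> dF cf; have mf := continuous_measurable_fun cf.
rewrite /Rintegral leb_integralE; last exact/measurable_EFinP.
rewrite -(@integral_itv_bndoo _ 0 l _ true false); last first.
  by apply: measurable_funTS; exact/measurable_EFinP.
have cF : continuous F.
  by move=> x; apply/differentiable_continuous/derivable1_diffP; have [] := dF x.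
rewrite (continuous_FTC2 (F := F)) //.
- exact: continuous_subspaceT.
- split; first by move=> x _; have [] := dF x.
  + by apply: cvg_at_right_filter; exact: cF.
  + by apply: cvg_at_left_filter; exact: cF.
- by move=> x _; rewrite derive1E; have [] := dF x.
Qed.

Definition polyL p : L2 l := cls l (horner p).

Lemma horner_Lfun p : horner p \in Lfun mu 2.
Proof. by apply: continuous_Lfun; exact: continuous_horner. Qed.

Lemma polyL_lin a p q : polyL (a *: p + q) = a *: polyL p + polyL q.
Proof.
rewrite -cls_lin; [|exact: horner_Lfun..].
by congr cls; apply/funext => x; rewrite !hornerE.
Qed.

(* The primitive vanishing at 0; the coefficient i = 0 is a quotient by 0, which is 0. *)
Definition primp p : {poly R} := \poly_(i < (size p).+1) (p`_i.-1 / i%:R).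

Lemma deriv_primp p : (primp p)^`() = p.
Proof.
apply/polyP => i; rewrite coef_deriv coef_poly ltnS.
case: ltnP => hi /=; last by rewrite mul0rn nth_default.
by rewrite -[LHS]mulr_natr mulfVK// pnatr_eq0.
Qed.

Lemma primp0 p : (primp p).[0] = 0.
Proof. by rewrite horner_coef0 coef_poly /= invr0 mulr0. Qed.

Lemma Rintegral_horner p : \int[mu]_x p.[x] = (primp p).[l].
Proof.
have d x : is_derive (x : R) (1 : R) (horner (primp p)) p.[x].
  by rewrite -{2}[p]deriv_primp; exact: is_derive_poly.
by rewrite (leb_FTC2 d (@continuous_horner R p)) primp0 subr0.
Qed.

Lemma ip_polyL p q : ip (polyL p) (polyL q) = (primp (p * q)).[l].
Proof.
rewrite ip_cls ?horner_Lfun// -Rintegral_horner.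
by apply: eq_Rintegral => x _; rewrite hornerM.
Qed.

Definition approx u := forall e : R, 0 < e -> exists p, L2norm (u - polyL p) < e.

Lemma approx_lin a u v : approx u -> approx v -> approx (a *: u + v).
Proof.
move=> hu hv e e0.
have a1 : 0 < `|a| + 1 by rewrite ltr_wpDl.
have e2 : 0 < e / 2 by rewrite divr_gt0.
have [p hp] := hu _ (divr_gt0 e2 a1).
have [q hq] := hv _ e2.
exists (a *: p + q).
rewrite polyL_lin opprD addrACA -scalerBr.
apply: (le_lt_trans (L2normD _ _)); rewrite L2normZ.
have : `|a| * L2norm (u - polyL p) <= e / 2.
  have := ltW hp; rewrite ler_pdivlMr// mulrC; apply: le_trans.
  by rewrite ler_wpM2r ?L2norm_ge0// lerDl.
lra.
Qed.

Lemma approx_polyL p : approx (polyL p).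
Proof. by move=> e e0; exists p; rewrite subrr /L2norm /form_norm ip0l sqrtr0. Qed.

Lemma approx_closed u :
  (forall e : R, 0 < e -> exists2 v, approx v & L2norm (u - v) < e) -> approx u.
Proof.
move=> h e e0; have e2 : 0 < e / 2 by rewrite divr_gt0.
have [v hv uv] := h _ e2; have [p hp] := hv _ e2.
exists p; apply: (le_lt_trans (L2norm_triangle _ v _)); lra.
Qed.

Lemma approx_sum n (a : nat -> R) (F : nat -> L2 l) : (forall i, approx (F i)) ->
  approx (\sum_(i < n) a i *: F i).
Proof.
move=> hF; elim: n => [|n ih].
  rewrite big_ord0; have := approx_polyL 0; have := polyL_lin (-1) 0 0.
  by rewrite scaler0 addr0 scaleN1r addNr => ->.
by rewrite big_ord_recr /= addrC; apply: approx_lin.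
Qed.

Lemma L2norm_cls_lt (f g : R -> R) (e : R) : f \in Lfun mu 2 -> g \in Lfun mu 2 ->
  0 < e -> \int[mu]_x ((f x - g x) ^+ 2) < e ^+ 2 -> L2norm (cls l f - cls l g) < e.
Proof.
move=> hf hg e0 h; rewrite -(@ltr_pXn2r _ 2)// ?nnegrE ?L2norm_ge0 ?ltW//.
rewrite sqr_L2norm; apply: le_lt_trans h.
have hd := Lfun_lin (-1) hg hf.
rewrite le_eqVlt (ipE hd hd); first by apply/orP; left; apply/eqP;
  apply: eq_Rintegral => x _; rewrite expr2 mulN1r addrC.
- apply: aeS (aeI (aeI (clsE hf) (clsE hg)) (aeI (L2_addE (cls l f) (- cls l g))
    (L2_oppE (cls l g)))) => x [[e1 e2] [-> ->]].
  by rewrite e1 e2 mulN1r addrC.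
- apply: aeS (aeI (aeI (clsE hf) (clsE hg)) (aeI (L2_addE (cls l f) (- cls l g))
    (L2_oppE (cls l g)))) => x [[e1 e2] [-> ->]].
  by rewrite e1 e2 mulN1r addrC.
Qed.

Lemma approx_dominated (F : nat -> R -> R) (f g : R -> R) :
  (forall n, F n \in Lfun mu 2) -> f \in Lfun mu 2 ->
  (\forall x \ae mu, F n x @[n --> \oo] --> f x) ->
  g \in Lfun mu 2 ->
  (forall n x, 0 < x < l -> `|F n x - f x| <= `|g x|) ->
  (forall n, approx (cls l (F n))) -> approx (cls l f).
Proof.
move=> hF hf Ff hg Fg aF; apply: approx_closed => e e0.
have mF n := measurable_Lfun (hF n); have mf := measurable_Lfun hf.
have e20 : 0 < e ^+ 2 by rewrite exprn_gt0.
have [n _ hn] := L2_dominated mF mf Ff hg Fg e20.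
exists (cls l (F n)) => //; rewrite L2norm_distC.
by apply: L2norm_cls_lt => //; apply: hn => /=.
Qed.

Definition indf (c x : R) : R := (x <= c)%R%:R.

Lemma indf_Lfun c : indf c \in Lfun mu 2.
Proof.
apply: (@bounded_Lfun _ _ _ 1) => [|x _]; last by rewrite /indf; case: (x <= c); rewrite ?normr1 ?normr0 ?ler01.
rewrite (_ : indf c = \1_([set` `]-oo, c]] : set R)).
  by apply: measurable_indic; exact: measurable_itv.
by apply/funext => x; rewrite indicE /indf mem_setE in_itv.
Qed.

Definition ind (c : R) : L2 l := cls l (indf c).

Lemma ae_neq (c : R) : \forall x \ae mu, x != c.
Proof.
have m1 : measurable ([set c] : set (measurableTypeR R)) by exact: measurable_set1.
exists [set c]; split=> //.
- have : (mu [set c] <= lebesgue_measure [set c])%E.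
    rewrite lebE; apply: le_measure => //; rewrite inE//=.
    by apply: measurableI => //; exact: measurable_I.
  by rewrite lebesgue_measure_set1 measure_le0 => /eqP.
- by move=> x /= /negP; rewrite negbK => /eqP.
Qed.

Lemma approx_ind c : approx (ind c).
Proof.
(* The affine map [q] sends c to 1/2; this [L] is large enough, for any real c, that (0, l) is sent
   into [0, 1]. *)
pose L := `|c| + l; have L0 : 0 < L by rewrite ltr_wpDl.
pose q : {poly R} := (2 * L)^-1 *: ('X - (c - L)%:P).
have qE x : q.[x] = (x - c + L) / (2 * L).
  rewrite /q hornerZ hornerXsubC [RHS]mulrC; congr (_ * _); ring.
have L2 : 0 < 2 * L by rewrite mulr_gt0.
have q01 x : 0 < x < l -> 0 <= q.[x] <= 1.
  move=> /andP[x0 xl]; rewrite qE ler_pdivrMr// mul1r divr_ge0/=; last exact: ltW.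
    by rewrite /L; have := ler_norm (- c); rewrite normrN; lra.
  by rewrite /L; have := ler_norm c; lra.
pose F n := horner ((1 - q ^+ n) ^+ (2 ^ n)%N).
have FE n x : F n x = (1 - q.[x] ^+ n) ^+ (2 ^ n)%N by rewrite /F !hornerE.
apply: (@approx_dominated F (indf c) (fun=> 1)).
- by move=> n; exact: horner_Lfun.
- exact: indf_Lfun.
- apply: aeS (aeI ae_in_itv (ae_neq c)) => x [hx xc].
  have -> : indf c x = (q.[x] <= 1 / 2)%R%:R.
    by rewrite /indf qE ler_pdivrMr//; congr (_%:R); congr (nat_of_bool _);
      apply/idP/idP; lra.
  under eq_fun do rewrite FE.
  apply: cvg_step_poly; first exact: q01.
  rewrite qE; apply: contra xc => /eqP h; apply/eqP.
  have : x - c + L = 1 / 2 * (2 * L) by rewrite -h divfK// gt_eqF.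
  lra.
- exact: cst_Lfun.
- move=> n x hx; rewrite FE normr1 /indf.
  have /andP[] := step_poly_range n (q01 x hx).
  by rewrite ler_norml; case: (x <= c) => /= h1 h2; apply/andP; split; lra.
- by move=> n; exact: approx_polyL.
Qed.

Lemma cls_step_function (a c : nat -> R) m :
  let F x := \sum_(i < m) a i * (indf (c i.+1) x - indf (c i) x) in
  F \in Lfun mu 2 /\ cls l F = \sum_(i < m) a i *: (ind (c i.+1) - ind (c i)).
Proof.
elim: m => [|m [h1 h2]] F.
  rewrite (_ : F = (fun=> 0)); last by apply/funext => x; rewrite /F big_ord0.
  split; first exact: cst_Lfun.
  by rewrite big_ord0; apply: cls_eq; [exact: cst_Lfun|exact: L2_zeroE].
pose d x := indf (c m.+1) x - indf (c m) x.
have dE : (fun x => -1 * indf (c m) x + indf (c m.+1) x) = d.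
  by apply/funext => x; rewrite mulN1r addrC.
have hd : d \in Lfun mu 2 by rewrite -dE; apply: Lfun_lin; exact: indf_Lfun.
have cd : cls l d = ind (c m.+1) - ind (c m).
  by rewrite -dE cls_lin ?indf_Lfun// scaleN1r addrC.
have FE : (fun x => a m * d x + \sum_(i < m) a i * (indf (c i.+1) x - indf (c i) x)) = F.
  by apply/funext => x; rewrite /F big_ord_recr addrC.
by rewrite -FE cls_lin// h2 cd big_ord_recr addrC; split=> //; exact: Lfun_lin.
Qed.

(** Step functions on a uniform subdivision, with the values of [f] at left endpoints, converge
    pointwise on (0, l) and stay within 2 M of [f]; they are combinations of the indicators already
    treated. *)
Lemma approx_continuous (f : R -> R) : continuous f -> approx (cls l f).
Proof.
move=> cf; have [M hM] := continuous_bounded_itv cf.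
pose c n (k : nat) : R := k%:R * l / n.+1%:R.
pose F n x : R := \sum_(i < n.+1) f (c n i) * (indf (c n i.+1) x - indf (c n i) x).
have c0 n : c n 0%N = 0 by rewrite /c !mul0r.
have cS n k : c n k < c n k.+1.
  by rewrite /c ltr_pM2r ?invr_gt0// ltr_pM2r// ltr_nat.
have cl n : c n n.+1 = l by rewrite /c mulrAC divff ?mul1r// pnatr_eq0.
have FE n x : 0 < x < l -> exists2 t, F n x = f t & 0 <= t <= l /\ `|t - x| <= l / n.+1%:R.
  move=> /andP[x0 xl]; pose b k := x <= c n k.
  have [k xk|||k /and3P[k1 k2 k3] kE] := @monotone_step_sum R n.+1 (fun k => f (c n k)) b.
  - by rewrite /b (le_trans xk)// ltW.
  - by rewrite /b c0 -ltNge.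
  - by rewrite /b cl ltW.
  exists (c n k); first exact: kE.
  rewrite /b -ltNge in k3; rewrite /b in k2.
  have ck : c n k.+1 = c n k + l / n.+1%:R by rewrite /c -natr1 !mulrDl mul1r.
  split; first by rewrite divr_ge0 ?mulr_ge0 ?(ltW l0)//= ltW// (lt_trans k3).
  have : 0 <= l / n.+1%:R by rewrite divr_ge0 ?(ltW l0).
  rewrite ler_norml; move: k2 k3; rewrite ck; move: (l / _) (c n k) => d1 d2 *.
  by apply/andP; split; lra.
have FL n := cls_step_function (fun k => f (c n k)) (c n) n.+1.
apply: (@approx_dominated F f (fun=> 2 * M)).
- by move=> n; case: (FL n).
- exact: continuous_Lfun.
- apply: aeS ae_in_itv => x hx; apply/cvgrPdist_lt => e e0.
  have /cvgrPdist_lt/(_ _ e0)[d /= d0 hd] := cf x.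
  near=> n; have [t -> [_ tx]] := FE n x hx.
  apply: hd => /=; rewrite distrC (le_lt_trans tx)//.
  rewrite ltr_pdivrMr// mulrC -ltr_pdivrMr//.
  apply: lt_trans (_ : n%:R < _); last by rewrite ltr_nat.
  by near: n; exact: nbhs_infty_gtr.
- exact: cst_Lfun.
- move=> n x hx; have [t -> [tl _]] := FE n x hx.
  have hx' : 0 <= x <= l by case/andP: hx => ? ?; apply/andP; split; exact: ltW.
  have h1 := hM t tl; have h2 := hM x hx'.
  rewrite (le_trans (ler_normB _ _))//; have := ler_norm (2 * M); lra.
- move=> n; have [_ ->] := FL n.
  apply: (@approx_sum n.+1 (fun k => f (c n k)) (fun k => ind (c n k.+1) - ind (c n k))) => i.
  rewrite addrC -scaleN1r; apply: approx_lin; exact: approx_ind.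
Unshelve. all: by end_near. Qed.

Lemma clamp_Lfun M (f : R -> R) : 0 <= M ->
  measurable_fun [set: measurableTypeR R] f -> clamp M \o f \in Lfun mu 2.
Proof.
move=> M0 mf; apply: (@bounded_Lfun _ _ _ M) => [|x _]; last exact: clamp_le.
exact: (measurableT_comp (continuous_measurable_fun (@continuous_clamp R M)) mf).
Qed.

(** Continuous functions approximate [f] in L1. Clamping them to [-M, M] does not move them away
    from [f], and |f - clamp g|^2 <= 2 M |f - g| turns L1 convergence into L2 convergence. *)
Lemma approx_bounded (f : R -> R) (M : R) : 0 <= M ->
  measurable_fun [set: measurableTypeR R] f -> (forall x, `|f x| <= M) ->
  approx (cls l f).
Proof.
move=> M0 mf fM; have hf : f \in Lfun mu 2 by apply: (@bounded_Lfun _ _ _ M).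
pose I : set (measurableTypeR R) := [set` `]0, l[].
have mI : measurable I by exact: measurable_I.
have finE : (lebesgue_measure I < +oo)%E.
  by rewrite lebesgue_measure_itv /= lte_fin l0 -EFinD ltry.
have fi : lebesgue_measure.-integrable I (EFin \o f).
  apply: measurable_bounded_integrable => //; first exact: measurable_funTS.
  exists M; split; first exact: num_real.
  by move=> x Mx y _ /=; rewrite (le_trans (fM y))// ltW.
have [g [cg gi gE]] := approximation_continuous_integrable mI finE fi.
apply: approx_closed => e e0.
pose e2 := e ^+ 2 / (2 * (M + 1)).
have M1 : 0 < M + 1 by lra.
have e20 : 0 < e2 by rewrite divr_gt0 ?exprn_gt0// mulr_gt0.
have /fine_cvgP[_ /cvgrPdist_lt/(_ _ e20)[n _ hn]] := gE.
have cc : continuous (clamp M \o g n).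
  by move=> x; apply: continuous_comp; [exact: cg|exact: continuous_clamp].
exists (cls l (clamp M \o g n)); first exact: approx_continuous.
apply: L2norm_cls_lt => //; first exact: continuous_Lfun.
have mc := continuous_measurable_fun cc.
have mg := continuous_measurable_fun (cg n).
have md : measurable_fun [set: measurableTypeR R] (fun x => (f x - (clamp M \o g n) x) ^+ 2).
  by apply: measurable_funX; exact: measurable_funB.
rewrite /Rintegral leb_integralE; last exact/measurable_EFinP.
have di : lebesgue_measure.-integrable I (EFin \o (fun x => f x - g n x)).
  exact: (integrableB mI fi (gi n)).
have ni : lebesgue_measure.-integrable I (EFin \o (fun x => `|f x - g n x|)).
  exact: integrable_norm di.
have bnd x : (f x - (clamp M \o g n) x) ^+ 2 <= 2 * M * `|f x - g n x|.
  have h1 := clamp_lipschitz M (f x) (g n x); rewrite clamp_id// in h1.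
  have h2 := clamp_le (g n x) M0; have h3 := fM x.
  rewrite -real_normK ?num_real// expr2 ler_pM// (le_trans (ler_normB _ _))//=; lra.
have hn' : \int[lebesgue_measure]_(x in I) `|f x - g n x| < e2.
  have := hn n (leqnn n); rewrite /= sub0r normrN; apply: le_lt_trans.
  exact: ler_norm.
apply: (@le_lt_trans _ _ (\int[lebesgue_measure]_(x in I) (2 * M * `|f x - g n x|))).
  apply: le_Rintegral => //.
  - apply: measurable_bounded_integrable => //; first exact: measurable_funTS.
    exists (4 * M ^+ 2); split; first exact: num_real.
    move=> x Mx y _ /=; apply: (le_trans _ (ltW Mx)).
    rewrite normrX; have h2 := clamp_le (g n y) M0; have h3 := fM y.
    have -> : 4 * M ^+ 2 = (2 * M) ^+ 2 by ring.
    rewrite ler_pXn2r ?nnegrE ?mulr_ge0// (le_trans (ler_normB _ _))//=; lra.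
  - have := integrableZl mI (2 * M) ni.
    by apply: eq_integrable => // x _ /=; rewrite EFinM.
rewrite RintegralZl//.
apply: (@le_lt_trans _ _ (2 * M * e2)); first by rewrite ler_wpM2l ?mulr_ge0// ltW.
rewrite /e2; have -> : 2 * M * (e ^+ 2 / (2 * (M + 1))) = e ^+ 2 * (M / (M + 1)).
  by field; rewrite gt_eqF.
by rewrite gtr_pMr ?exprn_gt0// ltr_pdivrMr// mul1r ltrDl.
Qed.

(** The truncations of [u] at levels n are bounded, and their distance to [u] is dominated by
    |u|. *)
Theorem polynomials_dense u : approx u.
Proof.
rewrite -(clsK u); have mu_u := L2_measurable u.
apply: (@approx_dominated (fun n => clamp n%:R \o u) u u).
- by move=> n; exact: clamp_Lfun.
- exact: L2_mem.
- apply: aeW => x; apply/cvgrPdist_lt => e e0.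
  near=> n; rewrite /= clamp_id ?subrr ?normr0//.
  by near: n; exact: nbhs_infty_ger.
- exact: L2_mem.
- move=> n x _ /=; have := clamp_lipschitz n%:R (u x) 0; rewrite clamp0// !subr0 => h.
  rewrite /clamp; have n0 : (0 : R) <= n%:R by [].
  have h1 := ler_norm (u x); have h2 := ler_norm (- u x); rewrite normrN in h2.
  move: (n%:R : R) n0 (u x) h1 h2 => c c0 y h1 h2.
  rewrite ler_norml.
  by case: (leP c y); case: (leP (- c) c); case: (leP (- c) y) => *; apply/andP; split; lra.
- by move=> n; apply: (@approx_bounded _ n%:R) => //;
    [exact: measurable_Lfun (clamp_Lfun _ _)|move=> x; exact: clamp_le].
Unshelve. all: by end_near. Qed.

Lemma dense_eq0 u : (forall p, ip u (polyL p) = 0) -> u = 0.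
Proof.
move=> h; apply: ip_eq0; apply/eqP; rewrite eq_le ip_ge0 andbT.
apply/ler_addgt0Pr => e e0; rewrite add0r.
have u0 := L2norm_ge0 u.
have u1 : 0 < L2norm u + 1 by lra.
have [p hp] := polynomials_dense u (divr_gt0 e0 u1).
have -> : ip u u = ip u (u - polyL p) by rewrite ipBr h subr0.
apply: (le_trans (ler_norm _)); apply: (le_trans (ip_CS _ _)).
apply: (@le_trans _ _ (L2norm u * (e / (L2norm u + 1)))).
  by rewrite ler_wpM2l// ltW.
by rewrite mulrCA ger_pMr// ler_pdivrMr// mul1r lerDl.
Qed.

(** The bound with [C] is the continuity of [F], which carries its vanishing from the polynomials to
    their closure. *)
Lemma dense_linear (F : L2 l -> R) (C : R) :
  (forall a u v, F (a *: u + v) = a * F u + F v) ->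
  (forall u, `|F u| <= C * L2norm u) ->
  (forall p, F (polyL p) = 0) -> forall u, F u = 0.
Proof.
move=> Flin Fbnd Fp u; apply/eqP; rewrite -normr_le0.
apply/ler_addgt0Pr => e e0; rewrite add0r.
have C1 : 0 < `|C| + 1 by rewrite ltr_wpDl.
have [p hp] := polynomials_dense u (divr_gt0 e0 C1).
have -> : F u = F (u - polyL p).
  have := Flin (-1) (polyL p) u; rewrite Fp mulr0 add0r => <-.
  by rewrite scaleN1r addrC.
apply: (le_trans (Fbnd _)).
apply: (@le_trans _ _ (`|C| * (e / (`|C| + 1)))).
  apply: (@le_trans _ _ (`|C| * L2norm (u - polyL p))).
    by rewrite ler_wpM2r ?L2norm_ge0// ler_norm.
  by rewrite ler_wpM2l// ltW.
by rewrite mulrCA ger_pMr// ler_pdivrMr// mul1r lerDl.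
Qed.

Lemma dense_bilinear (F : L2 l -> L2 l -> R) (C : R) :
  (forall a u v w, F (a *: u + v) w = a * F u w + F v w) ->
  (forall a u v w, F w (a *: u + v) = a * F w u + F w v) ->
  (forall u v, `|F u v| <= C * (L2norm u * L2norm v)) ->
  (forall p q, F (polyL p) (polyL q) = 0) -> forall u v, F u v = 0.
Proof.
move=> Fl Fr Fb Fp u v.
apply: (@dense_linear (F ^~ v) (C * L2norm v)) => [a u1 u2|u1|p]; first exact: Fl.
  by rewrite -mulrA [X in C * X]mulrC.
apply: (@dense_linear (F (polyL p)) (C * L2norm (polyL p))) => [a u1 u2|u1|q] //.
by rewrite -mulrA.
Qed.

End L2_polynomials.

Arguments polyL {R} l p.
Arguments ind {R} l c.

(** * Weak derivatives and traces *)

Section L2_primitive.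
Context {R : realType} {l : R}.
Hypothesis l0 : 0 < l.
Local Notation mu := (leb l).
Implicit Types (u v w : L2 l) (p q : {poly R}).

(* The primitive of v on [0, l], as an inner product so as to be continuous in v. *)
Definition V v (x : R) : R := ip v (ind l x).

Lemma V_lin a u v x : V (a *: u + v) x = a * V u x + V v x.
Proof. exact: ip_linear. Qed.

Lemma indBE x y : \forall t \ae mu, (ind l y - ind l x) t = indf y t - indf x t.
Proof.
apply: aeS (aeI (aeI (clsE (indf_Lfun y)) (clsE (indf_Lfun x)))
  (aeI (L2_addE (ind l y) (- ind l x)) (L2_oppE (ind l x)))) => t [[e1 e2] [-> ->]].
by rewrite e1 e2.
Qed.

Lemma indfB_Lfun x y : (fun t => indf y t - indf x t) \in Lfun mu 2.
Proof.
have := Lfun_lin (-1) (@indf_Lfun R l x) (@indf_Lfun R l y).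
rewrite (_ : (fun t => _) = (fun t => indf y t - indf x t))//.
by apply/funext => t; rewrite mulN1r addrC.
Qed.

Lemma ip_indB x y x' y' : ip (ind l y - ind l x) (ind l y' - ind l x') =
  \int[mu]_t ((indf y t - indf x t) * (indf y' t - indf x' t)).
Proof. by apply: ipE; [exact: indfB_Lfun|exact: indfB_Lfun|exact: indBE|exact: indBE]. Qed.

Lemma ip_indB_le x y : x <= y -> ip (ind l y - ind l x) (ind l y - ind l x) <= y - x.
Proof.
move=> xy; rewrite ip_indB.
pose A : set (measurableTypeR R) := [set` `]x, y]].
have mA : measurable A by exact: measurable_itv.
have -> : \int[mu]_t ((indf y t - indf x t) * (indf y t - indf x t)) =
    \int[mu]_t (\1_A t : R).
  apply: eq_Rintegral => t _; rewrite indicE mem_setE in_itv /= /indf.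
  case: (ltP x t) => h1; case: (leP t y) => h2 /=; try by rewrite ?subr0 ?mulr1 ?subrr ?mulr0.
  by have := le_lt_trans (le_trans h1 xy) h2; rewrite ltxx.
rewrite /Rintegral integral_indic// setIT.
have h : (mu A <= (y - x)%:E)%E.
  rewrite lebE; apply: (@le_trans _ _ (lebesgue_measure A)).
    apply: le_measure => //; rewrite inE//=.
    by apply: measurableI => //; exact: measurable_I.
  rewrite lebesgue_measure_itv /=; case: ifP => _; first by rewrite -EFinD.
  by rewrite lee_fin subr_ge0.
by rewrite -lee_fin fineK// ge0_fin_numE ?measure_ge0// (le_lt_trans h)// ltry.
Qed.

Lemma ip_indB_disjoint x y x' y' : x <= y -> x' <= y' ->
  `]x, y[%classic `&` `]x', y'[%classic = (set0 : set R) ->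
  ip (ind l y - ind l x) (ind l y' - ind l x') = 0.
Proof.
move=> xy xy' dis; rewrite ip_indB.
transitivity (\int[mu]_t (0 : R)); last by rewrite /Rintegral integral0.
apply: eq_Rintegral.
have h a b t : a <= b -> indf b t - indf a t = (a < t <= b)%R%:R :> R.
  rewrite /indf; case: (ltP a t) => h1; case: (leP t b) => h2 ab //=; rewrite ?subrr ?subr0//.
  by have := lt_le_trans h2 (le_trans h1 ab); rewrite ltxx.
move=> t _; rewrite !h// -natrM mulnb.
case: (boolP ((x < t <= y) && (x' < t <= y'))) => // /andP[/andP[h1 h2] /andP[h3 h4]].
(* The hypothesis concerns open intervals, the indicators half-open ones. If t lies in both
   half-open intervals, it may be a common right endpoint, but the midpoint of [m] and t lies in
   both open ones. *)
pose m := Num.max x x'; have mt : m < t by rewrite gt_max h1.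
have : (`]x, y[%classic `&` `]x', y'[%classic) ((m + t) / 2).
  have m1 : x <= m by rewrite le_max lexx.
  have m2 : x' <= m by rewrite le_max lexx orbT.
  by split; rewrite /= in_itv /=; apply/andP; split; lra.
by rewrite dis.
Qed.

Lemma V_diff v x y : V v y - V v x = ip v (ind l y - ind l x).
Proof. by rewrite ipBr. Qed.

(** With the signs s_i of the increments, the sum of their absolute values is the product of [v]
    with S, the sum of the s_i times the indicators of the intervals. These are orthogonal, so |S|^2
    is at most the total length, and Cauchy-Schwarz allows the length d^2. *)
Lemma abs_cont_V v (a b : R) : abs_cont a b (V v).
Proof.
move=> e e0.
pose d := e / (L2norm v + 1); have v0 := L2norm_ge0 v.
have v1 : 0 < L2norm v + 1 by lra.
have d0 : 0 < d by rewrite divr_gt0.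
exists (d ^+ 2); first by rewrite exprn_gt0.
move=> n x y xy dis sxy.
pose E i := ind l (y i) - ind l (x i).
pose s i := Num.sg (ip v (E i)).
pose S := \sum_(i < n) s i *: E i.
have vS : \sum_(i < n) `|V v (y i) - V v (x i)| = ip v S.
  rewrite /S; elim/big_rec2: _ => [|i a1 b1 _ ->]; first by rewrite ip0r.
  by rewrite ipDr ipZr V_diff -/(E i) normrEsg.
have EE i j : i != j -> ip (E i) (E j) = 0.
  move=> ij; have [_ [xi _]] := xy i; have [_ [xj _]] := xy j.
  apply: ip_indB_disjoint => //; apply: contrapT => /eqP/set0P ne.
  by move/eqP: ij; apply; exact: dis.
have ipsum (I : finType) u (F : I -> L2 l) : ip u (\sum_i F i) = \sum_i ip u (F i).
  by elim/big_rec2: _ => [|i a1 b1 _ <-]; rewrite ?ip0r ?ipDr.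
have SS : ip S S <= \sum_(i < n) (y i - x i).
  rewrite {2}/S ipsum; apply: ler_sum => i _.
  rewrite ipZr ip_sym ipsum (bigD1 i)//= big1 ?addr0 => [|j ji]; last first.
    by rewrite ipZr EE ?mulr0// eq_sym.
  rewrite ipZr mulrA -expr2; have [_ [xi _]] := xy i.
  apply: le_trans (ip_indB_le xi); rewrite ler_piMl ?ip_ge0//.
  rewrite -real_normK ?num_real// normr_sg expr2.
  by case: (ip v (E i) != 0); rewrite ?mulr1 ?mulr0 ?ler01.
have Sd : L2norm S < d.
  rewrite -(@ltr_pXn2r _ 2)// ?nnegrE ?L2norm_ge0 ?ltW//.
  by rewrite sqr_L2norm (le_lt_trans SS).
rewrite vS (le_lt_trans (ler_norm _))// (le_lt_trans (ip_CS _ _))//.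
apply: (@le_lt_trans _ _ (L2norm v * d)); first by rewrite ler_wpM2l// ltW.
by rewrite /d mulrCA gtr_pMr// ltr_pdivrMr// mul1r ltrDl.
Qed.

Lemma abs_cont_small (a b : R) (f : R -> R) (e : R) : abs_cont a b f -> 0 < e ->
  exists2 d : R, 0 < d & forall x y, a <= x -> x <= y -> y <= b -> y - x < d ->
    `|f y - f x| < e.
Proof.
move=> acf e0; have [d d0 hd] := acf e e0; exists d => // x y ax xy yb yxd.
have := hd 1%N (fun=> x) (fun=> y); rewrite !big_ord1; apply=> //.
by move=> i j _ _; rewrite (ord1 i) (ord1 j).
Qed.

Lemma continuous_V v : continuous (V v).
Proof.
move=> x; apply/cvgrPdist_lt => e e0.
have [d d0 hd] := abs_cont_small (@abs_cont_V v (x - 1) (x + 1)) e0.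
exists (Num.min 1 d); first by rewrite /= lt_min ltr01.
move=> y /=; rewrite lt_min => /andP[h1 h2].
have [xy|yx] := leP x y.
- rewrite distrC; rewrite distrC ger0_norm ?subr_ge0// in h1 h2.
  by apply: hd => //; lra.
- rewrite gtr0_norm ?subr_gt0// in h1 h2.
  by apply: hd => //; lra.
Qed.

Definition VL v : L2 l := cls l (V v).

Lemma V_Lfun v : V v \in Lfun mu 2.
Proof. by apply: continuous_Lfun => //; exact: continuous_V. Qed.

Lemma VL_E v : \forall x \ae mu, VL v x = V v x.
Proof. exact/clsE/V_Lfun. Qed.

Lemma VL_lin a u v : VL (a *: u + v) = a *: VL u + VL v.
Proof.
rewrite /VL -cls_lin; [|exact: V_Lfun..].
by congr cls; apply/funext => x; rewrite V_lin.
Qed.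

Lemma ind0 x : x <= 0 -> ind l x = 0.
Proof.
move=> x0; apply: cls_eq; first exact: indf_Lfun.
apply: aeS (aeI ae_in_itv (L2_zeroE mu)) => t [/andP[t0 _] ->].
by rewrite /indf leNgt (le_lt_trans x0 t0).
Qed.

Lemma V0 v : V v 0 = 0. Proof. by rewrite /V ind0// ip0r. Qed.

Lemma L2norm_le_bound (f : R -> R) M : 0 <= M -> f \in Lfun mu 2 ->
  (forall x, 0 < x < l -> `|f x| <= M) -> L2norm (cls l f) <= M * Num.sqrt l.
Proof.
move=> M0 hf fM; rewrite -(@ler_pXn2r _ 2)// ?nnegrE ?L2norm_ge0 ?mulr_ge0 ?sqrtr_ge0//.
rewrite sqr_L2norm ip_cls// exprMn sqr_sqrtr ?(ltW l0)//.
have -> : M ^+ 2 * l = \int[mu]_x (M * M).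
  rewrite /Rintegral integral_cst//.
  by rewrite -/(mu setT) leb_setTE//= expr2.
(* The bound on [f] is known on (0, l) only, while the integrals are compared at every real point;
   the clamped function obeys it everywhere and agrees with [f] almost everywhere. *)
pose g x := clamp M (f x).
have mf := measurable_Lfun hf.
have hg : g \in Lfun mu 2 by exact: clamp_Lfun.
have -> : \int[mu]_x (f x * f x) = \int[mu]_x (g x * g x).
  apply: ae_eq_Rintegral; [exact: measurable_funM|by apply: measurable_funM; exact: (measurable_Lfun hg)|].
  by apply: aeS ae_in_itv => x hx; rewrite /g clamp_id// fM.
apply: le_Rintegral => //.
- exact: Lfun_mul_integrable.
- by apply: (@Lfun_mul_integrable _ _ (fun=> M) (fun=> M)); exact: cst_Lfun.
- move=> x _; rewrite -expr2 -real_normK ?num_real// expr2.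
  by rewrite ler_pM// clamp_le.
Qed.

Lemma V_bound v x : `|V v x| <= Num.sqrt l * L2norm v.
Proof.
rewrite mulrC (le_trans (ip_CS _ _))// ler_wpM2l ?L2norm_ge0//.
rewrite -[leRHS]mul1r; apply: L2norm_le_bound => //; first exact: indf_Lfun.
by move=> t _; rewrite /indf; case: (t <= x); rewrite ?normr1 ?normr0.
Qed.

Lemma VL_bound v : L2norm (VL v) <= l * L2norm v.
Proof.
have -> : l * L2norm v = Num.sqrt l * L2norm v * Num.sqrt l.
  by rewrite mulrAC -expr2 sqr_sqrtr// ltW.
apply: L2norm_le_bound; [|exact: V_Lfun|by move=> x _; exact: V_bound].
by rewrite mulr_ge0 ?sqrtr_ge0 ?L2norm_ge0.
Qed.

Lemma indl : ind l l = polyL l 1%:P.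
Proof.
rewrite /ind /polyL; apply: cls_eq; first exact: indf_Lfun.
apply: aeS (aeI (clsE (horner_Lfun l0 1%:P)) ae_in_itv) => t [-> /andP[_ tl]].
by rewrite hornerE /indf ltW.
Qed.

Lemma V_polyL p x : 0 <= x <= l -> V (polyL l p) x = (primp p).[x].
Proof.
move=> /andP[]; rewrite le_eqVlt => /predU1P[<- _|x0]; first by rewrite V0 primp0.
rewrite le_eqVlt => /predU1P[->|xl].
  by rewrite /V indl ip_polyL// mulr1.
rewrite /V ip_cls; [|exact: horner_Lfun|exact: indf_Lfun].
rewrite -(Rintegral_horner x0).
have mp : measurable_fun [set: measurableTypeR R] (fun t => p.[t]).
  exact: continuous_measurable_fun (@continuous_horner R p).
rewrite /Rintegral !leb_integralE; [|exact/measurable_EFinP|]; last first.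
  apply/measurable_EFinP; apply: measurable_funM => //.
  exact: measurable_Lfun (@indf_Lfun R l x).
have -> : (\int[lebesgue_measure]_(t in `]0%R, l[) (p.[t] * indf x t)%:E =
  \int[lebesgue_measure]_(t in `]0%R, l[) (((fun t => p.[t]%:E) \_ [set` `]-oo, x]]) t))%E.
  apply: eq_integral => t _; rewrite patchE mem_setE in_itv /= /indf.
  by case: (t <= x); rewrite ?mulr1 ?mulr0.
rewrite -integral_mkcondr.
have -> : [set` `]0, l[] `&` [set` `]-oo, x]] = [set` `]0, x]] :> set R.
  apply/seteqP; split=> t /=; rewrite !in_itv /=.
    by case=> /andP[-> _] ->.
  by move=> /andP[-> tx]; rewrite tx (le_lt_trans tx xl).
congr fine; apply: integral_itv_bndoo.
by apply: measurable_funTS; exact/measurable_EFinP.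
Qed.

Lemma VL_polyL p : VL (polyL l p) = polyL l (primp p).
Proof.
apply: cls_eq; first exact: V_Lfun.
apply: aeS (aeI (clsE (horner_Lfun l0 (primp p))) ae_in_itv) => x [-> /andP[x0 xl]].
by rewrite V_polyL// !ltW.
Qed.

Lemma deriv0_horner (r : {poly R}) : r^`() = 0 -> r.[l] = r.[0].
Proof.
move=> r0; have d x : is_derive (x : R) (1 : R) (horner r) (0 : R).
  by rewrite -[X in is_derive _ _ _ X](horner0 x) -r0; exact: is_derive_poly.
have := leb_FTC2 l0 d (fun x => cvg_cst 0).
by rewrite /Rintegral integral0 /= => h; apply/eqP; rewrite -subr_eq0 -h.
Qed.

(** The defect is a continuous bilinear form: each of its three terms is at most l |u| |v|, whence
    the constant 3 l. On polynomials it vanishes because a polynomial with zero derivative has equal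
    values at 0 and l. *)
Lemma VL_by_parts u v : ip u (VL v) + ip (VL u) v = V u l * V v l.
Proof.
apply/eqP; rewrite -subr_eq0; apply/eqP.
pose F u v := ip u (VL v) + ip (VL u) v - V u l * V v l.
apply: (@dense_bilinear _ _ l0 F (3 * l)).
- move=> a u1 u2 w; rewrite /F VL_lin V_lin !ip_linear; ring.
- move=> a u1 u2 w; rewrite /F VL_lin V_lin (ip_sym w) (ip_sym (VL w)) !ip_linear.
  rewrite (ip_sym (VL u1)) (ip_sym (VL u2)) (ip_sym u1) (ip_sym u2); ring.
- move=> {}u {}v; rewrite /F.
  have h1 := ip_CS u (VL v); have h2 := ip_CS (VL u) v.
  have h3 : L2norm u * L2norm (VL v) <= l * (L2norm u * L2norm v).
    by rewrite mulrCA ler_wpM2l ?L2norm_ge0// VL_bound.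
  have h4 : L2norm (VL u) * L2norm v <= l * (L2norm u * L2norm v).
    by rewrite mulrA ler_wpM2r ?L2norm_ge0// VL_bound.
  have h5 : `|V u l * V v l| <= l * (L2norm u * L2norm v).
    rewrite normrM; apply: (le_trans (ler_pM _ _ (V_bound u l) (V_bound v l))) => //.
    by rewrite mulrACA -expr2 sqr_sqrtr// ltW.
  rewrite (le_trans (ler_normB _ _))//.
  have := ler_normD (ip u (VL v)) (ip (VL u) v); lra.
- move=> p q; rewrite /F !VL_polyL !ip_polyL// !V_polyL ?(ltW l0) ?lexx//.
  set P := primp p; set Q := primp q.
  have dP : P^`() = p by exact: deriv_primp.
  have dQ : Q^`() = q by exact: deriv_primp.
  have := @deriv0_horner (primp (p * Q) + primp (P * q) - P * Q).
  rewrite derivB derivD !deriv_primp derivM dP dQ subrr => /(_ erefl).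
  rewrite !hornerE !primp0 mul0r subr0 addr0; lra.
Qed.

Lemma ipl1 v : ip v (polyL l 1%:P) = V v l.
Proof. by rewrite -indl. Qed.

End L2_primitive.

Section weak_derivatives.
Context {R : realType} {l : R}.
Hypothesis l0 : 0 < l.
Local Notation mu := (leb l).
Implicit Types (u v w : L2 l) (p q : {poly R}).

Lemma ip_clsr u (f : R -> R) : f \in Lfun mu 2 -> ip u (cls l f) = \int[mu]_x (u x * f x).
Proof. by move=> hf; apply: ipE => //; [exact: L2_mem|exact: aeW|exact: clsE]. Qed.

Lemma test_function0 (phi : R -> R) x : test_function l phi -> ~~ (0 < x < l) -> phi x = 0.
Proof.
case=> _ _ sub; apply: contraNeq => px.
have : closure [set x | phi x != 0] x by apply: subset_closure.
by move=> /sub; rewrite /= in_itv.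
Qed.

Lemma test_function_continuous (phi : R -> R) : test_function l phi -> continuous phi.
Proof.
by case=> d _ _ x; apply/differentiable_continuous/derivable1_diffP.
Qed.

(** In this form the definition is the vanishing of continuous functionals of [u] and [v], to which
    density applies. *)
Lemma is_wderivP u v : is_wderiv u v <-> forall phi, test_function l phi ->
  ip u (cls l (derive1 phi)) + ip v (cls l phi) = 0.
Proof.
split=> h phi tphi; have c1 := test_function_continuous tphi; have [_ c2 _] := tphi.
- rewrite !ip_clsr; [|exact: continuous_Lfun..].
  by rewrite h// addNr.
- have := h phi tphi; rewrite !ip_clsr; [|exact: continuous_Lfun..].
  by move=> /eqP; rewrite addr_eq0 => /eqP.
Qed.

Lemma is_wderiv_lin a u1 v1 u2 v2 : is_wderiv u1 v1 -> is_wderiv u2 v2 ->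
  is_wderiv (a *: u1 + u2) (a *: v1 + v2).
Proof.
move=> /is_wderivP h1 /is_wderivP h2; apply/is_wderivP => phi tphi.
rewrite !ip_linear; have := h1 phi tphi; have := h2 phi tphi => e1 e2.
have -> : forall b c d e : R, a * b + c + (a * d + e) = a * (b + d) + (c + e) by move=> *; ring.
by rewrite e1 e2 mulr0 addr0.
Qed.

Lemma is_wderiv_polyL p : is_wderiv (polyL l p) (polyL l p^`()).
Proof.
apply/is_wderivP => phi tphi; have c1 := test_function_continuous tphi; have [d c2 _] := tphi.
have ch := @continuous_horner R.
rewrite !ip_cls; [|exact: continuous_Lfun..].
rewrite -RintegralD//; [|by apply: Lfun_mul_integrable; exact: continuous_Lfun..].
have D (x : R) : is_derive x (1 : R) (fun t => p.[t] * phi t)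
    (p.[x] * derive1 phi x + p^`().[x] * phi x).
  have h1 : is_derive x (1 : R) (horner p) p^`().[x] by exact: is_derive_poly.
  have h2 : is_derive x (1 : R) phi (derive1 phi x) by rewrite derive1E; exact/derivableP.
  have := @is_deriveM _ _ (horner p) phi x 1 _ _ h1 h2.
  by rewrite [phi x *: _]mulrC.
rewrite (leb_FTC2 l0 D).
  by rewrite !(test_function0 tphi) ?ltxx ?andbF// !mulr0 subrr.
move=> x; apply: cvgD; apply: cvgM; [exact: ch|exact: c2|exact: ch|exact: c1].
Qed.

Lemma is_wderiv_VL v : is_wderiv (VL v) v.
Proof.
apply/is_wderivP => phi tphi.
pose F v := ip (VL v) (cls l (derive1 phi)) + ip v (cls l phi).
apply: (@dense_linear _ _ l0 F (l * L2norm (cls l (derive1 phi)) + L2norm (cls l phi))).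
- by move=> a u1 u2; rewrite /F (VL_lin l0) !ip_linear; ring.
- move=> u; rewrite /F (le_trans (ler_normD _ _))// mulrDl lerD//; last first.
    by rewrite mulrC ip_CS.
  apply: (le_trans (ip_CS _ _)); rewrite mulrAC ler_wpM2r ?L2norm_ge0//.
  exact: VL_bound.
- move=> p; rewrite /F (VL_polyL l0).
  have /is_wderivP/(_ _ tphi) := @is_wderiv_polyL (primp p).
  by rewrite deriv_primp.
Qed.

End weak_derivatives.

Section du_bois_reymond.
Context {R : realType}.

(* Zero-mean combinations of products of the cutoff with polynomials are the
   derivatives of test functions. *)
Definition cutoff (a b x : R) : R := Num.max 0 ((x - a) * (b - x)).

Lemma cutoff_out a b x : a <= b -> ~~ (a <= x <= b) -> cutoff a b x = 0.
Proof.
move=> ab; rewrite negb_and -!ltNge => h; rewrite /cutoff max_l//.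
by case/orP: h => h; [rewrite nmulr_rle0|rewrite pmulr_rle0]; lra.
Qed.

Lemma cutoff_gt0 a b x : a < x < b -> 0 < cutoff a b x.
Proof. by move=> /andP[h1 h2]; rewrite /cutoff lt_max mulr_gt0 ?orbT// subr_gt0. Qed.

Lemma continuous_cutoff a b : continuous (cutoff a b).
Proof.
have -> : cutoff a b = fun x => ((x - a) * (b - x) + `|(x - a) * (b - x)|) / 2.
  apply/funext => x; rewrite /cutoff; move: ((x - a) * (b - x)) => y.
  by case: (leP 0 y) => h; [rewrite ger0_norm//|rewrite ltr0_norm//]; lra.
move=> x; apply: cvgM; last exact: cvg_cst.
have h : (y - a) * (b - y) @[y --> x] --> (x - a) * (b - x).
  apply: cvgM; apply: cvgB; [exact: cvg_id|exact: cvg_cst|exact: cvg_cst|exact: cvg_id].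
by apply: cvgD => //; exact: cvg_norm.
Qed.

Variables (l a b : R) (psi : R -> R).
Hypotheses (a0 : 0 < a) (bl : b < l) (cpsi : continuous psi).
Hypothesis psi_out : forall x, ~~ (a <= x <= b) -> psi x = 0.
Local Notation mu := (leb l).

Lemma Rintegral_support (D : set (measurableTypeR R)) : (forall x, a <= x <= b -> D x) ->
  \int[lebesgue_measure]_(x in D) psi x = \int[lebesgue_measure]_x psi x.
Proof.
move=> hD; rewrite Rintegral_mkcond; apply: eq_Rintegral => x _.
rewrite patchE; case: ifPn => // xD; rewrite psi_out//.
by apply: contra xD => /hD; rewrite inE.
Qed.

Lemma support_integrable (D : set (measurableTypeR R)) : measurable D ->
  lebesgue_measure.-integrable D (EFin \o psi).
Proof.
move=> mD; pose I : set (measurableTypeR R) := [set` `[a, b]].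
have mI : measurable I by exact: measurable_itv.
have h : lebesgue_measure.-integrable I (EFin \o psi).
  apply: continuous_compact_integrable; first exact: segment_compact.
  exact: continuous_subspaceT.
have -> : EFin \o psi = (EFin \o psi) \_ I.
  apply/funext => x; rewrite patchE; case: ifPn => // xI /=; rewrite psi_out//.
  by move: xI; rewrite mem_setE in_itv.
apply/(integrable_restrict _ mI mD).
by apply: integrableS h => //; exact: measurableI.
Qed.

(** The primitive from minus infinity vanishes to the left of a, and the zero mean makes it vanish
    to the right of b; its support therefore lies in [a, b], inside (0, l). *)
Lemma primitive_test_function : \int[mu]_x psi x = 0 ->
  exists2 phi, test_function l phi & derive1 phi = psi.
Proof.
move=> psi0.
pose phi x := \int[lebesgue_measure]_(t in [set` `]-oo, x]]) psi t.
have dphi x : derivable phi x 1 /\ derive1 phi x = psi x.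
  apply: (@continuous_FTC1 R psi -oo%O x (x + 1)) => //.
  - by rewrite ltrDl.
  - by apply: support_integrable; exact: measurable_itv.
  - by rewrite ltNyr.
  - exact: cpsi.
have ephi : derive1 phi = psi by apply/funext => x; case: (dphi x).
exists phi => //; split.
- by move=> x; case: (dphi x).
- by rewrite ephi.
- have int0 : \int[lebesgue_measure]_x psi x = 0.
    rewrite -psi0 [RHS]/Rintegral leb_integralE; last first.
      by apply/measurable_EFinP; exact: continuous_measurable_fun.
    rewrite -[RHS]/(\int[lebesgue_measure]_(x in [set` `]0, l[]) psi x) Rintegral_support//.
    by move=> x /andP[h1 h2]; rewrite /= in_itv /= (lt_le_trans a0 h1) (le_lt_trans h2 bl).
  have sub : [set x | phi x != 0] `<=` [set` `[a, b]].
    move=> x /=; rewrite in_itv /= => px; apply/andP; split.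
    + rewrite leNgt; apply: contra px => xa; apply/eqP; rewrite /phi.
      transitivity (\int[lebesgue_measure]_(t in [set` `]-oo, x]]) (0 : R)).
        apply: eq_Rintegral => t; rewrite mem_setE in_itv /= => tx; apply: psi_out.
        by rewrite negb_and -!ltNge (le_lt_trans tx xa).
      by rewrite /Rintegral integral0.
    + rewrite leNgt; apply: contra px => xb; apply/eqP; rewrite /phi Rintegral_support//.
      by move=> t /andP[h1 h2]; rewrite /= in_itv /= (le_trans h2)// ltW.
  apply: (subset_trans (closure_subset sub)).
  rewrite -(closure_id _).1; last exact: itv_closed.
  by move=> x /=; rewrite !in_itv /= => /andP[h1 h2]; rewrite (lt_le_trans a0 h1) (le_lt_trans h2 bl).
Qed.

End du_bois_reymond.

(** * The structure of H^1: constant plus primitive, uniqueness of derivatives and traces *)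

Section sobolev_H1.
Context {R : realType} {l : R}.
Hypothesis l0 : 0 < l.
Local Notation mu := (leb l).
Implicit Types (u v w e : L2 l) (p q : {poly R}).

Lemma ae_exists (P : R -> Prop) (x y : R) : (\forall t \ae mu, P t) ->
  0 <= x -> x < y -> y <= l -> exists2 t, x < t < y & P t.
Proof.
move=> [N [mN N0 PN]] x0 xy yl; apply: contrapT => h.
pose J : set (measurableTypeR R) := [set` `]x, y[].
have mJ : measurable J by exact: measurable_itv.
have JN : J `<=` N.
  move=> t; rewrite /J /= in_itv /= => ht; apply: PN => /= Pt; apply: h.
  by exists t.
have : (mu J <= mu N)%E by apply: le_measure => //; rewrite inE.
rewrite N0 lebE setIidl; last first.
  move=> t; rewrite /J /= !in_itv /= => /andP[h1 h2].
  by rewrite (le_lt_trans x0 h1) (lt_le_trans h2 yl).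
rewrite lebesgue_measure_itv /= lte_fin xy -EFinB lee_fin subr_le0.
by rewrite leNgt xy.
Qed.

(** Points of equality exist arbitrarily close to x, and both functions are continuous there. They
    are sought on the right of x, except at x = l, where they are sought on the left. *)
Lemma abs_cont_eq (f g : R -> R) : abs_cont 0 l f -> abs_cont 0 l g ->
  (\forall x \ae mu, f x = g x) -> forall x, 0 <= x <= l -> f x = g x.
Proof.
move=> acf acg fg x /andP[x0 xl]; apply/eqP; rewrite -subr_eq0 -normr_le0.
apply/ler_addgt0Pr => e e0; rewrite add0r.
have e2 : 0 < e / 2 by rewrite divr_gt0.
have [d1 d10 h1] := abs_cont_small acf e2.
have [d2 d20 h2] := abs_cont_small acg e2.
pose d := Num.min d1 d2; have d0 : 0 < d by rewrite lt_min d10.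
have dd1 : d <= d1 by rewrite ge_min lexx.
have dd2 : d <= d2 by rewrite ge_min lexx orbT.
have key s t : 0 <= s -> s <= t -> t <= l -> t - s < d ->
    `|f t - f s| < e / 2 /\ `|g t - g s| < e / 2.
  by move=> s0 st tl td; split; [apply: h1|apply: h2] => //; apply: (lt_le_trans td).
suff [t ft [k1 k2]] : exists2 t, f t = g t & `|f t - f x| < e / 2 /\ `|g t - g x| < e / 2.
  have -> : f x - g x = (g t - g x) - (f t - f x) by rewrite ft; ring.
  by rewrite (le_trans (ler_normB _ _))//; lra.
have [xl'|lx] := ltP x l.
- pose y := Num.min l (x + d).
  have [||t /andP[t1 t2] ft] := @ae_exists _ x y fg x0.
  + by rewrite lt_min xl' ltrDl.
  + by rewrite ge_min lexx.
  exists t => //; move: t2; rewrite lt_min => /andP[t2 t3].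
  by apply: key => //; lra.
- have xE : x = l by apply/eqP; rewrite eq_le xl.
  pose y := Num.max 0 (l - d).
  have [|||t /andP[t1 t2] ft] := @ae_exists _ y l fg.
  + by rewrite le_max lexx.
  + by rewrite gt_max l0 /=; lra.
  + by [].
  exists t => //; move: t1; rewrite gt_max => /andP[t1 t3].
  have [k1 k2] := key t x (ltW t1) ltac:(lra) xl ltac:(lra).
  by rewrite distrC (distrC (g t)).
Qed.

(** The constant k is the mean of [e] with weight [th]. For a cutoff c_n and a polynomial p,
    subtracting from c_n p the multiple of [th] with the same integral leaves the derivative of a
    test function, so e - k is orthogonal to c_n p. As p varies, c_n (e - k) = 0, and the sets where
    c_n > 0 exhaust (0, l). *)
Lemma du_bois_reymond e :
  (forall phi, test_function l phi -> ip e (cls l (derive1 phi)) = 0) ->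
  exists k : R, e = polyL l k%:P.
Proof.
move=> he.
pose a0 := l / 3; pose b0 := 2 * l / 3.
(* As [th] is a square, its integral is a squared L2 norm, and [ip_eq0] shows that it is not
   zero. *)
pose c0 := cutoff a0 b0; pose th x := c0 x * c0 x.
have cc0 : continuous c0 by exact: continuous_cutoff.
have cth : continuous th by move=> x; apply: cvgM; exact: cc0.
have l0' := l0; have ab0 : a0 <= b0 by rewrite /a0 /b0; lra.
have th_out x : ~~ (a0 <= x <= b0) -> th x = 0.
  by move=> h; rewrite /th /c0 cutoff_out// mul0r.
pose m := \int[mu]_x th x.
have m0 : m != 0.
  have -> : m = ip (cls l c0) (cls l c0) by rewrite ip_cls//; exact: continuous_Lfun.
  apply/eqP => /ip_eq0 c00.
  have h : \forall x \ae mu, c0 x = 0.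
    apply: aeS (aeI (clsE (continuous_Lfun l0 cc0)) (L2_zeroE mu)) => x [<- <-].
    by rewrite c00.
  have [|||t ht] := @ae_exists _ a0 b0 h; try (rewrite /a0 /b0; lra).
  by have := cutoff_gt0 ht; rewrite -/c0 => + ct; rewrite ct ltxx.
pose k := ip e (cls l th) / m; exists k.
pose e' := e - polyL l k%:P.
(* Starting at l / 3 makes every [a n, b n] contain [a0, b0], so the support of [psi] lies in
   [a n, b n] for all n. *)
pose a n := l / n.+3%:R; pose b n := l - a n.
have an n : 0 < a n /\ a n <= a0.
  rewrite /a /a0 divr_gt0//; split=> //.
  by rewrite ler_pM2l// lef_pV2 ?posrE// ler_nat.
have bn n : b n < l /\ b0 <= b n by have [] := an n; rewrite /b /a0 /b0; lra.
pose c n := cutoff (a n) (b n).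
have cc n : continuous (c n) by exact: continuous_cutoff.
have abn n : a n <= b n by have [_ h1] := an n; have [_ h2] := bn n; lra.
have key n p : ip e' (cls l (fun x => c n x * p.[x])) = 0.
  pose w x := c n x * p.[x].
  have cw : continuous w by move=> x; apply: cvgM; [exact: cc|exact: continuous_horner].
  pose s := \int[mu]_x w x / m.
  pose psi x := - s * th x + w x.
  have cpsi : continuous psi.
    move=> x; apply: cvgD; last exact: cw.
    by apply: cvgM; [exact: cvg_cst|exact: cth].
  have Lth := continuous_Lfun l0 cth; have Lw := continuous_Lfun l0 cw.
  have L1 : (fun=> 1) \in Lfun mu 2 by exact: cst_Lfun.
  have int1 (f : R -> R) : f \in Lfun mu 2 -> \int[mu]_x f x = ip (cls l f) (cls l (fun=> 1)).
    by move=> hf; rewrite ip_cls//; apply: eq_Rintegral => x _; rewrite mulr1.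
  have cpsiE : cls l psi = - s *: cls l th + cls l w by rewrite -cls_lin.
  have psi_out x : ~~ (a n <= x <= b n) -> psi x = 0.
    move=> h; rewrite /psi /w /c cutoff_out// mul0r addr0 th_out ?mulr0//.
    apply: contra h => /andP[h1 h2].
    by rewrite (le_trans (an n).2 h1) (le_trans h2 (bn n).2).
  have psi0 : \int[mu]_x psi x = 0.
    rewrite int1; last exact: continuous_Lfun.
    rewrite cpsiE ip_linear -!int1// -/m /s.
    by rewrite mulNr divfK// addNr.
  have [phi tphi ephi] := primitive_test_function (an n).1 (bn n).1 cpsi psi_out psi0.
  have := he phi tphi; rewrite ephi cpsiE ip_sym ip_linear (ip_sym _ e) (ip_sym _ e).
  rewrite /e' ipBl -/w => h.
  have -> : ip (polyL l k%:P) (cls l w) = k * \int[mu]_x w x.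
    rewrite /polyL ip_cls ?horner_Lfun// (int1 w Lw) -ipZl.
    rewrite -[k *: _]addr0.
    have -> : k *: cls l w + 0 = cls l (fun x => k * w x + 0).
      rewrite cls_lin ?cst_Lfun//; congr (_ + _); apply/esym/cls_eq; first exact: cst_Lfun.
      exact: L2_zeroE.
    rewrite -int1; last by apply: Lfun_lin => //; exact: cst_Lfun.
    by apply: eq_Rintegral => x _; rewrite hornerC addr0.
  move: h; rewrite /s /k => h.
  have -> : ip e (cls l w) = \int[mu]_x w x / m * ip e (cls l th).
    by apply/eqP; rewrite -subr_eq0 -h; apply/eqP; ring.
  by apply/eqP; rewrite subr_eq0; apply/eqP; ring.
have Lc n : (fun x => c n x * e' x) \in Lfun mu 2.
  have [M hM] := continuous_bounded_itv l0 (cc n).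
  apply: (@bounded_mul_Lfun _ _ _ _ M); last exact: L2_mem.
    exact: continuous_measurable_fun.
  by move=> x /andP[h1 h2]; rewrite hM// !ltW.
have ce0 n : cls l (fun x => c n x * e' x) = 0.
  apply: (dense_eq0 l0) => p; rewrite ip_cls ?horner_Lfun//.
  rewrite -[RHS](key n p) ip_clsr; last first.
    apply: continuous_Lfun => // x.
    by apply: cvgM; [exact: cc|exact: continuous_horner].
  by apply: eq_Rintegral => x _; rewrite mulrCA mulrA.
have ae0 : \forall x \ae mu, forall n, c n x * e' x = 0.
  apply/ae_foralln => n.
  by apply: aeS (aeI (clsE (Lc n)) (L2_zeroE mu)) => x [<- <-]; rewrite ce0.
apply/eqP; rewrite -subr_eq0; apply/eqP; rewrite -/e'; apply: L2_eqP.
apply: aeS (aeI (aeI ae0 ae_in_itv) (L2_zeroE mu)) => x [[h /andP[x0 xl]] ->] _.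
pose d := Num.min x (l - x); have d0 : 0 < d by rewrite lt_min x0 subr_gt0.
pose n := Num.bound (l / d).
have ad : a n < d.
  rewrite /a ltr_pdivrMr// mulrC -ltr_pdivrMr//.
  rewrite (lt_trans (archi_boundP _))// ?divr_ge0 ?ltW//.
  by rewrite ltr_nat ltnS leqW.
have cn0 : 0 < c n x.
  apply: cutoff_gt0; move: ad; rewrite lt_min => /andP[h1 h2].
  by rewrite /b; apply/andP; split; lra.
by move/eqP: (h n); rewrite mulf_eq0 (gt_eqF cn0) => /eqP.
Qed.

(** [VL v] also has the weak derivative [v], so the difference has weak derivative 0 and the
    preceding lemma applies. *)
Lemma is_wderiv_struct u v : is_wderiv u v -> exists k : R, u = polyL l k%:P + VL v.
Proof.
move=> uv; have [phi tphi|k hk] := @du_bois_reymond (u - VL v).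
  have := (is_wderivP l0 _ _).1 (is_wderiv_lin l0 (-1) (is_wderiv_VL l0 v) uv) phi tphi.
  by rewrite !scaleN1r addNr ip0l addr0 (addrC u).
by exists k; rewrite -hk subrK.
Qed.

Lemma poly_primp p : p = p.[0]%:P + primp p^`().
Proof.
apply/polyP => i; rewrite coefD coefC coef_poly.
case: i => [|i] /=; first by rewrite invr0 mulr0 addr0 horner_coef0.
rewrite add0r ltnS coef_deriv; case: ltnP => hi.
  by rewrite -[X in X / _]mulr_natr mulfK// pnatr_eq0.
have := nth_default 0 hi; rewrite coef_deriv => /eqP.
by rewrite mulrn_eq0 /= => /eqP.
Qed.

Lemma polyLC_lin a (k1 k2 : R) :
  polyL l (a * k1 + k2)%:P = a *: polyL l k1%:P + polyL l k2%:P.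
Proof. by rewrite -polyL_lin// polyCD polyCM mul_polyC. Qed.

Lemma polyL0 : polyL l 0 = 0.
Proof.
have := polyL_lin l0 (-1) 0 0.
by rewrite scaler0 addr0 scaleN1r addNr.
Qed.

Lemma V_affine_ac v (k : R) : abs_cont 0 l (fun x => k + V v x).
Proof.
move=> e e0; have [d d0 hd] := @abs_cont_V R l v 0 l e e0.
exists d => // n s t h1 h2 h3; have := hd n s t h1 h2 h3.
by congr (_ < _); apply: eq_bigr => i _; congr `|_|; ring.
Qed.

Lemma polyLC_E (k : R) : \forall x \ae mu, polyL l k%:P x = k.
Proof. by apply: aeS (clsE (horner_Lfun l0 k%:P)) => x ->; rewrite hornerC. Qed.

Lemma V_affine_rep v (k : R) : is_ac_rep (polyL l k%:P + VL v) (fun x => k + V v x).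
Proof.
split; first exact: V_affine_ac.
apply: aeS (aeI (L2_addE (polyL l k%:P) (VL v)) (aeI (polyLC_E k) (VL_E l0 v))).
by move=> x [-> [-> ->]].
Qed.

(** An explicit representative exists, so the choice in [trace] is not the default value, and
    [abs_cont_eq] identifies the two on [0, l]. *)
Lemma trace_affine v (k : R) x : 0 <= x <= l ->
  trace (polyL l k%:P + VL v) x = k + V v x.
Proof.
set u := _ + _; have [ac rep] := V_affine_rep v k.
have [ac' rep'] : is_ac_rep u (trace u).
  by apply: (@xgetPex _ (fun=> 0) [set f | is_ac_rep u f]); exists (fun x => k + V v x); exact: V_affine_rep.
by move=> hx; apply: (abs_cont_eq ac' ac) => //; apply: aeS (aeI rep rep') => y [-> ->].
Qed.

(** If 0 has the weak derivative w, then 0 = k + V w on [0, l], so k, V w l and VL w vanish.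
    Integration by parts then makes w orthogonal to primitives of polynomials, and V w l = 0 makes
    it orthogonal to constants, hence to all polynomials. *)
Lemma is_wderiv_unique u v1 v2 : is_wderiv u v1 -> is_wderiv u v2 -> v1 = v2.
Proof.
move=> h1 h2; apply/eqP; rewrite -subr_eq0; apply/eqP; set w := v1 - v2.
have hw : is_wderiv 0 w.
  have := is_wderiv_lin l0 (-1) h2 h1; rewrite !scaleN1r addNr.
  by rewrite [- v2 + v1]addrC.
have [k hk] := is_wderiv_struct hw.
have t0 x : 0 <= x <= l -> k + V w x = 0.
  move=> hx; rewrite -(trace_affine w k hx) -hk.
  have -> : (0 : L2 l) = polyL l 0%:P + VL 0.
    have VL0 : VL (0 : L2 l) = 0.
      by have := VL_lin l0 (-1) 0 0; rewrite scaler0 addr0 scaleN1r addNr.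
    by rewrite polyL0 VL0 addr0.
  by rewrite trace_affine// /V ip0l addr0.
have k0 : k = 0 by have := t0 0; rewrite V0 addr0 lexx (ltW l0) => ->.
have Vl : V w l = 0 by have := t0 l; rewrite k0 add0r lexx (ltW l0) => ->.
have VL0 : VL w = 0 by rewrite k0 polyL0 add0r in hk.
apply: (dense_eq0 l0) => p.
rewrite [p]poly_primp -[_%:P]scale1r polyL_lin// scale1r.
have -> : polyL l p.[0]%:P = p.[0] *: polyL l 1%:P.
  by have := polyLC_lin p.[0] 1 0; rewrite mulr1 addr0 polyL0 addr0.
rewrite ip_sym ip_linear (ip_sym _ w) (ip_sym _ w) ipl1//.
rewrite Vl mulr0 add0r -VL_polyL//.
have := VL_by_parts l0 w (polyL l p^`()).
by rewrite VL0 ip0l addr0 Vl mul0r.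
Qed.

Lemma wderivE u v : is_wderiv u v -> wderiv u = v.
Proof.
move=> uv; apply: (is_wderiv_unique (u := u)) => //.
by apply: (@xgetPex _ 0 [set v | is_wderiv u v]); exists v.
Qed.

Lemma sobolev1P u : sobolev 1 u -> u = polyL l (trace u 0)%:P + VL (wderiv u).
Proof.
case=> v uv _; rewrite (wderivE uv).
have [k hk] := is_wderiv_struct uv; rewrite {2}hk trace_affine ?lexx ?(ltW l0)//.
by rewrite V0// addr0.
Qed.

Lemma trace_V u x : sobolev 1 u -> 0 <= x <= l -> trace u x = trace u 0 + V (wderiv u) x.
Proof. by move=> /sobolev1P hu hx; rewrite {1}hu trace_affine. Qed.

Lemma sobolev1_in_AC u : sobolev 1 u -> in_AC u.
Proof.
by move=> /sobolev1P ->; exists (fun x => trace u 0 + V (wderiv u) x); exact: V_affine_rep.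
Qed.

Lemma sobolev_lin m a u v : sobolev m u -> sobolev m v -> sobolev m (a *: u + v).
Proof.
elim: m u v => // m ih u v [u' hu su] [v' hv sv].
exists (a *: u' + v'); first exact: is_wderiv_lin.
exact: ih.
Qed.

Lemma sobolevS m u : sobolev m.+1 u -> sobolev 1 u /\ sobolev m (wderiv u).
Proof. by case=> v uv sv; rewrite (wderivE uv); split=> //; exists v. Qed.

Lemma sobolevSI m u : sobolev 1 u -> sobolev m (wderiv u) -> sobolev m.+1 u.
Proof. by case=> v uv _; rewrite (wderivE uv) => sv; exists v. Qed.

Lemma wderiv_lin a u v : sobolev 1 u -> sobolev 1 v ->
  wderiv (a *: u + v) = a *: wderiv u + wderiv v.
Proof.
move=> [u' hu _] [v' hv _]; rewrite (wderivE hu) (wderivE hv).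
by apply: wderivE; exact: is_wderiv_lin.
Qed.

Lemma trace_lin a u v x : sobolev 1 u -> sobolev 1 v -> 0 <= x <= l ->
  trace (a *: u + v) x = a * trace u x + trace v x.
Proof.
move=> su sv hx.
have -> : a *: u + v = polyL l (a * trace u 0 + trace v 0)%:P +
    VL (a *: wderiv u + wderiv v).
  by rewrite {1}(sobolev1P su) {1}(sobolev1P sv) VL_lin// polyLC_lin scalerDr addrACA.
rewrite trace_affine// V_lin (trace_V su hx) (trace_V sv hx); ring.
Qed.

Lemma sobolev_by_parts u v : sobolev 1 u -> sobolev 1 v ->
  ip (wderiv u) v + ip u (wderiv v) = trace u l * trace v l - trace u 0 * trace v 0.
Proof.
move=> su sv; have ll : 0 <= l <= l by rewrite lexx ltW.
rewrite (trace_V su ll) (trace_V sv ll).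
have -> : ip (wderiv u) v = ip (wderiv u) (polyL l (trace v 0)%:P + VL (wderiv v)).
  by rewrite -(sobolev1P sv).
have -> : ip u (wderiv v) = ip (polyL l (trace u 0)%:P + VL (wderiv u)) (wderiv v).
  by rewrite -(sobolev1P su).
have C (k : R) : polyL l k%:P = k *: polyL l 1%:P.
  by have := polyLC_lin k 1 0; rewrite mulr1 addr0 polyL0 addr0.
have := VL_by_parts l0 (wderiv u) (wderiv v).
rewrite ipDr ipDl (C (trace v 0)) (C (trace u 0)) ipZr ipZl ipl1//.
rewrite (ip_sym (polyL l 1%:P)) ipl1//.
move: (ip _ _) (ip _ _) => A B; move: (V _ l) (V _ l) => D E.
by move=> h; lra.
Qed.

Lemma trace_sqr_le u : sobolev 1 u -> trace u 0 = 0 ->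
  trace u l ^+ 2 <= l * ip (wderiv u) (wderiv u).
Proof.
move=> su u0; have ll : 0 <= l <= l by rewrite lexx ltW.
rewrite (trace_V su ll) u0 add0r -sqr_L2norm -real_normK ?num_real//.
rewrite -[X in _ <= X * _](sqr_sqrtr (ltW l0)) -exprMn.
by rewrite ler_pXn2r ?nnegrE ?mulr_ge0 ?sqrtr_ge0 ?L2norm_ge0// V_bound.
Qed.

Lemma sobolev1_polyL p : sobolev 1 (polyL l p).
Proof. by exists (polyL l p^`()) => //; exact: is_wderiv_polyL. Qed.

Lemma wderiv_polyL p : wderiv (polyL l p) = polyL l p^`().
Proof. exact/wderivE/is_wderiv_polyL. Qed.

Lemma trace_polyL p x : 0 <= x <= l -> trace (polyL l p) x = p.[x].
Proof.
move=> hx; have -> : polyL l p = polyL l p.[0]%:P + VL (polyL l p^`()).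
  by rewrite VL_polyL// {1}[p]poly_primp -[X in polyL l (X + _)]scale1r polyL_lin// scale1r.
rewrite trace_affine// V_polyL//.
by rewrite {3}[p]poly_primp hornerD hornerC.
Qed.

End sobolev_H1.

(** * The Wirtinger inequality for functions vanishing at 0 only *)

Section wirtinger.
Context {R : realType} {l : R}.
Hypothesis l0 : 0 < l.
Implicit Types (u v w : L2 l) (p q : {poly R}).

(* With w = k tan (k (l - x)), one has P'^2 - k^2 P^2 - (w P^2)' = (P' - w P)^2. *)
Lemma wirtinger_poly_lt (P : {poly R}) (k : R) : P.[0] = 0 -> 0 < k -> k * l < pi / 2 ->
  k ^+ 2 * (primp (P * P)).[l] <= (primp (P^`() * P^`())).[l].
Proof.
move=> P0 k0 kl; have l0' := l0.
set A := primp (P^`() * P^`()); set B := primp (P * P).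
pose t x := tan (k * (l - x)).
pose Phi x := A.[x] - k ^+ 2 * B.[x] - k * (t x * (P.[x] * P.[x])).
have cosk x : 0 <= x <= l -> cos (k * (l - x)) != 0.
  move=> /andP[x0 xl]; rewrite gt_eqF//; apply: cos_gt0_pihalf.
  have h1 : 0 <= k * (l - x) by rewrite mulr_ge0 ?subr_ge0// ltW.
  have h2 : k * (l - x) <= k * l by rewrite ler_pM2l//; lra.
  by have pp := pi_gt0 R; apply/andP; split; lra.
have dt x : 0 <= x <= l -> is_derive (x : R) (1 : R) t (- (k * (1 + t x ^+ 2))).
  move=> hx; have c0 := cosk x hx.
  have d1 : is_derive x (1 : R) (fun x => k * (l - x)) (- k).
    have h : is_derive x (1 : R) (k \*: (cst l - id)) (k *: (0 - 1)).
      apply: is_deriveZ; apply: is_deriveB.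
    by move: h; rewrite sub0r scalerN [_ *: _]mulr1.
  have := @is_derive1_comp R tan (fun x => k * (l - x)) x _ _ (is_derive_tan c0) d1.
  by rewrite cos2_tan2// mulrN mulrC.
have dp (q : {poly R}) (x : R) : is_derive x (1 : R) (horner q) q^`().[x] by exact: is_derive_poly.
have dPhi x : 0 <= x <= l -> is_derive (x : R) (1 : R) Phi ((P^`().[x] - k * t x * P.[x]) ^+ 2).
  move=> hx.
  have h := is_deriveB (is_deriveB (dp A x) (is_deriveZ (k ^+ 2) (dp B x)))
    (is_deriveZ k (is_deriveM (dt x hx) (is_deriveM (dp P x) (dp P x)))).
  suff -> : (P^`().[x] - k * t x * P.[x]) ^+ 2 = (A^`().[x] - k ^+ 2 *: B^`().[x] -
     k *: (t x *: (P.[x] *: P^`().[x] + P.[x] *: P^`().[x]) +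
       (P.[x] * P.[x]) *: (- (k * (1 + t x ^+ 2))))) by [].
  rewrite !deriv_primp !hornerM /GRing.scale /=; ring.
have := @ger0_derive1_ndecr R Phi 0 l _ _ _ 0 l (lexx _) (ltW l0) (lexx _).
have oo x : x \in `]0, l[ -> 0 <= x <= l.
  by rewrite in_itv /= => /andP[h1 h2]; rewrite !ltW.
have d0 x : x \in `]0, l[ -> derivable Phi x 1.
  by move=> /oo /dPhi [].
have d1 x : x \in `]0, l[ -> 0 <= derive1 Phi x.
  by move=> /oo /dPhi [_]; rewrite derive1E => ->; rewrite sqr_ge0.
have d2 : {within `[0, l], continuous Phi}.
  apply: derivable_within_continuous => x; rewrite in_itv /= => hx.
  by have [] := dPhi x hx.
have tl : t l = 0 by rewrite /t subrr mulr0 tan0.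
move=> /(_ d0 d1 d2); rewrite /Phi tl !primp0 P0.
by rewrite !mulr0 mul0r !mulr0 !subr0; lra.
Qed.

(** At the critical k = pi / (2 l) the weight k tan (k (l - x)) is singular at x = 0, so this value
    is reached as a limit of smaller k. *)
Lemma wirtinger_poly (P : {poly R}) : P.[0] = 0 ->
  (pi / (2 * l)) ^+ 2 * (primp (P * P)).[l] <= (primp (P^`() * P^`())).[l].
Proof.
move=> P0; have l0' := l0; set I := (primp (P * P)).[l]; set J := (primp _).[l].
have I0 : 0 <= I by rewrite /I -ip_polyL//; exact: ip_ge0.
set K := (pi / (2 * l)) ^+ 2; have K0 : 0 <= K by exact: sqr_ge0.
have KI := mulr_ge0 K0 I0.
apply/ler_addgt0Pr => e e0.
(* The bound 1/2 keeps k positive; the other one makes 2 t K I <= e, which covers the loss in (1 -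
   t)^2 >= 1 - 2 t. *)
pose t := Num.min (1 / 2) (e / (2 * (K * I) + 1)).
have den : 0 < 2 * (K * I) + 1 by lra.
have t0 : 0 < t by rewrite lt_min divr_gt0//= divr_gt0.
have t1 : t <= 1 / 2 by rewrite ge_min lexx.
have t2 : t <= e / (2 * (K * I) + 1) by rewrite ge_min lexx orbT.
have pi0 := pi_gt0 R.
have := @wirtinger_poly_lt P (pi / (2 * l) * (1 - t)) P0.
have -> : pi / (2 * l) * (1 - t) * l = pi / 2 * (1 - t) by field; rewrite gt_eqF.
rewrite mulr_gt0 ?divr_gt0 ?mulr_gt0//; last lra.
have h : pi / 2 * (1 - t) < pi / 2 by rewrite gtr_pMr ?divr_gt0//; lra.
move=> /(_ isT h); rewrite exprMn -/K -/I -/J => hJ.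
have h1 : t * (2 * (K * I)) <= e.
  apply: (@le_trans _ _ (e / (2 * (K * I) + 1) * (2 * (K * I)))).
    by rewrite ler_wpM2r// mulr_ge0.
  by rewrite -mulrA ger_pMr// mulrC ler_pdivrMr// mul1r lerDl.
have h2 : 0 <= t ^+ 2 * (K * I) by rewrite mulr_ge0// sqr_ge0.
nra.
Qed.

(** The sharp constant is used on a polynomial close to [v]; the cruder [VL_bound] affects only the
    small remainder. *)
Lemma VL_wirtinger v : L2norm (VL v) <= 2 * l / pi * L2norm v.
Proof.
have l0' := l0; have pi0 := pi_gt0 R.
set c := 2 * l / pi; have c0 : 0 < c by rewrite divr_gt0// mulr_gt0.
have hp p : L2norm (VL (polyL l p)) <= c * L2norm (polyL l p).
  have n1 : 0 <= c * L2norm (polyL l p) by exact: mulr_ge0 (ltW c0) (L2norm_ge0 _).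
  rewrite -(@ler_pXn2r _ 2)// ?nnegrE ?L2norm_ge0 ?n1//.
  rewrite exprMn !sqr_L2norm VL_polyL// !ip_polyL//.
  have := wirtinger_poly (primp0 p); rewrite deriv_primp => h.
  have -> : (primp (primp p * primp p)).[l] =
    c ^+ 2 * ((pi / (2 * l)) ^+ 2 * (primp (primp p * primp p)).[l]).
    by rewrite /c; move: (pi : R) pi0 => q q0; field; rewrite (gt_eqF l0) (gt_eqF q0).
  by rewrite ler_wpM2l// sqr_ge0.
apply/ler_addgt0Pr => e e0.
have d0 : 0 < l + c by lra.
have [q hq'] := polynomials_dense l0 v (divr_gt0 e0 d0).
have vE : v = polyL l q + (v - polyL l q) by rewrite addrC subrK.
have h1 : L2norm (VL v) <= L2norm (VL (polyL l q)) + L2norm (VL (v - polyL l q)).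
  have VLD u1 u2 : VL (u1 + u2) = VL u1 + VL u2.
    by have := VL_lin l0 1 u1 u2; rewrite !scale1r.
  by rewrite {1}vE VLD L2normD.
have h2 := hp q; have h3 := VL_bound l0 (v - polyL l q).
have h4 : L2norm (polyL l q) <= L2norm v + L2norm (v - polyL l q).
  by have := L2normD v (polyL l q - v); rewrite subrKC (L2norm_distC _ v).
have h5 : c * L2norm (polyL l q) <= c * (L2norm v + L2norm (v - polyL l q)).
  by rewrite ler_pM2l.
have h6 : (l + c) * L2norm (v - polyL l q) <= e.
  by rewrite mulrC -ler_pdivlMr// ltW.
lra.
Qed.

Lemma sobolev_wirtinger u : sobolev 1 u -> trace u 0 = 0 ->
  ip u u <= 4 * l ^+ 2 / pi ^+ 2 * ip (wderiv u) (wderiv u).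
Proof.
move=> su u0; have uE : u = VL (wderiv u) by rewrite {1}(sobolev1P l0 su) u0 (polyL0 l0) add0r.
have c0 : 0 <= 2 * l / pi by rewrite divr_ge0 ?pi_ge0// mulr_ge0// ltW.
have -> : 4 * l ^+ 2 / pi ^+ 2 = (2 * l / pi) ^+ 2 by rewrite !exprMn exprVn; ring.
have n1 : 0 <= 2 * l / pi * L2norm (wderiv u) by exact: mulr_ge0 c0 (L2norm_ge0 _).
rewrite {1 2}uE -!sqr_L2norm -exprMn ler_pXn2r ?nnegrE ?L2norm_ge0 ?n1//.
exact: VL_wirtinger.
Qed.

End wirtinger.

(** * Energy estimates *)

Section two_by_two_forms.
Context {R : realType}.

Lemma bilin_mx2 (a b c d x1 y1 x2 y2 : R) :
  bilin (mx2 a b c d) (cv2 x1 y1) (cv2 x2 y2) =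
    a * (x1 * x2) + b * (x1 * y2) + c * (y1 * x2) + d * (y1 * y2).
Proof.
rewrite /bilin mxE !big_ord_recl big_ord0 /= !mxE !big_ord_recl !big_ord0 /= !mxE /=.
ring.
Qed.

Lemma eigenvalue_mx2 (a b c d s : R) :
  eigenvalue (mx2 a b c d) s = ((a - s) * (d - s) == b * c).
Proof.
rewrite /eigenvalue /eigenspace kermx_eq0 row_free_unit unitmxE unitfE negbK.
rewrite (expand_det_row _ ord0) !big_ord_recl big_ord0 /cofactor !det_mx11 !mxE /=.
rewrite !mulr1n !mulr0n !subr0 -[RHS]subr_eq0; congr (_ == _).
rewrite expr0 expr1; ring.
Qed.

(** Let r be the smaller root of the characteristic polynomial. Then a - r and c - r are nonnegative
    with product b^2, so the form minus r (x^2 + y^2) is a square up to a positive factor. No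
    eigenvalue lies below r, so the infimum is taken over a set bounded below and is at most r. *)
Lemma lambda_min_mx2 (a b c x y : R) :
  lambda_min (mx2 a b b c) * (x ^+ 2 + y ^+ 2) <=
    a * x ^+ 2 + 2 * b * (x * y) + c * y ^+ 2.
Proof.
pose D := (a - c) ^+ 2 + 4 * b ^+ 2.
have D0 : 0 <= D by rewrite addr_ge0 ?sqr_ge0// mulr_ge0 ?sqr_ge0.
pose q := Num.sqrt D; have q2 : q ^+ 2 = D by rewrite sqr_sqrtr.
have q0 : 0 <= q by exact: sqrtr_ge0.
pose r := (a + c - q) / 2.
have qac : `|a - c| <= q.
  rewrite -(@ler_pXn2r _ 2)// ?nnegrE// real_normK ?num_real// q2 /D lerDl.
  by rewrite mulr_ge0 ?sqr_ge0.
have [ra rc] : r <= a /\ r <= c.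
  by move: qac; rewrite ler_norml => /andP[h1 h2]; split; rewrite /r; lra.
have root : (a - r) * (c - r) = b ^+ 2.
  have -> : (a - r) * (c - r) = (q ^+ 2 - (a - c) ^+ 2) / 4 by rewrite /r; field.
  by rewrite q2 /D; field.
have er : eigenvalue (mx2 a b b c) r by rewrite eigenvalue_mx2 root expr2.
have lmr : lambda_min (mx2 a b b c) <= r.
  apply: ge_inf => //; exists r => s; rewrite /= eigenvalue_mx2 -expr2 -root => /eqP h.
  rewrite leNgt; apply/negP => sr.
  have h1 : 0 < (r - s) * (r - s) by rewrite mulr_gt0 ?subr_gt0.
  have h2 : 0 <= (r - s) * (a - r) by rewrite mulr_ge0 ?subr_ge0// ltW.
  have h3 : 0 <= (r - s) * (c - r) by rewrite mulr_ge0 ?subr_ge0// ltW.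
  by nra.
have xy0 : 0 <= x ^+ 2 + y ^+ 2 by rewrite addr_ge0 ?sqr_ge0.
apply: (le_trans (ler_wpM2r xy0 lmr)).
suff : 0 <= (a - r) * x ^+ 2 + 2 * b * (x * y) + (c - r) * y ^+ 2 by lra.
move: ra rc; rewrite -subr_ge0 -[r <= c]subr_ge0; move: root.
move: (a - r) (c - r) => A C AC A0 C0.
have [A00|An0] := eqVneq A 0.
  move: AC; rewrite A00 mul0r => /esym/eqP; rewrite sqrf_eq0 => /eqP ->.
  by rewrite mul0r mulr0 mul0r !add0r mulr_ge0 ?sqr_ge0.
have Ap : 0 < A by rewrite lt_neqAle eq_sym An0.
rewrite -(pmulr_rge0 _ Ap).
have -> : A * (A * x ^+ 2 + 2 * b * (x * y) + C * y ^+ 2) = (A * x + b * y) ^+ 2.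
  have -> : A * (A * x ^+ 2 + 2 * b * (x * y) + C * y ^+ 2) =
    (A * x) ^+ 2 + 2 * A * b * (x * y) + (A * C) * y ^+ 2 by ring.
  by rewrite AC; ring.
exact: sqr_ge0.
Qed.

End two_by_two_forms.

Section L2_forms.
Context {R : realType} {l : R}.
Implicit Types (u v w g z : L2 l).

Lemma ip_young (k : R) u v : 0 < k -> 2 * `|ip u v| <= k * ip u u + k^-1 * ip v v.
Proof.
move=> k0; have h := ip_CS u v; rewrite -!sqr_L2norm.
have s0 : 0 <= (k * L2norm u - L2norm v) ^+ 2 by exact: sqr_ge0.
have -> : k * L2norm u ^+ 2 + k^-1 * L2norm v ^+ 2 =
   2 * (L2norm u * L2norm v) + k^-1 * (k * L2norm u - L2norm v) ^+ 2.
  by field; rewrite gt_eqF.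
have : 0 <= k^-1 * (k * L2norm u - L2norm v) ^+ 2 by rewrite mulr_ge0 ?invr_ge0 ?(ltW k0).
lra.
Qed.

(** The scalar inequality at (|g|, t |z|), where the sign t is opposite to that of b: by
    Cauchy-Schwarz this is the worst case for the cross term. *)
Lemma ip_lambda_min (a b c : R) g z :
  lambda_min (mx2 a b b c) * (ip g g + ip z z) <=
    a * ip g g + 2 * b * ip g z + c * ip z z.
Proof.
have h := ip_CS g z; rewrite -!sqr_L2norm.
pose t : R := if 0 <= b then -1 else 1.
have := lambda_min_mx2 a b c (L2norm g) (t * L2norm z).
have -> : (t * L2norm z) ^+ 2 = L2norm z ^+ 2.
  by rewrite exprMn /t; case: ifP; rewrite ?sqrrN expr1n mul1r.
move=> /le_trans; apply; rewrite lerD2r lerD2l -!mulrA ler_pM2l//.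
have [b0|b0] := leP 0 b.
  by rewrite /t b0; move: h; rewrite ler_norml => /andP[h _];
    rewrite ler_wpM2l//; lra.
have -> : t = 1 by rewrite /t leNgt b0.
rewrite mul1r ler_nM2l//.
by move: h; rewrite ler_norml => /andP[_ ].
Qed.

Definition intg (f : R -> R) := (leb l).-integrable [set: _] (EFin \o f).

Lemma intg_ip u v : intg (fun x => u x * v x). Proof. exact: ip_integrable. Qed.

Lemma intgZ (a : R) (f : R -> R) : intg f -> intg (fun x => a * f x).
Proof.
move=> hf; have := integrableZl (measurableT : measurable [set: measurableTypeR R]) a hf.
by apply: eq_integrable => // x _ /=; rewrite EFinM.
Qed.

Lemma intgD (f g : R -> R) : intg f -> intg g -> intg (fun x => f x + g x).
Proof. by move=> hf hg; exact: (integrableD measurableT hf hg). Qed.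

Lemma RintZ (a : R) (f : R -> R) : intg f ->
  \int[leb l]_x (a * f x) = a * \int[leb l]_x f x.
Proof. by move=> hf; rewrite RintegralZl. Qed.

Lemma RintD (f g : R -> R) : intg f -> intg g ->
  \int[leb l]_x (f x + g x) = \int[leb l]_x f x + \int[leb l]_x g x.
Proof. by move=> hf hg; rewrite RintegralD. Qed.

End L2_forms.

(** * The state space and its inner products in terms of scalar products of components *)

Section state_space.
Context {R : realType} (p : params R).
Local Notation l := (len p).
Local Notation rho := (p_rho p).
Local Notation Iw := (p_Iw p).
Local Notation ms := (p_ms p).
Local Notation Js := (p_Js p).
Local Notation xc := (p_xc p).
Local Notation cw := (p_comega p).
Local Notation cphi := (p_cphi p).
Local Notation eps1 := (p_eps1 p).
Local Notation eps2 := (p_eps2 p).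
Hypothesis l0 : 0 < l.

Lemma sobolevL2P (f : L2 l) : sobolevL 2 f <->
  [/\ sobolev 1 f, sobolev 1 (wderiv f), trace f 0 = 0 & trace (wderiv f) 0 = 0].
Proof.
split=> [[/(sobolevS l0)[s1 s2] h]|[s1 s2 t0 t1]].
  by split=> //; [exact: (h 0%N)|exact: (h 1%N)].
split; first exact: (sobolevSI l0 s1 s2).
case=> [_|[_|k kk]]; [exact: t0|exact: t1|by case: (notF kk)].
Qed.

Lemma sobolevL1P (f : L2 l) : sobolevL 1 f <-> sobolev 1 f /\ trace f 0 = 0.
Proof.
split=> [[s h]|[s h]]; split=> //; first exact: (h 0%N).
by case.
Qed.

Lemma in0l : 0 <= (0 : R) <= l. Proof. by rewrite lexx ltW. Qed.
Lemma inll : 0 <= l <= l. Proof. by rewrite lexx ltW. Qed.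

Lemma sobolevL2_lin (a : R) (f g : L2 l) : sobolevL 2 f -> sobolevL 2 g ->
  sobolevL 2 (a *: f + g).
Proof.
move=> /sobolevL2P[f1 f2 f3 f4] /sobolevL2P[g1 g2 g3 g4]; apply/sobolevL2P; split.
- exact: sobolev_lin.
- by rewrite wderiv_lin//; exact: sobolev_lin.
- by rewrite trace_lin ?in0l// f3 g3 mulr0 addr0.
- by rewrite wderiv_lin// trace_lin ?in0l// f4 g4 mulr0 addr0.
Qed.

Lemma sobolevL1_lin (a : R) (f g : L2 l) : sobolevL 1 f -> sobolevL 1 g ->
  sobolevL 1 (a *: f + g).
Proof.
move=> /sobolevL1P[f1 f2] /sobolevL1P[g1 g2]; apply/sobolevL1P; split.
- exact: sobolev_lin.
- by rewrite trace_lin ?in0l// f2 g2 mulr0 addr0.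
Qed.

Lemma sobolev1_0 : sobolev 1 (0 : L2 l).
Proof. by rewrite -(polyL0 l0); exact: sobolev1_polyL. Qed.

Lemma wderiv0 : wderiv (0 : L2 l) = 0.
Proof. by rewrite -{1}(polyL0 l0) (wderiv_polyL l0) deriv0 (polyL0 l0). Qed.

Lemma trace0 x : 0 <= x <= l -> trace (0 : L2 l) x = 0.
Proof. by move=> hx; rewrite -(polyL0 l0) (trace_polyL l0)// horner0. Qed.

Lemma Hspace_subspace : lin_subspace (Hspace p).
Proof.
split.
  rewrite /Hspace /=; split.
    by apply/sobolevL2P; rewrite wderiv0 trace0 ?in0l//; split=> //; exact: sobolev1_0.
  by apply/sobolevL1P; rewrite trace0 ?in0l//; split=> //; exact: sobolev1_0.
move=> a [[[[[f1 g1] h1] z1] zw1] zp1] [[[[[f2 g2] h2] z2] zw2] zp2].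
rewrite /Hspace /= => -[sf1 sh1] [sf2 sh2].
by split; [exact: sobolevL2_lin|exact: sobolevL1_lin].
Qed.

Lemma inner1E (f1 g1 h1 z1 f2 g2 h2 z2 : L2 l) (zw1 zp1 zw2 zp2 : R) :
  inner1 (p := p) (f1, g1, h1, z1, zw1, zp1) (f2, g2, h2, z2, zw2, zp2) =
  rho * cw ^+ 2 * ip (wderiv (wderiv f1)) (wderiv (wderiv f2))
  + Iw * cphi ^+ 2 * ip (wderiv h1) (wderiv h2)
  + (rho * ip g1 g2 + rho * xc * ip g1 z2 + rho * xc * ip z1 g2 + Iw_star p * ip z1 z2)
  + (ms * (zw1 * zw2) + ms * xc * (zw1 * zp2) + ms * xc * (zp1 * zw2)
     + Js_star p * (zp1 * zp2)).
Proof.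
rewrite /inner1 bilin_mx2; congr (_ + _ + _).
- under eq_Rintegral do rewrite -[X in X + _]mulrA -[X in _ + X]mulrA.
  rewrite RintD ?RintZ ?ip_def//; try apply: intgZ; exact: intg_ip.
- under eq_Rintegral do rewrite bilin_mx2.
  have i u v := @intg_ip R l u v.
  by rewrite !RintD ?RintZ ?ip_def//; repeat (first [apply: intgD|apply: intgZ|exact: i]).
Qed.

Lemma PsiE (f1 g1 h1 z1 f2 g2 h2 z2 : L2 l) (zw1 zp1 zw2 zp2 : R) :
  Psi (p := p) (f1, g1, h1, z1, zw1, zp1) (f2, g2, h2, z2, zw2, zp2) =
  (rho * (eps1 * ip g1 f2) + rho * xc * (eps2 * ip g1 h2)
   + rho * xc * (eps1 * ip z1 f2) + Iw_star p * (eps2 * ip z1 h2))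
  + (rho * (eps1 * ip g2 f1) + rho * xc * (eps2 * ip g2 h1)
   + rho * xc * (eps1 * ip z2 f1) + Iw_star p * (eps2 * ip z2 h1))
  + (ms * (zw1 * (eps1 * trace f2 l)) + ms * xc * (zw1 * (eps2 * trace h2 l))
   + ms * xc * (zp1 * (eps1 * trace f2 l)) + Js_star p * (zp1 * (eps2 * trace h2 l)))
  + (ms * (zw2 * (eps1 * trace f1 l)) + ms * xc * (zw2 * (eps2 * trace h1 l))
   + ms * xc * (zp2 * (eps1 * trace f1 l)) + Js_star p * (zp2 * (eps2 * trace h1 l))).
Proof.
rewrite /Psi !bilin_mx2; congr (_ + _ + _).
have i u v := @intg_ip R l u v.
under eq_Rintegral do rewrite !bilin_mx2 !(mulrCA _ eps1) !(mulrCA _ eps2).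
rewrite !RintD ?RintZ ?ip_def//.
all: repeat (first [apply: intgD|apply: intgZ|exact: i]).
by rewrite !(mulrCA eps1) !(mulrCA eps2).
Qed.

End state_space.

Ltac nneg := repeat (first [assumption | apply: ltW; assumption | exact: ler01 | exact: ler0n
  | exact: normr_ge0 | exact: sqrtr_ge0 | exact: pi_ge0 | apply: exprn_ge0
  | apply: addr_ge0 | apply: mulr_ge0]).

Section thresholds.
Context {R : realType}.

Lemma efrac_lt_pos (e a b : R) : 0 < b -> (e%:E < efrac a b)%E -> e * b < a.
Proof. by move=> b0; rewrite /efrac gt_eqF// lte_fin ltr_pdivlMr. Qed.

(** For b = 0, which occurs when x_c = 0, the threshold is infinite and the claim reduces to the
    positivity of the numerator. *)
Lemma efrac_lt (e a b : R) : 0 <= b -> 0 < a -> (e%:E < efrac a b)%E -> e * b < a.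
Proof.
rewrite le_eqVlt => /predU1P[<- a0 _|b0 _]; first by rewrite mulr0.
exact: efrac_lt_pos.
Qed.

Lemma powR_three_halves (a : R) : 0 < a -> a `^ (3 / 2) = a * Num.sqrt a.
Proof.
move=> a0; have -> : 3 / 2 = 1 + 2^-1 :> R by field.
by rewrite powRD ?gt_eqF ?implybT// powRr1 ?powR12_sqrt// ltW.
Qed.

Lemma min6_gt0 (a b c d e f : R) : 0 < a -> 0 < b -> 0 < c -> 0 < d -> 0 < e -> 0 < f ->
  exists m, [/\ 0 < m, m <= a, m <= b & m <= c] /\ [/\ m <= d, m <= e & m <= f].
Proof.
move=> *; exists (Num.min a (Num.min b (Num.min c (Num.min d (Num.min e f))))).
by rewrite !lt_min !ge_min !lexx !orbT; do !(split=> //); do !(apply/andP; split).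
Qed.

Lemma sqr_young (a b : R) : 2 * `|a * b| <= a ^+ 2 + b ^+ 2.
Proof.
rewrite normrM -(real_normK (num_real a)) -(real_normK (num_real b)).
have := sqr_ge0 (`|a| - `|b|); rewrite sqrrB; lra.
Qed.

(** This combines Young's inequality for t with a coefficient s of unknown sign, such as those
    containing x_c. *)
Lemma absmul_le (c s t k : R) : `|s| <= c -> 2 * `|t| <= k -> 2 * (s * t) <= c * k.
Proof.
move=> sc tk; apply: (@le_trans _ _ (`|s| * (2 * `|t|))).
  by have := ler_norm (s * t); rewrite normrM; lra.
by rewrite ler_pM// mulr_ge0.
Qed.

Lemma absmul_ge (c s t k : R) : `|s| <= c -> 2 * `|t| <= k -> - (c * k) <= 2 * (s * t).
Proof.
move=> sc tk; have := @absmul_le c (- s) t k; rewrite normrN => /(_ sc tk).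
rewrite mulNr mulrN; lra.
Qed.

Lemma le_sum6 (F H G Z a b q : R) : 0 <= F -> 0 <= H -> 0 <= G -> 0 <= Z -> 0 <= a -> 0 <= b ->
  q = F + H + G + Z + a + b ->
  [/\ F <= q, H <= q, G <= q & Z <= q] /\ [/\ a <= q, b <= q, G + Z <= q & a + b <= q].
Proof. by move=> *; split; split; lra. Qed.

Lemma ip_young1 (l : R) (u v : L2 l) : 2 * `|ip u v| <= ip u u + ip v v.
Proof. by have := ip_young u v (@ltr01 R); rewrite invr1 !mul1r. Qed.

End thresholds.

(** * Comparison of both inner products with a reference form *)

Section energy_norms.
Context {R : realType} (p : params R).
Local Notation l := (len p).
Local Notation rho := (p_rho p).
Local Notation Iw := (p_Iw p).
Local Notation ms := (p_ms p).
Local Notation Js := (p_Js p).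
Local Notation xc := (p_xc p).
Local Notation cw := (p_comega p).
Local Notation cphi := (p_cphi p).
Local Notation eps1 := (p_eps1 p).
Local Notation eps2 := (p_eps2 p).
Local Notation Is := (Iw_star p).
Local Notation Jst := (Js_star p).
Hypothesis hp : admissible p.

Lemma l_gt0 : 0 < l. Proof. by case: hp => -[]. Qed.

Definition qform (X : state p) : R :=
  let: (f, g, h, z, zw, zp) := X in
  ip (wderiv (wderiv f)) (wderiv (wderiv f)) + ip (wderiv h) (wderiv h)
  + ip g g + ip z z + zw ^+ 2 + zp ^+ 2.

Lemma qform_ge0 X : 0 <= qform X.
Proof.
case: X => [[[[[f g] h] z] zw] zp]; rewrite /qform.
by rewrite !addr_ge0 ?ip_ge0 ?sqr_ge0.
Qed.

(** Wirtinger for f and for f' multiplies two constants 4 l^2 / pi^2; the trace bound costs a factor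
    l and Wirtinger for f'. *)
Lemma sobolevL2_bounds (f : L2 l) : sobolevL 2 f ->
  let F2 := ip (wderiv (wderiv f)) (wderiv (wderiv f)) in
  ip f f <= 16 * l ^+ 4 / pi ^+ 4 * F2 /\ trace f l ^+ 2 <= 4 * l ^+ 3 / pi ^+ 2 * F2.
Proof.
have l0 := l_gt0; have pi0 := pi_gt0 R.
move=> /(sobolevL2P l0)[s1 s2 t1 t2] F2.
have w1 := sobolev_wirtinger l0 s1 t1; have w2 := sobolev_wirtinger l0 s2 t2.
have w3 := trace_sqr_le l0 s1 t1.
rewrite -/F2 in w2; move: (pi : R) pi0 w1 w2 => q q0 w1 w2.
set c := 4 * l ^+ 2 / q ^+ 2 in w1 w2.
have c0 : 0 <= c by rewrite divr_ge0; nneg.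
split.
- have -> : 16 * l ^+ 4 / q ^+ 4 * F2 = c * (c * F2) by rewrite /c; field; rewrite gt_eqF.
  by rewrite (le_trans w1)// ler_wpM2l.
- have -> : 4 * l ^+ 3 / q ^+ 2 * F2 = l * (c * F2) by rewrite /c; field; rewrite gt_eqF.
  by rewrite (le_trans w3)// ler_wpM2l// ltW.
Qed.

Lemma sobolevL1_bounds (h : L2 l) : sobolevL 1 h ->
  let H1 := ip (wderiv h) (wderiv h) in
  ip h h <= 4 * l ^+ 2 / pi ^+ 2 * H1 /\ trace h l ^+ 2 <= l * H1.
Proof.
have l0 := l_gt0; move=> /sobolevL1P[s1 t1] H1.
by split; [exact: sobolev_wirtinger|exact: trace_sqr_le].
Qed.

Lemma inner2_qform_le : exists2 C : R, 0 < C &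
  forall X, Hspace p X -> inner1 X X <= C * qform X /\ inner2 X X <= C * qform X.
Proof.
have l0 := l_gt0; have pi0 := pi_gt0 R.
case: hp => -[_ r0 I0 m0 J0] [cw0 cp0 _ _] [_ _ e10 e20] _ _.
have xx := sqr_ge0 xc.
have Is0 : 0 < Is by rewrite /Iw_star ltr_wpDr// mulr_ge0// ltW.
have Js0 : 0 < Jst by rewrite /Js_star ltr_wpDr// mulr_ge0// ltW.
set x := `|xc|; have x0 : 0 <= x by exact: normr_ge0.
set A := 16 * l ^+ 4 / pi ^+ 4; set B := 4 * l ^+ 2 / pi ^+ 2; set C := 4 * l ^+ 3 / pi ^+ 2.
have A0 : 0 <= A by rewrite divr_ge0; nneg.
have B0 : 0 <= B by rewrite divr_ge0; nneg.
have C0 : 0 <= C by rewrite divr_ge0; nneg.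
pose K1 := rho * cw ^+ 2 + Iw * cphi ^+ 2 + (rho + rho * x + Is) + (ms + ms * x + Jst).
pose K2 := (rho * eps1 * (1 + A) + rho * x * eps2 * (1 + B) + rho * x * eps1 * (1 + A)
  + Is * eps2 * (1 + B)) + (ms * eps1 * (1 + C) + ms * x * eps2 * (1 + l)
  + ms * x * eps1 * (1 + C) + Jst * eps2 * (1 + l)).
have K10 : 0 < K1.
  have c1 : 0 < rho * cw ^+ 2 by rewrite mulr_gt0 ?exprn_gt0.
  have c2 : 0 < Iw * cphi ^+ 2 by rewrite mulr_gt0 ?exprn_gt0.
  have c3 : 0 <= rho * x by rewrite mulr_ge0// ltW.
  have c4 : 0 <= ms * x by rewrite mulr_ge0// ltW.
  rewrite /K1; lra.
have K20 : 0 <= K2.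
  rewrite /K2; move: (ltW r0) (ltW e10) (ltW e20) (ltW m0) (ltW Is0) (ltW Js0) (ltW l0).
  by move=> *; repeat (first [assumption|exact: ler01|apply: addr_ge0|apply: mulr_ge0]).
exists (K1 + K2); first by rewrite ltr_wpDr.
move=> [[[[[f g] h] z] a] b] [sf sh].
have [f1 f2] := sobolevL2_bounds sf; have [h1 h2] := sobolevL1_bounds sh.
set q := qform _; have q0 : 0 <= q by exact: qform_ge0.
have [] := @le_sum6 R (ip (wderiv (wderiv f)) (wderiv (wderiv f))) (ip (wderiv h) (wderiv h))
  (ip g g) (ip z z) (a ^+ 2) (b ^+ 2) q; rewrite ?ip_ge0 ?sqr_ge0//.
move=> [Fq Hq Gq Zq] [aq bq GZq abq].
have AF := le_trans f1 (ler_wpM2l A0 Fq); have BH := le_trans h1 (ler_wpM2l B0 Hq).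
have CF := le_trans f2 (ler_wpM2l C0 Fq); have lH := le_trans h2 (ler_wpM2l (ltW l0) Hq).
have y1 := le_trans (ip_young1 g f) (lerD Gq AF).
have y2 := le_trans (ip_young1 g h) (lerD Gq BH).
have y3 := le_trans (ip_young1 z f) (lerD Zq AF).
have y4 := le_trans (ip_young1 z h) (lerD Zq BH).
have y5 := le_trans (ip_young1 g z) GZq.
have y6 := le_trans (sqr_young a (trace f l)) (lerD aq CF).
have y7 := le_trans (sqr_young a (trace h l)) (lerD aq lH).
have y8 := le_trans (sqr_young b (trace f l)) (lerD bq CF).
have y9 := le_trans (sqr_young b (trace h l)) (lerD bq lH).
have y10 := le_trans (sqr_young a b) abq.
have rx : `|rho * xc| <= rho * x by rewrite normrM gtr0_norm.
have mx : `|ms * xc| <= ms * x by rewrite normrM gtr0_norm.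
have self (c : R) : 0 < c -> `|c| <= c by move=> c0; rewrite gtr0_norm.
have I1 : inner1 (p := p) (f, g, h, z, a, b) (f, g, h, z, a, b) <= K1 * q.
  rewrite inner1E (ip_sym z g) (mulrC b a).
  have i0 := absmul_le rx y5; have i7 := absmul_le mx y10.
  have c1 : 0 <= rho * cw ^+ 2 by rewrite mulr_ge0 ?sqr_ge0// ltW.
  have c2 : 0 <= Iw * cphi ^+ 2 by rewrite mulr_ge0 ?sqr_ge0// ltW.
  have i1 := ler_wpM2l c1 Fq; have i2 := ler_wpM2l c2 Hq.
  have i3 := ler_wpM2l (ltW r0) Gq; have i4 := ler_wpM2l (ltW Is0) Zq.
  have i5 := ler_wpM2l (ltW m0) aq; have i6 := ler_wpM2l (ltW Js0) bq.
  rewrite /K1 -(expr2 a) -(expr2 b); clear -i0 i1 i2 i3 i4 i5 i6 i7; lra.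
split; first by rewrite (le_trans I1)// ler_wpM2r// lerDl.
rewrite /inner2 [leRHS]mulrDl; apply: lerD => //; rewrite PsiE.
have bx1 : `|rho * xc * eps2| <= rho * x * eps2 by rewrite normrM (gtr0_norm e20) ler_wpM2r// ltW.
have bx2 : `|rho * xc * eps1| <= rho * x * eps1 by rewrite normrM (gtr0_norm e10) ler_wpM2r// ltW.
have bx3 : `|ms * xc * eps2| <= ms * x * eps2 by rewrite normrM (gtr0_norm e20) ler_wpM2r// ltW.
have bx4 : `|ms * xc * eps1| <= ms * x * eps1 by rewrite normrM (gtr0_norm e10) ler_wpM2r// ltW.
have j1 := absmul_le (self _ (mulr_gt0 r0 e10)) y1.
have j2 := absmul_le bx1 y2.
have j3 := absmul_le bx2 y3.
have j4 := absmul_le (self _ (mulr_gt0 Is0 e20)) y4.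
have j5 := absmul_le (self _ (mulr_gt0 m0 e10)) y6.
have j6 := absmul_le bx3 y7.
have j7 := absmul_le bx4 y8.
have j8 := absmul_le (self _ (mulr_gt0 Js0 e20)) y9.
rewrite /K2; clear -j1 j2 j3 j4 j5 j6 j7 j8.
move: (ip g f) (ip g h) (ip z f) (ip z h) (trace f l) (trace h l) j1 j2 j3 j4 j5 j6 j7 j8.
move: Is Jst A B C q x => *; lra.
Qed.

Hypothesis hS : structural p.

Local Notation lamM := (lambda_min (mxM p)).
Local Notation lamMs := (lambda_min (mxMs p)).
Local Notation s := (Num.sqrt rho).
Local Notation si := (Num.sqrt Iw).
Local Notation x := (`|xc|).

Lemma thresholds_eps1 : [/\ 0 < lamM, 0 < lamMs,
   eps1 * (4 * l ^+ 3 * (1 + x) * (4 * l * (rho * s) * cw + pi ^+ 2 * ms)) <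
     pi ^+ 4 * rho * cw ^+ 2 &
  [/\ eps1 * (2 * s) < cw * lamM, eps1 * (2 * s * x) < cw * lamM,
     eps1 * (2 * ms) < lamMs & eps1 * (2 * ms * x) < lamMs]].
Proof.
have pi0 := pi_gt0 R; case: hp => -[l0 r0 I0 m0 J0] [cw0 cp0 _ _] [_ _ e10 e20] _ _.
case: hS => _ + _ _ _; rewrite lt_min => /andP[_].
rewrite /Km1 !big_cons big_nil !lt_min => /andP[h1 /andP[h2 /andP[h3 /andP[h4 /andP[h5 _]]]]].
have s0 : 0 < s by rewrite sqrtr_gt0.
(* [efrac_lt_pos] asks nothing of the numerator, so these two entries yield the positivity of both
   smallest eigenvalues, on which the treatment of the remaining ones relies. *)
have k2 := efrac_lt_pos (mulr_gt0 (ltr0Sn R 1) s0) h2.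
have k4 := efrac_lt_pos (mulr_gt0 (ltr0Sn R 1) m0) h4.
have cl0 : 0 < cw * lamM by apply: lt_trans k2; rewrite !mulr_gt0.
have ls0 : 0 < lamMs by apply: lt_trans k4; rewrite !mulr_gt0.
have x0 := normr_ge0 xc.
split; [by rewrite pmulr_rgt0 in cl0|exact: ls0| |].
  rewrite -powR_three_halves//; apply: efrac_lt h1.
    by rewrite !mulr_ge0 ?addr_ge0 ?mulr_ge0 ?powR_ge0 ?exprn_ge0 ?ler01// ltW.
  by rewrite !mulr_gt0 ?exprn_gt0.
split=> //.
- by apply: efrac_lt h3 => //; rewrite !mulr_ge0// ltW.
- by apply: efrac_lt h5 => //; rewrite !mulr_ge0// ltW.
Qed.

Lemma thresholds_eps2 :
   eps2 * (4 * l ^+ 2 * (Is + rho * x) * si * cphi + pi ^+ 2 * l * (Jst + ms * x)) <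
     pi ^+ 2 * Iw * cphi ^+ 2 /\
  [/\ eps2 * (2 * rho * x) < si * cphi * lamM, eps2 * (2 * Is) < si * cphi * lamM,
     eps2 * (2 * ms * x) < lamMs & eps2 * (2 * Jst) < lamMs].
Proof.
have pi0 := pi_gt0 R; case: hp => -[l0 r0 I0 m0 J0] [cw0 cp0 _ _] [_ _ e10 e20] _ _.
have [lm ls _ _] := thresholds_eps1.
case: hS => _ _ _ + _; rewrite lt_min => /andP[_].
rewrite /Km2 !big_cons big_nil !lt_min => /andP[h1 /andP[h2 /andP[h3 /andP[h4 /andP[h5 _]]]]].
have s0 : 0 < si by rewrite sqrtr_gt0.
have x0 := normr_ge0 xc; have xx := sqr_ge0 xc.
have Is0 : 0 <= Is by rewrite /Iw_star addr_ge0 ?(ltW I0)// mulr_ge0// ltW.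
have Js0 : 0 <= Jst by rewrite /Js_star addr_ge0 ?(ltW J0)// mulr_ge0// ltW.
have c0 : 0 < si * cphi * lamM := mulr_gt0 (mulr_gt0 s0 cp0) lm.
split; last split.
- by apply: efrac_lt h1; [nneg|rewrite !mulr_gt0 ?exprn_gt0].
- by apply: efrac_lt h2 => //; nneg.
- by apply: efrac_lt h3 => //; nneg.
- by apply: efrac_lt h4 => //; nneg.
- by apply: efrac_lt h5 => //; nneg.
Qed.

(** Each product in [Psi] is bounded by Young's inequality, and the coefficients left over are
    positive by the entries of K_m. The first entries give [dF] and [dH]. In [dG], [dZ], [da] and
    [db] two terms compete with one smallest eigenvalue, and the factors 2 in the other denominators
    keep each below one half of it. *)
Lemma inner2_qform_ge : exists2 c : R, 0 < c &
  forall X, Hspace p X -> c * qform X <= inner1 X X /\ c * qform X <= inner2 X X.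
Proof.
have l0 := l_gt0; have pi0 := pi_gt0 R.
case: (hp) => -[_ r0 I0 m0 J0] [cw0 cp0 _ _] [_ _ e10 e20] _ _.
have [lm ls t1 [t2 t3 t4 t5]] := thresholds_eps1.
have [t6 [t7 t8 t9 t10]] := thresholds_eps2.
have xx := sqr_ge0 xc; have x0 := normr_ge0 xc.
have Is0 : 0 < Is by rewrite /Iw_star ltr_wpDr// mulr_ge0// ltW.
have Js0 : 0 < Jst by rewrite /Js_star ltr_wpDr// mulr_ge0// ltW.
have s0 : 0 < s by rewrite sqrtr_gt0.
have si0 : 0 < si by rewrite sqrtr_gt0.
have ss : s ^+ 2 = rho by rewrite sqr_sqrtr// ltW.
have sisi : si ^+ 2 = Iw by rewrite sqr_sqrtr// ltW.
pose A := 16 * l ^+ 4 / pi ^+ 4; pose B := 4 * l ^+ 2 / pi ^+ 2; pose C := 4 * l ^+ 3 / pi ^+ 2.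
(* the weights of Young's inequality for <g, f>, <z, f> and for <g, h>, <z, h> *)
pose k1 := (s * cw)^-1; pose k2 := (si * cphi)^-1.
have k10 : 0 < k1 by rewrite invr_gt0 mulr_gt0.
have k20 : 0 < k2 by rewrite invr_gt0 mulr_gt0.
pose dF := rho * cw ^+ 2 - (rho * eps1 * (1 + x) * (k1^-1 * A) + ms * eps1 * (1 + x) * C).
pose dH := Iw * cphi ^+ 2 - ((rho * x + Is) * eps2 * (k2^-1 * B) + (ms * x + Jst) * eps2 * l).
pose dG := lamM - (rho * eps1 * k1 + rho * x * eps2 * k2).
pose dZ := lamM - (rho * x * eps1 * k1 + Is * eps2 * k2).
pose da := lamMs - (ms * eps1 + ms * x * eps2).
pose db := lamMs - (ms * x * eps1 + Jst * eps2).
have dF0 : 0 < dF.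
  rewrite /dF subr_gt0 -(@ltr_pM2l _ (pi ^+ 4)) ?exprn_gt0// [ltRHS]mulrA.
  apply: le_lt_trans t1; rewrite /k1 /A /C invrK; move: (pi : R) pi0 => q q0.
  by rewrite le_eqVlt; apply/orP; left; apply/eqP; field; rewrite gt_eqF.
have dH0 : 0 < dH.
  rewrite /dH subr_gt0 -(@ltr_pM2l _ (pi ^+ 2)) ?exprn_gt0// [ltRHS]mulrA.
  apply: le_lt_trans t6; rewrite /k2 /B invrK; move: (pi : R) pi0 => q q0.
  by rewrite le_eqVlt; apply/orP; left; apply/eqP; field; rewrite gt_eqF.
have u1 : rho * eps1 * k1 < lamM / 2.
  rewrite /k1 ltr_pdivrMr ?mulr_gt0//.
  have -> : lamM / 2 * (s * cw) = s * (cw * lamM) / 2 by field.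
  have -> : rho * eps1 = s * (eps1 * (2 * s)) / 2 by rewrite -[in LHS]ss; field.
  by rewrite ltr_pM2r ?invr_gt0// ltr_pM2l.
have u2 : rho * x * eps1 * k1 < lamM / 2.
  rewrite /k1 ltr_pdivrMr ?mulr_gt0//.
  have -> : lamM / 2 * (s * cw) = s * (cw * lamM) / 2 by field.
  have -> : rho * x * eps1 = s * (eps1 * (2 * s * x)) / 2 by rewrite -[in LHS]ss; field.
  by rewrite ltr_pM2r ?invr_gt0// ltr_pM2l.
have u3 : rho * x * eps2 * k2 < lamM / 2.
  rewrite /k2 ltr_pdivrMr ?mulr_gt0//; clear -t7; lra.
have u4 : Is * eps2 * k2 < lamM / 2.
  rewrite /k2 ltr_pdivrMr ?mulr_gt0//; clear -t8; lra.
have dG0 : 0 < dG by rewrite /dG; clear -u1 u3; lra.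
have dZ0 : 0 < dZ by rewrite /dZ; clear -u2 u4; lra.
have da0 : 0 < da by rewrite /da; clear -t4 t9; lra.
have db0 : 0 < db by rewrite /db; clear -t5 t10; lra.
have [c [[c0 cF cH cG] [cZ ca cb]]] := min6_gt0 dF0 dH0 dG0 dZ0 da0 db0.
exists c => //.
have pk1 : 0 <= k1^-1 by rewrite invr_ge0 ltW.
have pk2 : 0 <= k2^-1 by rewrite invr_ge0 ltW.
move=> [[[[[f g] h] z] a] b] [sf sh].
have [f1 f2] := sobolevL2_bounds sf; have [h1 h2] := sobolevL1_bounds sh.
have F0 := ip_ge0 (wderiv (wderiv f)); have H0 := ip_ge0 (wderiv h).
have G0 := ip_ge0 g; have Z0 := ip_ge0 z; have a0 := sqr_ge0 a; have b0 := sqr_ge0 b.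
have I1 : rho * cw ^+ 2 * ip (wderiv (wderiv f)) (wderiv (wderiv f))
   + Iw * cphi ^+ 2 * ip (wderiv h) (wderiv h) + lamM * (ip g g + ip z z) +
   lamMs * (a ^+ 2 + b ^+ 2) <= inner1 (p := p) (f, g, h, z, a, b) (f, g, h, z, a, b).
  have e1 := ip_lambda_min rho (rho * xc) Is g z.
  have e2 := lambda_min_mx2 ms (ms * xc) Jst a b.
  rewrite inner1E (ip_sym z g) (mulrC b a) -(expr2 a) -(expr2 b) /mxM /mxMs.
  clear -e1 e2; move: (lambda_min _) (lambda_min _) e1 e2; move: Is Jst => ? ? ? ?.
  move: (ip _ _) (ip _ _) (ip _ _) (ip g g) (ip z z) => *; lra.
have y1 := le_trans (ip_young g f k10) (lerD (lexx _) (ler_wpM2l pk1 f1)).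
have y2 := le_trans (ip_young g h k20) (lerD (lexx _) (ler_wpM2l pk2 h1)).
have y3 := le_trans (ip_young z f k10) (lerD (lexx _) (ler_wpM2l pk1 f1)).
have y4 := le_trans (ip_young z h k20) (lerD (lexx _) (ler_wpM2l pk2 h1)).
have y6 := le_trans (sqr_young a (trace f l)) (lerD (lexx _) f2).
have y7 := le_trans (sqr_young a (trace h l)) (lerD (lexx _) h2).
have y8 := le_trans (sqr_young b (trace f l)) (lerD (lexx _) f2).
have y9 := le_trans (sqr_young b (trace h l)) (lerD (lexx _) h2).
have self (t : R) : 0 < t -> `|t| <= t by move=> t0; rewrite gtr0_norm.
have bx1 : `|rho * xc * eps2| <= rho * x * eps2 by rewrite !normrM (gtr0_norm e20) (gtr0_norm r0).
have bx2 : `|rho * xc * eps1| <= rho * x * eps1 by rewrite !normrM (gtr0_norm e10) (gtr0_norm r0).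
have bx3 : `|ms * xc * eps2| <= ms * x * eps2 by rewrite !normrM (gtr0_norm e20) (gtr0_norm m0).
have bx4 : `|ms * xc * eps1| <= ms * x * eps1 by rewrite !normrM (gtr0_norm e10) (gtr0_norm m0).
have j1 := absmul_ge (self _ (mulr_gt0 r0 e10)) y1.
have j2 := absmul_ge bx1 y2.
have j3 := absmul_ge bx2 y3.
have j4 := absmul_ge (self _ (mulr_gt0 Is0 e20)) y4.
have j5 := absmul_ge (self _ (mulr_gt0 m0 e10)) y6.
have j6 := absmul_ge bx3 y7.
have j7 := absmul_ge bx4 y8.
have j8 := absmul_ge (self _ (mulr_gt0 Js0 e20)) y9.
have I2 : dF * ip (wderiv (wderiv f)) (wderiv (wderiv f)) + dH * ip (wderiv h) (wderiv h)
  + dG * ip g g + dZ * ip z z + da * a ^+ 2 + db * b ^+ 2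
  <= inner2 (p := p) (f, g, h, z, a, b) (f, g, h, z, a, b).
  rewrite /inner2; apply: le_trans (lerD I1 (lexx _)); rewrite PsiE.
  rewrite /dF /dH /dG /dZ /da /db; clear -j1 j2 j3 j4 j5 j6 j7 j8.
  move: (ip (wderiv (wderiv f)) _) (ip (wderiv h) _) (ip g g) (ip z z) j1 j2 j3 j4 j5 j6 j7 j8.
  move: (ip g f) (ip g h) (ip z f) (ip z h) (trace f l) (trace h l).
  rewrite -/A -/B -/C; move: lamM lamMs Is Jst A B C k1 k2 (k1^-1) (k2^-1) x => *; lra.
have I3 : c * qform (f, g, h, z, a, b) <=
  dF * ip (wderiv (wderiv f)) (wderiv (wderiv f)) + dH * ip (wderiv h) (wderiv h)
  + dG * ip g g + dZ * ip z z + da * a ^+ 2 + db * b ^+ 2.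
  rewrite /qform; move: (ip (wderiv (wderiv f)) _) (ip (wderiv h) _) (ip g g) (ip z z) (a ^+ 2)
    (b ^+ 2) F0 H0 G0 Z0 a0 b0 => *.
  by rewrite !mulrDr; repeat (apply: lerD); apply: ler_wpM2r.
split; last exact: le_trans I3 I2.
(* The same [c] serves [inner1]: each of [dF], ..., [db] is a coefficient of the lower bound [I1]
   minus a nonnegative quantity. *)
apply: le_trans I3 (le_trans _ I1).
have m1 t u v : 0 <= v -> 0 <= u -> (t - u) * v <= t * v :> R.
  by move=> v0 u0; rewrite ler_wpM2r// lerBlDr lerDl.
have P1 : 0 <= rho * eps1 * (1 + x) * (k1^-1 * A) + ms * eps1 * (1 + x) * C.
  have A0 : 0 <= A by rewrite divr_ge0; nneg.
  have C0 : 0 <= C by rewrite divr_ge0; nneg.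
  by nneg.
have P2 : 0 <= (rho * x + Is) * eps2 * (k2^-1 * B) + (ms * x + Jst) * eps2 * l.
  have B0 : 0 <= B by rewrite divr_ge0; nneg.
  by nneg.
have P3 : 0 <= rho * eps1 * k1 + rho * x * eps2 * k2 by nneg.
have P4 : 0 <= rho * x * eps1 * k1 + Is * eps2 * k2 by nneg.
have P5 : 0 <= ms * eps1 + ms * x * eps2 by nneg.
have P6 : 0 <= ms * x * eps1 + Jst * eps2 by nneg.
move: (ip (wderiv (wderiv f)) _) (ip (wderiv h) _) (ip g g) (ip z z) (a ^+ 2)
  (b ^+ 2) F0 H0 G0 Z0 a0 b0 => *.
by rewrite !mulrDr !addrA; repeat (apply: lerD); apply: m1.
Qed.

End energy_norms.

Lemma add_chain (R : realType) (a b c T x : R) : a + b = T -> b + c = 0 -> c = x -> a = T + x.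
Proof. by move=> <- h <-; rewrite -addrA h addr0. Qed.

Lemma add_chain1 (R : realType) (a b T x : R) : a + b = T -> b = x -> a = T - x.
Proof. by move=> <- <-; rewrite addrK. Qed.

(** * Dissipativity of the operator for the augmented inner product *)

Section dissipation.
Context {R : realType} (p : params R).
Local Notation l := (len p).
Local Notation rho := (p_rho p).
Local Notation Iw := (p_Iw p).
Local Notation ms := (p_ms p).
Local Notation Js := (p_Js p).
Local Notation xc := (p_xc p).
Local Notation cw := (p_comega p).
Local Notation cphi := (p_cphi p).
Local Notation etaw := (p_etaomega p).
Local Notation etaphi := (p_etaphi p).
Local Notation k1 := (p_k1 p).
Local Notation k2 := (p_k2 p).
Local Notation eps1 := (p_eps1 p).
Local Notation eps2 := (p_eps2 p).
Local Notation aw := (p_alphaomega p).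
Local Notation bw := (p_betaomega p).
Local Notation gw := (p_gammaomega p).
Local Notation aphi := (p_alphaphi p).
Local Notation bphi := (p_betaphi p).
Local Notation gphi := (p_gammaphi p).
Local Notation Is := (Iw_star p).
Local Notation Jst := (Js_star p).
Hypotheses (hp : admissible p) (hS : structural p).
Let l0 : 0 < l := l_gt0 hp.

Lemma ip_linear_r (a : R) (u v w : L2 l) : ip w (a *: u + v) = a * ip w u + ip w v.
Proof. by rewrite !(ip_sym w) ip_linear. Qed.

(* inner2 as a function of the scalar products of the components, subject to
   polynomial identities over R. *)
Definition form2 (A B gg gz zg zz gf gh zf zh gf' gh' zf' zh' w1 v1 w2 v2
    tf1 th1 tf2 th2 : R) : R :=
  (rho * cw ^+ 2 * A + Iw * cphi ^+ 2 * B
   + (rho * gg + rho * xc * gz + rho * xc * zg + Is * zz)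
   + (ms * (w1 * w2) + ms * xc * (w1 * v2) + ms * xc * (v1 * w2) + Jst * (v1 * v2)))
  + ((rho * (eps1 * gf) + rho * xc * (eps2 * gh) + rho * xc * (eps1 * zf) + Is * (eps2 * zh))
   + (rho * (eps1 * gf') + rho * xc * (eps2 * gh') + rho * xc * (eps1 * zf') + Is * (eps2 * zh'))
   + (ms * (w1 * (eps1 * tf2)) + ms * xc * (w1 * (eps2 * th2))
      + ms * xc * (v1 * (eps1 * tf2)) + Jst * (v1 * (eps2 * th2)))
   + (ms * (w2 * (eps1 * tf1)) + ms * xc * (w2 * (eps2 * th1))
      + ms * xc * (v2 * (eps1 * tf1)) + Jst * (v2 * (eps2 * th1)))).

Lemma inner2E (f1 g1 h1 z1 f2 g2 h2 z2 : L2 l) (w1 v1 w2 v2 : R) :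
  inner2 (p := p) (f1, g1, h1, z1, w1, v1) (f2, g2, h2, z2, w2, v2) =
  form2 (ip (wderiv (wderiv f1)) (wderiv (wderiv f2))) (ip (wderiv h1) (wderiv h2))
    (ip g1 g2) (ip g1 z2) (ip z1 g2) (ip z1 z2)
    (ip g1 f2) (ip g1 h2) (ip z1 f2) (ip z1 h2) (ip g2 f1) (ip g2 h1) (ip z2 f1) (ip z2 h1)
    w1 v1 w2 v2 (trace f1 l) (trace h1 l) (trace f2 l) (trace h2 l).
Proof. by rewrite /inner2 inner1E PsiE. Qed.

Lemma form2_lin (a A1 A2 B1 B2 c1 c2 d1 d2 e1 e2 i1 i2 j1 j2 m1 m2 n1 n2 o1 o2 q1 q2
    r1 r2 s1 s2 t1 t2 w1 w2 v1 v2 w v x1 x2 y1 y2 x y : R) :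
  form2 (a * A1 + A2) (a * B1 + B2) (a * c1 + c2) (a * d1 + d2) (a * e1 + e2) (a * i1 + i2)
    (a * j1 + j2) (a * m1 + m2) (a * n1 + n2) (a * o1 + o2) (a * q1 + q2) (a * r1 + r2)
    (a * s1 + s2) (a * t1 + t2) (a * w1 + w2) (a * v1 + v2) w v (a * x1 + x2) (a * y1 + y2) x y =
  a * form2 A1 B1 c1 d1 e1 i1 j1 m1 n1 o1 q1 r1 s1 t1 w1 v1 w v x1 y1 x y
  + form2 A2 B2 c2 d2 e2 i2 j2 m2 n2 o2 q2 r2 s2 t2 w2 v2 w v x2 y2 x y.
Proof. rewrite /form2; ring. Qed.

Lemma form2_sym (A B gg gz zg zz gf gh zf zh gf' gh' zf' zh' w1 v1 w2 v2 tf1 th1 tf2 th2 : R) :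
  form2 A B gg gz zg zz gf gh zf zh gf' gh' zf' zh' w1 v1 w2 v2 tf1 th1 tf2 th2 =
  form2 A B gg zg gz zz gf' gh' zf' zh' gf gh zf zh w2 v2 w1 v1 tf2 th2 tf1 th1.
Proof. rewrite /form2; ring. Qed.

(** Positivity is the only clause that needs the thresholds K_m, through [inner2_qform_ge]. *)
Lemma inner2_psd : psd_form (Hspace p) (inner2 (p := p)).
Proof.
split.
- move=> a [[[[[f1 g1] h1] z1] w1] v1] [[[[[f2 g2] h2] z2] w2] v2].
  move=> [[[[[f3 g3] h3] z3] w3] v3] [sf1 sh1] [sf2 sh2] [sf3 sh3].
  have -> : a *: ((f1, g1, h1, z1, w1, v1) : state p) + (f2, g2, h2, z2, w2, v2) =
    (a *: f1 + f2, a *: g1 + g2, a *: h1 + h2, a *: z1 + z2, a * w1 + w2, a * v1 + v2) by [].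
  move: sf1 sf2 => /(sobolevL2P l0)[F1 F1' _ _] /(sobolevL2P l0)[F2 F2' _ _].
  move: sh1 sh2 => /sobolevL1P[S1 _] /sobolevL1P[S2 _].
  rewrite !inner2E -form2_lin.
  congr (form2 _ _ _ _ _ _ _ _ _ _ _ _ _ _ _ _ _ _ _ _ _ _);
    rewrite ?(wderiv_lin l0)//; try exact: ip_linear; try exact: ip_linear_r;
    exact: (trace_lin l0 _ _ _ (inll l0)).
- move=> [[[[[f1 g1] h1] z1] w1] v1] [[[[[f2 g2] h2] z2] w2] v2] _ _.
  rewrite (inner2E f1) (inner2E f2).
  move: (wderiv (wderiv f1)) (wderiv (wderiv f2)) (wderiv h1) (wderiv h2) => A1 A2 B1 B2.
  apply: (etrans (form2_sym _ _ _ _ _ _ _ _ _ _ _ _ _ _ _ _ _ _ _ _ _ _)).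
  by congr (form2 _ _ _ _ _ _ _ _ _ _ _ _ _ _ _ _ _ _ _ _ _ _); exact: ip_sym.
- move=> X HX; have [c c0 hc] := inner2_qform_ge hp hS.
  have [_] := hc X HX; apply: le_trans.
  by rewrite mulr_ge0 ?qform_ge0// ltW.
Qed.

Lemma mx2_inv (a b c d : R) : a * d - b * c != 0 ->
  let m := invmx (mx2 a b c d) in
  [/\ a * m 0 0 + b * m 1 0 = 1, a * m 0 1 + b * m 1 1 = 0,
      c * m 0 0 + d * m 1 0 = 0 & c * m 0 1 + d * m 1 1 = 1].
Proof.
move=> dn m.
have U : mx2 a b c d \in unitmx.
  rewrite unitmxE unitfE (expand_det_row _ ord0) !big_ord_recl big_ord0 /cofactor.
  rewrite !det_mx11 !mxE /=; apply: contraNneq dn => <-.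
  by apply/eqP; rewrite expr0 expr1; ring.
have := mulmxV U; rewrite -/m => /matrixP e.
have key i j : mx2 a b c d i 0 * m 0 j + mx2 a b c d i 1 * m 1 j = (i == j)%:R.
  have h := e i j; rewrite [LHS]mxE [RHS]mxE !big_ord_recl big_ord0 addr0 in h.
  by rewrite -h; congr (_ * _ + _ * _); congr (_ _ _); exact/val_inj.
by split; [have := key 0 0|have := key 0 1|have := key 1 0|have := key 1 1]; rewrite !mxE /=.
Qed.

Lemma mxM_det : rho * Is - rho * xc * (rho * xc) != 0.
Proof.
have [[_ r0 I0 _ _] _ _ _ _] := hp.
have -> : rho * Is - rho * xc * (rho * xc) = rho * Iw by rewrite /Iw_star; ring.
by rewrite mulf_neq0 ?gt_eqF.
Qed.

Lemma mxMs_det : ms * Jst - ms * xc * (ms * xc) != 0.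
Proof.
have [[_ _ _ m0 J0] _ _ _ _] := hp.
have -> : ms * Jst - ms * xc * (ms * xc) = ms * Js by rewrite /Js_star; ring.
by rewrite mulf_neq0 ?gt_eqF.
Qed.

Lemma inv_comb_ip (a b : R) (m : 'M[R]_2) (B C F K u : L2 l) :
  let G := (- m 0 0 *: B + - m 0 1 *: C) + (m 0 0 *: F + m 0 1 *: K) in
  let Z := (- m 1 0 *: B + - m 1 1 *: C) + (m 1 0 *: F + m 1 1 *: K) in
  a * ip G u + b * ip Z u =
    (a * m 0 0 + b * m 1 0) * (ip F u - ip B u) + (a * m 0 1 + b * m 1 1) * (ip K u - ip C u).
Proof.
move=> G Z; rewrite /G /Z !ipDl !ipZl; move: (ip B u) (ip C u) (ip F u) (ip K u) => *; ring.
Qed.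

Lemma stateD (g G1 G2 z Z1 Z2 : L2 l) (w v : R) :
  ((g, G1, z, Z1, w, v) : state p) + (0, G2, 0, Z2, 0, 0) = (g, G1 + G2, z, Z1 + Z2, w, v).
Proof. by rewrite -[in RHS](addr0 g) -[in RHS](addr0 z) -[in RHS](addr0 w) -[in RHS](addr0 v). Qed.

(** The inner products contain M and M_s, which cancel the inverses in the operator. Only these
    products, tested against an arbitrary [u], enter the energy computation. *)
Lemma opA_struct (f g h z : L2 l) (zw zp : R) : exists (G Z : L2 l) (w v : R),
  [/\ opA p (f, g, h, z, zw, zp) = (g, G, z, Z, w, v),
   forall u, rho * ip G u + rho * xc * ip Z u =
     - (rho * cw ^+ 2) * ip (wderiv (wderiv (bend f g))) u
     + (aw * ip h u + bw * ip z u + gw * ip g u),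
   forall u, rho * xc * ip G u + Is * ip Z u =
     Iw * cphi ^+ 2 * ip (wderiv (twist h z)) u
     + (aphi * ip h u + bphi * ip z u + gphi * ip g u),
   ms * w + ms * xc * v = rho * cw ^+ 2 * trace (wderiv (bend f g)) l
     - k1 * (trace g l + eps1 * trace f l) &
   ms * xc * w + Jst * v = - (Iw * cphi ^+ 2) * trace (twist h z) l
     - k2 * (trace z l + eps2 * trace h l)].
Proof.
rewrite /opA /opA1 /opA2 /mxact.
generalize (wderiv (wderiv (bend (p := p) f g))) (wderiv (twist (p := p) h z)) => b2 t1.
set y1 := rho * cw ^+ 2 * _ - _; set y2 := - (Iw * cphi ^+ 2) * _ - _.
have [m1 m2 m3 m4] := mx2_inv mxM_det; have [n1 n2 n3 n4] := mx2_inv mxMs_det.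
set m := invmx (mxM p); set n := invmx (mxMs p).
rewrite -/m in m1 m2 m3 m4; rewrite -/n in n1 n2 n3 n4.
exists (((- m) 0 0 *: ((rho * cw ^+ 2) *: b2) + (- m) 0 1 *: (- (Iw * cphi ^+ 2) *: t1))
  + (m 0 0 *: (aw *: h + bw *: z + gw *: g) + m 0 1 *: (aphi *: h + bphi *: z + gphi *: g))).
exists (((- m) 1 0 *: ((rho * cw ^+ 2) *: b2) + (- m) 1 1 *: (- (Iw * cphi ^+ 2) *: t1))
  + (m 1 0 *: (aw *: h + bw *: z + gw *: g) + m 1 1 *: (aphi *: h + bphi *: z + gphi *: g))).
exists ((n *m cv2 y1 y2) 0 0), ((n *m cv2 y1 y2) 1 0).
have nE i : (n *m cv2 y1 y2) i 0 = n i 0 * y1 + n i 1 * y2.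
  rewrite mxE !big_ord_recl big_ord0 addr0 !mxE /=.
  by congr (_ * _ + _ * _); congr (_ _ _); exact/val_inj.
have mN i j : (- m) i j = - m i j by rewrite mxE.
split.
- exact: stateD.
- move=> u; rewrite !mN inv_comb_ip.
  rewrite m1 m2 mul0r addr0 mul1r !ipDl !ipZl.
  by rewrite addrC mulNr.
- move=> u; rewrite !mN inv_comb_ip.
  rewrite m3 m4 mul0r add0r mul1r !ipDl !ipZl.
  by rewrite addrC mulNr opprK.
- rewrite !nE.
  have -> : forall a b, a * (n 0 0 * y1 + n 0 1 * y2) + b * (n 1 0 * y1 + n 1 1 * y2) =
    (a * n 0 0 + b * n 1 0) * y1 + (a * n 0 1 + b * n 1 1) * y2 by move=> a b; ring.
  by rewrite n1 n2 mul1r mul0r addr0.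
- rewrite !nE.
  have -> : forall a b, a * (n 0 0 * y1 + n 0 1 * y2) + b * (n 1 0 * y1 + n 1 1 * y2) =
    (a * n 0 0 + b * n 1 0) * y1 + (a * n 0 1 + b * n 1 1) * y2 by move=> a b; ring.
  by rewrite n3 n4 mul1r mul0r add0r.
Qed.

(** Capital G, Z are components of AX; [Gg] stands for [ip G g], [bg] and [tz] for the products of
    (bend f g)'' with g and of (twist h z)' with z, and [gl], [bl], [tl] for values at l. The
    elastic terms cancel by skew-symmetry. The boundary forces from the integrations by parts cancel
    those of the tip equations, as both are tested with g(l) + eps_1 f(l) and z(l) + eps_2 h(l); the
    controls then leave pure squares. *)
Lemma generator_algebra (Gg Gz Zg Zz Gf Gh Zf Zh bg bf tz th hg zg gg hf zf gf hz zz hh gz gh zh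
    w v gl zl fl hl bl tl f2g2 g2g2 f2f2 g2f2 h1z1 z1z1 h1h1 z1h1 : R) :
  rho * Gg + rho * xc * Zg = - (rho * cw ^+ 2) * bg + (aw * hg + bw * zg + gw * gg) ->
  rho * Gf + rho * xc * Zf = - (rho * cw ^+ 2) * bf + (aw * hf + bw * zf + gw * gf) ->
  rho * xc * Gz + Is * Zz = Iw * cphi ^+ 2 * tz + (aphi * hz + bphi * zz + gphi * gz) ->
  rho * xc * Gh + Is * Zh = Iw * cphi ^+ 2 * th + (aphi * hh + bphi * zh + gphi * gh) ->
  ms * w + ms * xc * v = rho * cw ^+ 2 * bl - k1 * (gl + eps1 * fl) ->
  ms * xc * w + Jst * v = - (Iw * cphi ^+ 2) * tl - k2 * (zl + eps2 * hl) ->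
  bg = bl * gl + (f2g2 + etaw * g2g2) -> bf = bl * fl + (f2f2 + etaw * g2f2) ->
  tz = tl * zl - (h1z1 + etaphi * z1z1) -> th = tl * hl - (h1h1 + etaphi * z1h1) ->
  gh = hg -> f2g2 = g2f2 -> h1z1 = z1h1 -> gz = zg -> zh = hz ->
  form2 g2f2 z1h1 Gg Gz Zg Zz Gf Gh Zf Zh gg gz zg zz w v gl zl gl zl fl hl =
  - (rho * etaw * cw ^+ 2) * g2g2 - Iw * etaphi * cphi ^+ 2 * z1z1
  - eps1 * rho * cw ^+ 2 * (f2f2 + etaw * g2f2)
  - eps2 * Iw * cphi ^+ 2 * (h1h1 + etaphi * z1h1)
  + (gw * gg + bphi * zz + (aw + eps2 * gphi) * hg + (bw + gphi) * zg
     + (aphi + eps2 * bphi) * hz + eps1 * aw * hf + eps1 * bw * zf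
     + eps1 * gw * gf + eps2 * aphi * hh)
  + (rho * eps1 * gg + rho * xc * (eps1 + eps2) * zg + Is * eps2 * zz)
  + (ms * eps1 * gl ^+ 2 + ms * xc * (eps1 + eps2) * (gl * zl) + Jst * eps2 * zl ^+ 2)
  - k1 * (gl + eps1 * fl) ^+ 2 - k2 * (zl + eps2 * hl) ^+ 2.
Proof.
move=> a1 a2 a3 a4 a5 a6 b1 b2 b3 b4 c1 c2 c3 c4 c5.
(* The form is regrouped so that the left sides of the six equations of motion appear as blocks. *)
transitivity (rho * cw ^+ 2 * g2f2 + Iw * cphi ^+ 2 * z1h1
  + (rho * Gg + rho * xc * Zg) + (rho * xc * Gz + Is * Zz)
  + eps1 * (rho * Gf + rho * xc * Zf) + eps2 * (rho * xc * Gh + Is * Zh)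
  + (ms * w + ms * xc * v) * (gl + eps1 * fl) + (ms * xc * w + Jst * v) * (zl + eps2 * hl)
  + rho * eps1 * gg + rho * xc * (eps1 * zg + eps2 * gz) + Is * eps2 * zz
  + ms * eps1 * gl ^+ 2 + ms * xc * (eps1 + eps2) * (gl * zl) + Jst * eps2 * zl ^+ 2).
  by rewrite /form2; ring.
rewrite a1 a2 a3 a4 a5 a6 b1 b2 b3 b4 c1 c2 c3 c4 c5; ring.
Qed.

(** Of the four boundary terms, those at 0 vanish since u is clamped there, and the moment term at l
    by the domain condition; the shear force at l remains. *)
Lemma bend_by_parts (f g u : L2 l) : sobolev 2 (bend f g) -> trace (bend f g) l = 0 ->
  sobolevL 2 u ->
  ip (wderiv (wderiv (bend f g))) u = trace (wderiv (bend f g)) l * trace u l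
    + (ip (wderiv (wderiv f)) (wderiv (wderiv u))
       + etaw * ip (wderiv (wderiv g)) (wderiv (wderiv u))).
Proof.
move=> sb bl /(sobolevL2P l0)[u1 u2 t1 t2].
have [b1 b2] := sobolevS l0 sb.
have h2 := sobolev_by_parts l0 b2 u1; have h1 := sobolev_by_parts l0 b1 u2.
rewrite t1 mulr0 subr0 in h2; rewrite bl t2 mul0r mulr0 subr0 in h1.
have e : ip (bend f g) (wderiv (wderiv u)) = ip (wderiv (wderiv f)) (wderiv (wderiv u))
   + etaw * ip (wderiv (wderiv g)) (wderiv (wderiv u)) by rewrite /bend ipDl ipZl.
exact: (add_chain h2 h1 e).
Qed.

Lemma twist_by_parts (h z u : L2 l) : sobolev 1 (twist h z) -> sobolevL 1 u ->
  ip (wderiv (twist h z)) u = trace (twist h z) l * trace u l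
    - (ip (wderiv h) (wderiv u) + etaphi * ip (wderiv z) (wderiv u)).
Proof.
move=> st /sobolevL1P[u1 t1]; have hh := sobolev_by_parts l0 st u1.
rewrite t1 mulr0 subr0 in hh.
have e : ip (twist h z) (wderiv u) = ip (wderiv h) (wderiv u) + etaphi * ip (wderiv z) (wderiv u).
  by rewrite /twist ipDl ipZl.
exact: (add_chain1 hh e).
Qed.

Lemma generator_form (X : state p) : domA p X ->
  let: (f, g, h, z, zw, zp) := X in
  let f2 := wderiv (wderiv f) in let g2 := wderiv (wderiv g) in
  let h1 := wderiv h in let z1 := wderiv z in
  inner2 (opA p X) X =
  - (rho * etaw * cw ^+ 2) * ip g2 g2 - Iw * etaphi * cphi ^+ 2 * ip z1 z1
  - eps1 * rho * cw ^+ 2 * (ip f2 f2 + etaw * ip g2 f2)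
  - eps2 * Iw * cphi ^+ 2 * (ip h1 h1 + etaphi * ip z1 h1)
  + (gw * ip g g + bphi * ip z z + (aw + eps2 * gphi) * ip h g + (bw + gphi) * ip z g
     + (aphi + eps2 * bphi) * ip h z + eps1 * aw * ip h f + eps1 * bw * ip z f
     + eps1 * gw * ip g f + eps2 * aphi * ip h h)
  + (rho * eps1 * ip g g + rho * xc * (eps1 + eps2) * ip z g + Is * eps2 * ip z z)
  + (ms * eps1 * trace g l ^+ 2 + ms * xc * (eps1 + eps2) * (trace g l * trace z l)
     + Jst * eps2 * trace z l ^+ 2)
  - k1 * (trace g l + eps1 * trace f l) ^+ 2 - k2 * (trace z l + eps2 * trace h l) ^+ 2.
Proof.
case: X => [[[[[f g] h] z] zw] zp] [[sf sh] [sg sz sb st] bl [-> ->] _].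
move=> f2 g2 h1 z1; have [G [Z [w [v [-> e1 e2 e3 e4]]]]] := opA_struct f g h z (trace g l) (trace z l).
rewrite inner2E.
exact: (generator_algebra (e1 g) (e1 f) (e2 z) (e2 h) e3 e4
  (bend_by_parts sb bl sg) (bend_by_parts sb bl sf) (twist_by_parts st sz) (twist_by_parts st sh)
  (ip_sym g h) (ip_sym (wderiv (wderiv f)) (wderiv (wderiv g))) (ip_sym (wderiv h) (wderiv z))
  (ip_sym g z) (ip_sym z h)).
Qed.

Local Notation x := (`|xc|).

Lemma scaled_abs_le (c v k : R) : 0 <= c -> 2 * `|v| <= k -> 2 * (c * v) <= c * k.
Proof. by move=> c0 vk; apply: absmul_le => //; rewrite ger0_norm. Qed.

Lemma scaled_abs_ge (c v k : R) : 0 <= c -> 2 * `|v| <= k -> - (c * k) <= 2 * (c * v).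
Proof. by move=> c0 vk; apply: absmul_ge => //; rewrite ger0_norm. Qed.

(* A, B, C and l are the constants bounding u(x)^2 and |u|^2 by the highest
   derivative; each r_i weights the cross term in which lambda_1..6 use it. *)
Lemma dissipation_algebra (A B C F H G Z G2 Z1 ff hh g2f2 z1h1 hg zg hz hf zf gf gl zl y1 y2
    r1 r2 r3 r4 r5 r6 r7 r8 : R) :
  0 < r1 -> 0 < r2 -> 0 < r3 -> 0 < r4 -> 0 < r5 -> 0 < r6 -> 0 < r7 -> 0 < r8 ->
  2 * `|g2f2| <= r1 * G2 + r1^-1 * F -> 2 * `|z1h1| <= r2 * Z1 + r2^-1 * H ->
  2 * `|hg| <= r6 * hh + r6^-1 * G -> 2 * `|zg| <= r7 * Z + r7^-1 * G ->
  2 * `|hz| <= r8 * Z + r8^-1 * hh -> 2 * `|hf| <= r4 * hh + r4^-1 * ff ->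
  2 * `|zf| <= r5 * Z + r5^-1 * ff -> 2 * `|gf| <= r3 * G + r3^-1 * ff ->
  2 * `|zg| <= Z + G -> 2 * `|gl * zl| <= gl ^+ 2 + zl ^+ 2 ->
  ff <= A * F -> hh <= B * H -> G <= A * G2 -> Z <= B * Z1 ->
  gl ^+ 2 <= C * G2 -> zl ^+ 2 <= l * Z1 ->
  - (rho * etaw * cw ^+ 2) * G2 - Iw * etaphi * cphi ^+ 2 * Z1
  - eps1 * rho * cw ^+ 2 * (F + etaw * g2f2)
  - eps2 * Iw * cphi ^+ 2 * (H + etaphi * z1h1)
  + (gw * G + bphi * Z + (aw + eps2 * gphi) * hg + (bw + gphi) * zg
     + (aphi + eps2 * bphi) * hz + eps1 * aw * hf + eps1 * bw * zf
     + eps1 * gw * gf + eps2 * aphi * hh)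
  + (rho * eps1 * G + rho * xc * (eps1 + eps2) * zg + Is * eps2 * Z)
  + (ms * eps1 * gl ^+ 2 + ms * xc * (eps1 + eps2) * (gl * zl) + Jst * eps2 * zl ^+ 2)
  - k1 * y1 ^+ 2 - k2 * y2 ^+ 2 <=
  - (eps1 * (rho * cw ^+ 2 * (1 - etaw / 2 * r1^-1)
       - A / 2 * (aw * r4^-1 + bw * r5^-1 + gw * r3^-1))) * F
  - (rho * etaw * cw ^+ 2 - eps2 * x / 2 * (rho * A + ms * C)
     - eps1 * ((2 + x) / 2 * (rho * A + ms * C) + rho * etaw * cw ^+ 2 * r1 / 2)) * G2
  + (gw + (aw + eps2 * gphi) / 2 * r6^-1 + eps1 * gw * r3 / 2 + (bw + gphi) / 2 * r7^-1) * G
  - (eps2 * Iw * cphi ^+ 2 * (1 - etaphi / 2 * r2^-1)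
     - B * ((aw + eps2 * gphi) * r6 / 2 + (aphi + eps2 * bphi) / 2 * r8^-1
         + eps1 * aw * r4 / 2 + eps2 * aphi)) * H
  + (bphi + (bw + gphi) * r7 / 2 + (aphi + eps2 * bphi) * r8 / 2 + eps1 * bw * r5 / 2) * Z
  - (Iw * etaphi * cphi ^+ 2 - eps1 * x / 2 * (rho * B + ms * l)
     - eps2 * ((Is + x * rho / 2) * B + Iw * etaphi * cphi ^+ 2 * r2 / 2
       + l * (Jst + x * ms / 2))) * Z1.
Proof.
move=> r10 r20 r30 r40 r50 r60 r70 r80 Y1 Y2 Y6 Y7 Y8 Y4 Y5 Y3 Yzg Ytr bf bh bg bz bgl bzl.
case: hp => -[_ rho0 I0 m0 J0] [cw0 cp0 ew0 ep0] [k10 k20 e10 e20] [aw0 bw0 gw0] [ap0 bp0 gp0].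
have xx := sqr_ge0 xc; have x0 : 0 <= x := normr_ge0 xc.
have Is0 : 0 <= Is by rewrite /Iw_star addr_ge0 ?(ltW I0)// mulr_ge0// ltW.
have Js0 : 0 <= Jst by rewrite /Js_star addr_ge0 ?(ltW J0)// mulr_ge0// ltW.
have ir3 : 0 <= r3^-1 by rewrite invr_ge0 ltW.
have ir4 : 0 <= r4^-1 by rewrite invr_ge0 ltW.
have ir5 : 0 <= r5^-1 by rewrite invr_ge0 ltW.
have ir8 : 0 <= r8^-1 by rewrite invr_ge0 ltW.
have half0 : 0 <= 2^-1 :> R by rewrite invr_ge0 ler0n.
have n1 : 0 <= k1 * y1 ^+ 2 by rewrite mulr_ge0 ?sqr_ge0 ?ltW.
have n2 : 0 <= k2 * y2 ^+ 2 by rewrite mulr_ge0 ?sqr_ge0 ?ltW.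
have c1 := @scaled_abs_ge (eps1 * rho * cw ^+ 2 * etaw) _ _ ltac:(nneg) Y1.
have c2 := @scaled_abs_ge (eps2 * Iw * cphi ^+ 2 * etaphi) _ _ ltac:(nneg) Y2.
have c6 := @scaled_abs_le (aw + eps2 * gphi) _ _ ltac:(nneg) Y6.
have c7 := @scaled_abs_le (bw + gphi) _ _ ltac:(nneg) Y7.
have c8 := @scaled_abs_le (aphi + eps2 * bphi) _ _ ltac:(nneg) Y8.
have c4 := @scaled_abs_le (eps1 * aw) _ _ ltac:(nneg) Y4.
have c5 := @scaled_abs_le (eps1 * bw) _ _ ltac:(nneg) Y5.
have c3 := @scaled_abs_le (eps1 * gw) _ _ ltac:(nneg) Y3.
have q1 : `|rho * xc * (eps1 + eps2)| <= rho * x * (eps1 + eps2).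
  by rewrite !normrM (gtr0_norm rho0) (gtr0_norm (addr_gt0 e10 e20)).
have q2 : `|ms * xc * (eps1 + eps2)| <= ms * x * (eps1 + eps2).
  by rewrite !normrM (gtr0_norm m0) (gtr0_norm (addr_gt0 e10 e20)).
have c9 := absmul_le q1 Yzg; have c10 := absmul_le q2 Ytr.
(* These factors collect what is left in |f|^2, |h|^2 and the traces, now replaced by highest
   derivatives. For |g|^2 and |z|^2 only the inertial part is replaced; the part with lambda_2 and
   lambda_5 is kept for the conditions on mu_3 and mu_6. *)
have d1 := ler_wpM2l (_ : 0 <= 2^-1 * (eps1 * (aw * r4^-1 + bw * r5^-1 + gw * r3^-1))) bf.
have d2 := ler_wpM2l (_ : 0 <= (aw + eps2 * gphi) * r6 * 2^-1 + (aphi + eps2 * bphi) * 2^-1 * r8^-1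
         + eps1 * aw * r4 * 2^-1 + eps2 * aphi) bh.
have d3 := ler_wpM2l (_ : 0 <= rho * eps1 + rho * x * (eps1 + eps2) * 2^-1) bg.
have d4 := ler_wpM2l (_ : 0 <= Is * eps2 + rho * x * (eps1 + eps2) * 2^-1) bz.
have d5 := ler_wpM2l (_ : 0 <= ms * eps1 + ms * x * (eps1 + eps2) * 2^-1) bgl.
have d6 := ler_wpM2l (_ : 0 <= Jst * eps2 + ms * x * (eps1 + eps2) * 2^-1) bzl.
have {}d1 := d1 ltac:(nneg). have {}d2 := d2 ltac:(nneg). have {}d3 := d3 ltac:(nneg).
have {}d4 := d4 ltac:(nneg). have {}d5 := d5 ltac:(nneg). have {}d6 := d6 ltac:(nneg).
clear -n1 n2 c1 c2 c3 c4 c5 c6 c7 c8 c9 c10 d1 d2 d3 d4 d5 d6.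
move: (r1^-1) (r2^-1) (r3^-1) (r4^-1) (r5^-1) (r6^-1) (r7^-1) (r8^-1)
  n1 n2 c1 c2 c3 c4 c5 c6 c7 c8 c9 c10
  d1 d2 d3 d4 d5 d6.
move: (gl ^+ 2) (zl ^+ 2) (gl * zl) (k1 * y1 ^+ 2) (k2 * y2 ^+ 2) (cw ^+ 2) (cphi ^+ 2).
move: Is Jst rho Iw ms xc x etaw etaphi eps1 eps2 aw bw gw aphi bphi gphi l => *; lra.
Qed.

(** Bounding d2 G by d2 A G2 leaves the margin (d3 - d2 A) G2. One half of it pays for c G and the
    other for the squared trace c a; the margin in Z1 is shared between Z and b in the same way. *)
Lemma dissipation_sum (F H G Z G2 Z1 a b A B C d1 d2 d3 d4 d5 d6 : R) :
  0 < A -> 0 < B -> 0 < C -> 0 <= G2 -> 0 <= Z1 -> 0 <= F -> 0 <= H -> 0 <= G -> 0 <= Z ->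
  0 <= a -> 0 <= b -> G <= A * G2 -> Z <= B * Z1 -> a <= C * G2 -> b <= l * Z1 ->
  0 <= d2 -> 0 <= d5 -> 0 < d1 -> 0 < d4 -> 0 < d3 - d2 * A -> 0 < d6 - d5 * B ->
  forall c, c <= d1 -> c <= d4 -> c <= (d3 - d2 * A) / (2 * A) -> c <= (d6 - d5 * B) / (2 * B) ->
  c <= (d3 - d2 * A) / (2 * C) -> c <= (d6 - d5 * B) / (2 * l) ->
  - d1 * F - d3 * G2 + d2 * G - d4 * H + d5 * Z - d6 * Z1 <= - c * (F + H + G + Z + a + b).
Proof.
move=> A0 B0 C0 G20 Z10 F0 H0 G0 Z0 a0 b0 bG bZ ba bb d20 d50 d10 d40 D3 D6 c cF cH cG cZ ca cb.
have half (d t K u : R) : 0 < K -> 0 < d -> c <= d / (2 * K) -> 0 <= t -> t <= K * u ->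
    c * t <= d / 2 * u.
  move=> K0 d0 cd t0 tu; apply: (@le_trans _ _ (d / (2 * K) * t)); first exact: ler_wpM2r.
  apply: (@le_trans _ _ (d / (2 * K) * (K * u))).
    by apply: ler_wpM2l => //; rewrite divr_ge0 ?mulr_ge0 ?ltW.
  by rewrite le_eqVlt; apply/orP; left; apply/eqP; field; rewrite gt_eqF.
have l0' := l0.
have e1 := half _ _ _ _ A0 D3 cG G0 bG; have e2 := half _ _ _ _ B0 D6 cZ Z0 bZ.
have e3 := half _ _ _ _ C0 D3 ca a0 ba; have e4 := half _ _ _ _ l0' D6 cb b0 bb.
have e5 := ler_wpM2l d20 bG; have e6 := ler_wpM2l d50 bZ.
have e7 := ler_wpM2r F0 cF; have e8 := ler_wpM2r H0 cH.
clear -e1 e2 e3 e4 e5 e6 e7 e8; lra.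
Qed.

Let A : R := 16 * l ^+ 4 / pi ^+ 4.
Let B : R := 4 * l ^+ 2 / pi ^+ 2.
Let C : R := 4 * l ^+ 3 / pi ^+ 2.

(** [A / 2] is the constant 8 l^4 / pi^4 of lambda_1. The factor rho c_w^2 appears since lambda_1
    multiplies the weighted elastic energy, whereas |f''|^2 is unweighted here. *)
Lemma lambda_bending (r1 r3 r4 r5 r6 r7 : R) :
  0 < r1 -> 0 < r3 -> 0 < r4 -> 0 < r5 -> 0 < r6 -> 0 < r7 ->
  [/\ eps1 * (rho * cw ^+ 2 * (1 - etaw / 2 * r1^-1)
       - A / 2 * (aw * r4^-1 + bw * r5^-1 + gw * r3^-1)) = rho * cw ^+ 2 * lambda1 p r1 r3 r4 r5,
      gw + (aw + eps2 * gphi) / 2 * r6^-1 + eps1 * gw * r3 / 2 + (bw + gphi) / 2 * r7^-1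
        = lambda2 p r3 r6 r7 &
      rho * etaw * cw ^+ 2 - eps2 * x / 2 * (rho * A + ms * C)
     - eps1 * ((2 + x) / 2 * (rho * A + ms * C) + rho * etaw * cw ^+ 2 * r1 / 2)
        = lambda3 p r1].
Proof.
move=> r10 r30 r40 r50 r60 r70.
case: hp => -[_ rho0 I0 m0 _] [cw0 cp0 _ _] _ _ _.
rewrite /A /C /lambda1 /lambda2 /lambda3.
move: (pi : R) (pi_gt0 R) => q q0; move: x => y.
by split; field; rewrite ?gt_eqF//; do !split; rewrite ?gt_eqF.
Qed.

Lemma lambda_torsion (r2 r4 r5 r6 r7 r8 : R) :
  0 < r2 -> 0 < r4 -> 0 < r5 -> 0 < r6 -> 0 < r7 -> 0 < r8 ->
  [/\ eps2 * Iw * cphi ^+ 2 * (1 - etaphi / 2 * r2^-1)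
     - B * ((aw + eps2 * gphi) * r6 / 2 + (aphi + eps2 * bphi) / 2 * r8^-1
         + eps1 * aw * r4 / 2 + eps2 * aphi) = Iw * cphi ^+ 2 * lambda4 p r2 r4 r6 r8,
      bphi + (bw + gphi) * r7 / 2 + (aphi + eps2 * bphi) * r8 / 2 + eps1 * bw * r5 / 2
        = lambda5 p r5 r7 r8 &
      Iw * etaphi * cphi ^+ 2 - eps1 * x / 2 * (rho * B + ms * l)
     - eps2 * ((Is + x * rho / 2) * B + Iw * etaphi * cphi ^+ 2 * r2 / 2
       + l * (Jst + x * ms / 2)) = lambda6 p r2].
Proof.
move=> r20 r40 r50 r60 r70 r80.
case: hp => -[_ rho0 I0 m0 _] [cw0 cp0 _ _] _ _ _.
rewrite /B /lambda4 /lambda5 /lambda6.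
move: (pi : R) (pi_gt0 R) => q q0; move: x Is Jst => y I J.
by split; field; rewrite ?gt_eqF//; do !split; rewrite ?gt_eqF.
Qed.

Lemma opA_dissipative : exists2 c : R, 0 < c &
  forall X, domA p X -> inner2 (opA p X) X <= - c * qform X.
Proof.
case: (hS) => _ _ _ _ [r1 [r2 [r3 [r4 [r5 [r6 [r7 [r8 [[r10 r20 r30 r40]
  [r50 r60 r70 r80] [L1 L3 L4 L6] M3 M6]]]]]]]]].
case: (hp) => -[_ rho0 I0 m0 J0] [cw0 cp0 ew0 ep0] [k10 k20 e10 e20] [aw0 bw0 gw0] [ap0 bp0 gp0].
have l0' := l0; have pi0 := pi_gt0 R.
have A0 : 0 < A by rewrite /A !(mulr_gt0, invr_gt0, exprn_gt0).
have B0 : 0 < B by rewrite /B !(mulr_gt0, invr_gt0, exprn_gt0).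
have C0 : 0 < C by rewrite /C !(mulr_gt0, invr_gt0, exprn_gt0).
have [] := lambda_bending r10 r30 r40 r50 r60 r70.
set d1 := eps1 * _; set d2 := _ + (bw + gphi) / 2 * _; set d3 := _ - eps1 * _.
move=> [e1 e2 e3].
have [] := lambda_torsion r20 r40 r50 r60 r70 r80.
set d4 := eps2 * _ * _ * _ - _; set d5 := _ + eps1 * bw * _ / 2; set d6 := _ - eps2 * _.
move=> [e4 e5 e6].
have d20 : 0 <= d2.
  by rewrite /d2 !addr_ge0 ?mulr_ge0 ?addr_ge0 ?mulr_ge0 ?invr_ge0 ?ler0n// ltW.
have d50 : 0 <= d5.
  by rewrite /d5 !addr_ge0 ?mulr_ge0 ?addr_ge0 ?mulr_ge0 ?invr_ge0 ?ler0n// ltW.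
have d10 : 0 < d1 by rewrite e1; exact: mulr_gt0 (mulr_gt0 rho0 (exprn_gt0 _ cw0)) L1.
have d40 : 0 < d4 by rewrite e4; exact: mulr_gt0 (mulr_gt0 I0 (exprn_gt0 _ cp0)) L4.
(* This margin is [A] times mu_3; likewise the next one is [B] times mu_6. *)
have D3 : 0 < d3 - d2 * A.
  have -> : d3 - d2 * A = A * (pi ^+ 4 * lambda3 p r1 / (16 * l ^+ 4) - lambda2 p r3 r6 r7).
    rewrite e2 e3 /A; move: (pi : R) pi0 (lambda3 _ _) (lambda2 _ _ _ _) => q q0 u v.
    by field; rewrite ?gt_eqF//; do !split; rewrite ?gt_eqF.
  by rewrite mulr_gt0.
have D6 : 0 < d6 - d5 * B.
  have -> : d6 - d5 * B = B * (pi ^+ 2 * lambda6 p r2 / (4 * l ^+ 2) - lambda5 p r5 r7 r8).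
    rewrite e5 e6 /B; move: (pi : R) pi0 (lambda6 _ _) (lambda5 _ _ _ _) => q q0 u v.
    by field; rewrite ?gt_eqF//; do !split; rewrite ?gt_eqF.
  by rewrite mulr_gt0.
have [c [[c0 cF cH cG] [cZ ca cb]]] := min6_gt0 d10 d40
  (divr_gt0 D3 (mulr_gt0 (ltr0Sn R 1) A0)) (divr_gt0 D6 (mulr_gt0 (ltr0Sn R 1) B0))
  (divr_gt0 D3 (mulr_gt0 (ltr0Sn R 1) C0)) (divr_gt0 D6 (mulr_gt0 (ltr0Sn R 1) l0')).
exists c => //.
move=> [[[[[f g] h] z] a] b] dX; have E := generator_form dX.
case: dX => -[sf sh] [sg sz _ _] _ [ae be] _.
have [f1 f2] := sobolevL2_bounds hp sf; have [h1 h2] := sobolevL1_bounds hp sh.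
have [g1 g2] := sobolevL2_bounds hp sg; have [z1 z2] := sobolevL1_bounds hp sz.
rewrite E ae be.
have S := @dissipation_sum (ip (wderiv (wderiv f)) (wderiv (wderiv f)))
  (ip (wderiv h) (wderiv h)) (ip g g) (ip z z) (ip (wderiv (wderiv g)) (wderiv (wderiv g)))
  (ip (wderiv z) (wderiv z)) (trace g l ^+ 2) (trace z l ^+ 2) A B C d1 d2 d3 d4 d5 d6
  A0 B0 C0 (ip_ge0 _) (ip_ge0 _) (ip_ge0 _) (ip_ge0 _) (ip_ge0 _) (ip_ge0 _)
  (sqr_ge0 _) (sqr_ge0 _) g1 z1 g2 z2 d20 d50 d10 d40 D3 D6 c cF cH cG cZ ca cb.
(* In lambda_5 the weight r_8 multiplies |z|^2, so Young's inequality is taken with z as first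
   argument. *)
have yhz := ip_young z h r80; rewrite (ip_sym z h) in yhz.
apply: le_trans S.
exact: (dissipation_algebra (trace g l + eps1 * trace f l) (trace z l + eps2 * trace h l)
  r10 r20 r30 r40 r50 r60 r70 r80
  (ip_young _ _ r10) (ip_young _ _ r20) (ip_young _ _ r60) (ip_young _ _ r70)
  yhz (ip_young _ _ r40) (ip_young _ _ r50) (ip_young _ _ r30)
  (ip_young1 _ _) (sqr_young _ _) f1 h1 g1 z1 g2 z2).
Qed.

End dissipation.

(** * Density of the domain *)

Section boundary_corrections.
Context {R : realType} (l : R).
Hypothesis l0 : 0 < l.

(** Dominated convergence with bound |q|: |w| may reach 1 at the endpoints, which is what lets the
    corrections keep a fixed boundary value. *)
Lemma polyL_mul_exp_small (q w : {poly R}) (e : R) : 0 < e ->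
  (forall x, 0 < x < l -> `|w.[x]| < 1) ->
  \forall n \near \oo, L2norm (polyL l (q * w ^+ n)) < e.
Proof.
move=> e0 w1.
have mq (r : {poly R}) : measurable_fun [set: measurableTypeR R] (horner r).
  exact: continuous_measurable_fun (@continuous_horner R r).
have F0 : \forall x \ae leb l, (q * w ^+ n).[x] @[n --> \oo] --> (0 : {poly R}).[x].
  apply: aeS ae_in_itv => x /w1 wx; rewrite horner0.
  under eq_fun do rewrite hornerM horner_exp.
  rewrite -(mulr0 q.[x]); apply: cvgM; first exact: cvg_cst.
  exact: cvg_expr.
have Fq n x : 0 < x < l -> `|(q * w ^+ n).[x] - (0 : {poly R}).[x]| <= `|q.[x]|.
  move=> /w1 wx; rewrite horner0 subr0 hornerM horner_exp normrM normrX.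
  by rewrite ler_piMr// exprn_ile1// ltW.
apply: filterS (@L2_dominated R l (fun n => horner (q * w ^+ n)) (horner (0 : {poly R})) (horner q)
  _ (fun n => mq _) (mq _) F0 (horner_Lfun l0 q) Fq (exprn_gt0 2 e0)) => n h.
have := L2norm_cls_lt (horner_Lfun l0 (q * w ^+ n)) (horner_Lfun l0 0) e0 h.
by rewrite -/(polyL l (q * w ^+ n)) -/(polyL l 0) (polyL0 l0) subr0.
Qed.

(* The boundary values are corrected by q (1 - (x/l)^2)^n at 0 and by (x/l)^n at
   l, which tend to 0 in L2. *)
Lemma boundary_density (u : L2 l) (a b c e : R) : 0 < e ->
  exists p : {poly R}, [/\ p.[0] = a, p^`().[0] = b, p.[l] = c & L2norm (u - polyL l p) < e].
Proof.
move=> e0; have e3 : 0 < e / 3 by rewrite divr_gt0.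
have [p hp] := polynomials_dense l0 u e3.
have ln0 : l != 0 by rewrite gt_eqF.
(* [q] carries the missing value and slope at 0. Powers of 1 - (x/l)^2 are 1 with zero derivative at
   0, so multiplying by them changes neither. *)
pose q : {poly R} := (a - p.[0])%:P + (b - p^`().[0]) *: 'X.
pose w : {poly R} := l^-1 *: 'X.
have wE x : w.[x] = l^-1 * x by rewrite !hornerE.
have h2 x : 0 < x < l -> `|w.[x]| < 1.
  move=> /andP[x0 xl]; rewrite wE ger0_norm ?mulr_ge0 ?invr_ge0 ?(ltW l0) ?(ltW x0)//.
  by rewrite mulrC ltr_pdivrMr// mul1r.
have vE x : (1 - w ^+ 2).[x] = 1 - (l^-1 * x) ^+ 2.
  by rewrite hornerD hornerN horner_exp wE hornerC.
have h1 x : 0 < x < l -> `|(1 - w ^+ 2).[x]| < 1.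
  move=> hx; have /andP[x0 xl] := hx; have := h2 x hx; rewrite vE wE => h.
  have y0 : 0 < (l^-1 * x) ^+ 2 by rewrite exprn_gt0// mulr_gt0// invr_gt0.
  have y1 : (l^-1 * x) ^+ 2 < 1 by rewrite -(real_normK (num_real _)) expr_lt1.
  by rewrite ger0_norm ?subr_ge0 ?(ltW y1)// ltrBlDr ltrDl.
(* The extra factors matter for small n: for every n, including 0, the first correction vanishes at
   l and the second vanishes to second order at 0. *)
pose q1 := q * (1 - w ^+ 2); pose q2 := (c - p.[l]) *: w ^+ 2.
have [n [n1 n2]] : exists n, L2norm (polyL l (q1 * (1 - w ^+ 2) ^+ n)) < e / 3 /\
    L2norm (polyL l (q2 * w ^+ n)) < e / 3.
  apply: (@filter_ex _ \oo); apply: filterI; exact: polyL_mul_exp_small.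
pose r1 := q1 * (1 - w ^+ 2) ^+ n; pose r2 := q2 * w ^+ n.
have r1E x : r1.[x] = q.[x] * (1 - (l^-1 * x) ^+ 2) ^+ n.+1.
  by rewrite /r1 /q1 -mulrA -exprS hornerM horner_exp vE.
have r2E x : r2.[x] = (c - p.[l]) * (l^-1 * x) ^+ n.+2.
  by rewrite /r2 /q2 -scalerAl -exprD hornerZ horner_exp wE add2n.
have r1d : r1^`().[0] = b - p^`().[0].
  rewrite /r1 /q1 -mulrA -exprS derivM deriv_exp derivB deriv_exp derivC sub0r.
  rewrite hornerD !hornerM horner_exp vE hornerMn !hornerM hornerN hornerMn hornerM horner_exp wE.
  rewrite mulr0 expr0n subr0 expr1n expr1 mulr0 mul0rn oppr0 mul0r mul0rn mulr0 addr0 mulr1.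
  by rewrite /q derivD derivC derivZ derivX add0r hornerZ hornerC mulr1.
have r2d : r2^`().[0] = 0.
  rewrite /r2 /q2 -scalerAl -exprD derivZ hornerZ deriv_exp hornerMn hornerM horner_exp wE.
  by rewrite mulr0 expr0n mulr0 mul0rn mulr0.
exists (p + r1 + r2); split.
- rewrite !hornerD r1E r2E mulr0 !expr0n subr0 expr1n mulr1 mulr0 addr0.
  by rewrite /q hornerD hornerC hornerZ hornerX mulr0 addr0 addrC subrK.
- by rewrite !derivD !hornerD r1d r2d addr0 addrC subrK.
- rewrite !hornerD r1E r2E mulVf// !expr1n subrr !expr0n mulr0 mulr1 addr0.
  by rewrite addrC subrK.
- rewrite -(scale1r (p + r1)) (polyL_lin l0) scale1r -(scale1r p) (polyL_lin l0) scale1r.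
  move: hp n1 n2; rewrite -/r1 -/r2; move: (polyL l p) (polyL l r1) (polyL l r2) => P P1 P2 hP hP1 hP2.
  have -> : u - (P + P1 + P2) = (u - P) + (- 1 *: P1 + - 1 *: P2).
    by rewrite !scaleN1r !opprD !addrA.
  apply: le_lt_trans (L2normD _ _) _; have := L2normD (-1 *: P1) (-1 *: P2).
  rewrite !L2normZ normrN1 !mul1r => h; clear -h hP hP1 hP2; lra.
Qed.
End boundary_corrections.

Section domain_density.
Context {R : realType} (p : params R).
Local Notation l := (len p).
Local Notation etaw := (p_etaomega p).
Local Notation etaphi := (p_etaphi p).
Hypotheses (hp : admissible p) (hS : structural p).
Let l0 : 0 < l := l_gt0 hp.

Lemma sobolev_polyL m (r : {poly R}) : sobolev m (polyL l r).
Proof.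
elim: m r => [//|m ih] r; apply: (sobolevSI l0) => //; first exact: sobolev1_polyL.
by rewrite (wderiv_polyL l0).
Qed.

Lemma in_AC_polyL (r : {poly R}) : in_AC (polyL l r).
Proof. exact: sobolev1_in_AC (sobolev1_polyL l0 r). Qed.

Lemma sobolevL2_polyL (r : {poly R}) : r.[0] = 0 -> r^`().[0] = 0 -> sobolevL 2 (polyL l r).
Proof.
move=> r0 r1; apply/(sobolevL2P l0); rewrite (wderiv_polyL l0).
by split; rewrite ?(trace_polyL l0 _ (in0l l0)) //; exact: sobolev1_polyL.
Qed.

Lemma sobolevL1_polyL (r : {poly R}) : r.[0] = 0 -> sobolevL 1 (polyL l r).
Proof.
by move=> r0; apply/sobolevL1P; rewrite (trace_polyL l0 _ (in0l l0)); split=> //; exact: sobolev1_polyL.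
Qed.

(** The free data are g, z, the bending b and the twist t; f and h are recovered by integrating f''
    = b - eta_w g'' and h' = t - eta_phi z', so that the condition at l only concerns b. *)
Lemma domA_polyL (g z b t : {poly R}) : g.[0] = 0 -> g^`().[0] = 0 -> z.[0] = 0 -> b.[l] = 0 ->
  domA p (polyL l (primp (primp (b - etaw *: g^`()^`()))), polyL l g,
          polyL l (primp (t - etaphi *: z^`())), polyL l z, g.[l], z.[l]).
Proof.
move=> g0 g1 z0 bl.
have eb : bend (p := p) (polyL l (primp (primp (b - etaw *: g^`()^`())))) (polyL l g) = polyL l b.
  rewrite /bend !(wderiv_polyL l0) !deriv_primp.
  by rewrite addrC -(polyL_lin l0) addrC subrK.
have et : twist (p := p) (polyL l (primp (t - etaphi *: z^`()))) (polyL l z) = polyL l t.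
  by rewrite /twist !(wderiv_polyL l0) deriv_primp addrC -(polyL_lin l0) addrC subrK.
have sf := @sobolevL2_polyL (primp (primp (b - etaw *: g^`()^`()))) (primp0 _)
  (etrans (congr1 (horner^~ 0) (deriv_primp _)) (primp0 _)).
have sh := @sobolevL1_polyL (primp (t - etaphi *: z^`())) (primp0 _).
split.
- by split.
- rewrite eb et; split; [exact: sobolevL2_polyL|exact: sobolevL1_polyL|exact: sobolev_polyL|exact: sobolev_polyL].
- by rewrite eb (trace_polyL l0 _ (inll l0)).
- by rewrite !(trace_polyL l0 _ (inll l0)).
- by rewrite eb et !(wderiv_polyL l0); do !split; exact: in_AC_polyL.
Qed.

(** The velocities are approximated with the prescribed tip values a and b, so the last two
    components agree exactly. The bending is chosen after g: it approximates f'' + eta_w g'' for the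
    new g, so g'' may be large without harm. The twist is treated alike. *)
Lemma domA_dense (X : state p) (e : R) : Hspace p X -> 0 < e ->
  exists2 Y, domA p Y & form_norm (inner2 (p := p)) (X - Y) < e.
Proof.
have [C C0 hC] := inner2_qform_le hp.
case: X => [[[[[f g] h] z] a] b] HX e0; have [sf sh] := HX.
(* Four components contribute less than d^2 each, and 4 C d^2 <= (4 C + 1)^2 d^2 = e^2. *)
pose d := e / (4 * C + 1).
have C1 : 0 < 4 * C + 1 by rewrite addr_gt0 ?mulr_gt0.
have d0 : 0 < d by rewrite divr_gt0.
have [gp [g0 g1 gl dg]] := boundary_density l0 g 0 0 a d0.
have [zp [z0 _ zl dz]] := boundary_density l0 z 0 0 b d0.
have [bp [_ _ bl db]] := boundary_density l0
  (wderiv (wderiv f) + etaw *: polyL l gp^`()^`()) 0 0 0 d0.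
have [tp dt] := polynomials_dense l0 (wderiv h + etaphi *: polyL l zp^`()) d0.
have dY := domA_polyL tp g0 g1 z0 bl.
set F := polyL l (primp (primp _)) in dY; set H := polyL l (primp _) in dY.
have [HY _ _ _ _] := dY; have [sF sH] := HY.
exists (F, polyL l gp, H, polyL l zp, gp.[l], zp.[l]) => //.
have [f1 f2 _ _] := (sobolevL2P l0 _).1 sf; have [h1 _] := (sobolevL1P _).1 sh.
have [y1 y2 _ _] := (sobolevL2P l0 _).1 sF; have [v1 _] := (sobolevL1P _).1 sH.
have eF : wderiv (wderiv (f - F)) = wderiv (wderiv f) + etaw *: polyL l gp^`()^`() - polyL l bp.
  rewrite -scaleN1r addrC (wderiv_lin l0)// (wderiv_lin l0)// /F !(wderiv_polyL l0) !deriv_primp.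
  rewrite (addrC bp) -scaleNr (polyL_lin l0) scaleN1r opprD scaleNr opprK.
  by rewrite addrC addrA.
have eH : wderiv (h - H) = wderiv h + etaphi *: polyL l zp^`() - polyL l tp.
  rewrite -scaleN1r addrC (wderiv_lin l0)// /H !(wderiv_polyL l0) !deriv_primp.
  rewrite (addrC tp) -scaleNr (polyL_lin l0) scaleN1r opprD scaleNr opprK.
  by rewrite addrC addrA.
have [_ h2] := hC _ (subspaceB (Hspace_subspace l0) HX HY).
have sq (u : L2 l) : L2norm u < d -> ip u u < d ^+ 2.
  by move=> ud; rewrite -sqr_L2norm ltr_pXn2r// nnegrE ?L2norm_ge0 ?(ltW d0).
have E : ((f, g, h, z, a, b) : state p) - (F, polyL l gp, H, polyL l zp, gp.[l], zp.[l]) =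
  (f - F, g - polyL l gp, h - H, z - polyL l zp, a - gp.[l], b - zp.[l]) by [].
rewrite E in h2 *.
have q4 : qform ((f - F, g - polyL l gp, h - H, z - polyL l zp, a - gp.[l], b - zp.[l]) : state p)
    < 4 * d ^+ 2.
  rewrite /qform eF eH gl zl !subrr expr0n /= !addr0.
  have := ltrD (ltrD (ltrD (sq _ db) (sq _ dt)) (sq _ dg)) (sq _ dz).
  by move/lt_le_trans; apply; rewrite le_eqVlt; apply/orP; left; apply/eqP; ring.
rewrite /form_norm; have -> : e = Num.sqrt (e ^+ 2) by rewrite sqrtr_sqr gtr0_norm.
rewrite ltr_sqrt ?exprn_gt0//; apply: le_lt_trans h2 _.
apply: (@lt_le_trans _ _ (C * (4 * d ^+ 2))); first by rewrite ltr_pM2l.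
have -> : e = d * (4 * C + 1) by rewrite /d divfK// gt_eqF.
have d2 : 0 <= d ^+ 2 by exact: sqr_ge0.
have C2 : 4 * C <= (4 * C + 1) ^+ 2.
  rewrite -subr_ge0 (_ : _ - _ = 16 * C * C + 4 * C + 1); last by ring.
  by rewrite !addr_ge0// !mulr_ge0// ltW.
have -> : C * (4 * d ^+ 2) = d ^+ 2 * (4 * C) by ring.
by rewrite [leRHS]exprMn; exact: ler_wpM2l.
Qed.

End domain_density.

Lemma inner_norms_equivalent (R : realType) (p : params R) : admissible p -> structural p ->
  exists C1 C2 : R, [/\ 0 < C1, 0 < C2,
    forall X, Hspace p X -> norm2 p X <= C1 * norm1 p X &
    forall X, Hspace p X -> norm1 p X <= C2 * norm2 p X].
Proof.
move=> hp hS.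
have [C C0 hC] := inner2_qform_le hp; have [c c0 hc] := inner2_qform_ge hp hS.
have cmp (M : state p -> state p -> R) (M' : state p -> state p -> R) X :
    M X X <= C * qform X -> c * qform X <= M' X X ->
    Num.sqrt (M X X) <= Num.sqrt (C / c) * Num.sqrt (M' X X).
  move=> h h'; rewrite -sqrtrM ?divr_ge0 ?(ltW C0) ?(ltW c0)//; apply: ler_wsqrtr.
  by rewrite (le_trans h)// -mulrA ler_pM2l// mulrC ler_pdivlMr// mulrC.
exists (Num.sqrt (C / c)), (Num.sqrt (C / c)).
have k0 : 0 < Num.sqrt (C / c) by rewrite sqrtr_gt0 divr_gt0.
by split=> // X HX; have [h1 h2] := hC X HX; have [h3 h4] := hc X HX; exact: cmp.
Qed.

Theorem theorem15 (R : realType) (p : params R)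
    (T : R -> state p -> state p)
    (hp : admissible p) (hS : structural p)
    (hT : C0_semigroup (Hspace p) (norm1 p) T)
    (hA : generator (Hspace p) (norm1 p) T (domA p) (opA p)) :
  (exists2 Lambda : R, 0 < Lambda &
     forall X0, domA p X0 -> forall t, 0 <= t ->
       augmented_energy T X0 t
         <= augmented_energy T X0 0 * expR (- Lambda * t)) /\
  C0_semigroup (Hspace p) (norm2 p) T /\
  exp_stable (Hspace p) (norm2 p) T.
Proof.
have sH := Hspace_subspace (l_gt0 hp).
have [C1 [C2 [C10 C20 N12 N21]]] := inner_norms_equivalent hp hS.
have n1 X : 0 <= norm1 p X by exact: sqrtr_ge0.
have n2 X : 0 <= norm2 p X by exact: sqrtr_ge0.
have hT2 : C0_semigroup (Hspace p) (norm2 p) T .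
  exact: (equivalent_C0_semigroup sH C10 n1 n2 N12 N21 hT).
have hA2 : generator (Hspace p) (norm2 p) T (domA p) (opA p).
  exact: (equivalent_generator sH C10 C20 n1 n2 N12 N21 (C0_stable hT) hA).
have [k k0 hk] := opA_dissipative hp hS; have [C C0 hC] := inner2_qform_le hp.
(* The dissipation is measured by [qform]; [inner2 <= C * qform] turns it into a rate relative to
   the energy. *)
pose c := k / C; have c0 : 0 < c by rewrite divr_gt0.
have diss X : domA p X -> inner2 (opA p X) X <= - c * inner2 X X.
  move=> dX; apply: le_trans (hk X dX) _; rewrite !mulNr lerN2.
  have [HX _ _] := (hA X (opA p X)).1 (conj dX erefl).
  have [_ h] := hC X HX.
  rewrite /c mulrAC ler_pdivrMr// -mulrA ler_pM2l// mulrC.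
  exact: h.
have pB := inner2_psd hp hS.
split; last first.
  by split=> //; exact: (decay_exp_stable sH pB hT2 hA2 c0 diss (domA_dense hp)).
(* The energy is quadratic, hence twice the rate of the norm. *)
exists (2 * c); first by rewrite mulr_gt0.
move=> X dX t t0; have decay := decay_on_domain sH pB hT2 hA2 c0 diss dX t0.
have [HX _ _] := (hA X (opA p X)).1 (conj dX erefl).
have n2E Y : Hspace p Y -> norm2 p Y ^+ 2 = inner2 Y Y.
  by move=> HY; apply: sqr_sqrtr; exact: psd_ge0 pB _ HY.
rewrite /augmented_energy -mulrA ler_pM2l ?invr_gt0// (C0_id hT HX).
by rewrite (n2E _ HX) (n2E _ (C0_stable hT t0 HX)).
Qed.
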